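(* Let $K\subset\mathbb{R}^d$ be a compact convex set, let $\Lambda$ be a measurable space of parameters, and for each $\lambda\in\Lambda$ let $G(\cdot;\lambda)\in L^1(\mathbb{R}^d)$ be a real-valued function. For each $\lambda\in\Lambda$ let $F(z;\lambda)$, $z\in\mathbb{C}^d$, be an entire function of exponential type with respect to $K$. Let $\nu$ be a non-negative measure on $\Lambda$ that satisfies $$\int_\Lambda\int_{\mathbb{R}^d}|F(x;\lambda)-G(x;\lambda)|\,dx\,d\nu(\lambda)<\infty \qquad (\ast)$$ and $$\int_\Lambda\int_{\mathbb{R}^d}|\hat G(x;\lambda)\varphi(x)|\,dx\,d\nu(\lambda)<\infty$$ for all Schwartz functions $\varphi\in\mathcal{S}(\mathbb{R}^d)$ supported in $K^c=\mathbb{R}^d\setminus K$. Let $\mathcal{G}\in\mathcal{S}'(\mathbb{R}^d)$ be a real-valued continuous function such that $$\hat{\mathcal{G}}(\varphi)=\int_{\mathbb{R}^d}\int_\Lambda\hat G(x;\lambda)\,d\nu(\lambda)\,\varphi(x)\,dx$$ for all $\varphi\in\mathcal{S}(\mathbb{R}^d)$ supported in $K^c$. (i) If $G(x;\lambda)\le F(x;\lambda)$ for each $x\in\mathbb{R}^d$ and $\lambda\in\Lambda$, then there exists a real entire function $\mathcal{M}$ of exponential type with respect to $K$ such that $\mathcal{M}(x)\ge\mathcal{G}(x)$ for all $x\in\mathbb{R}^d$ and $\int_{\mathbb{R}^d}\{\mathcal{M}(x)-\mathcal{G}(x)\}\,dx$ is equal to the quantity in $(\ast)$. (ii) If $F(x;\lambda)\le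 G(x;\lambda)$ for each $x\in\mathbb{R}^d$ and $\lambda\in\Lambda$, then there exists a real entire function $\mathcal{L}$ of exponential type with respect to $K$ such that $\mathcal{L}(x)\le\mathcal{G}(x)$ for all $x\in\mathbb{R}^d$ and $\int_{\mathbb{R}^d}\{\mathcal{G}(x)-\mathcal{L}(x)\}\,dx$ is equal to the quantity in $(\ast)$.
   Context: The Fourier transform is $\hat F(\xi)=\int_{\mathbb{R}^d}e^{-2\pi i x\cdot\xi}F(x)\,dx$ for integrable $F$, extended to tempered distributions by $\hat T(\varphi)=T(\hat\varphi)$; here $\hat G(\cdot;\lambda)$ is the Fourier transform in the $x$ variable. A function that is a tempered distribution is identified with $\varphi\mapsto\int\mathcal{G}\varphi$. An entire function $F:\mathbb{C}^d\to\mathbb{C}$ is said to be of exponential type with respect to a compact convex set $K\subset\mathbb{R}^d$ if its restriction to $\mathbb{R}^d$ is a tempered distribution whose Fourier transform is supported in $K$. An entire function on $\mathbb{C}^d$ is real entire if it is real-valued on $\mathbb{R}^d$. *)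

(* Defs.v *)
From HB Require Import structures.
From mathcomp Require Import all_boot all_order all_algebra.
From mathcomp Require Import complex.
From mathcomp Require Import all_classical all_reals all_analysis.
Set Implicit Arguments.
Unset Strict Implicit.
Unset Printing Implicit Defensive.
Import Order.TTheory GRing.Theory Num.Theory.
Import numFieldNormedType.Exports.
Local Open Scope classical_set_scope.
Local Open Scope ring_scope.

(* R^d is 'rV[R]_d and C^d is 'rV[R[i]]_d.  The measurable sets of R^d are
   those of the product sigma-algebra, i.e. the Borel sets. *)
Definition rV_display : measure_display.
Proof. exact: default_measure_display. Qed.

Section measurable_rV.
Context {R : realType} {n : nat}.

Let coors : 'I_n -> 'rV[R]_n -> measurableTypeR R := fun i x => x ord0 i.

Let rV_set0 : g_sigma_preimage coors set0.
Proof. exact: sigma_algebra0. Qed.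

Let rV_setC A : g_sigma_preimage coors A -> g_sigma_preimage coors (~` A).
Proof. exact: sigma_algebraC. Qed.

Let rV_bigcup (F : _^nat) : (forall i, g_sigma_preimage coors (F i)) ->
  g_sigma_preimage coors (\bigcup_i (F i)).
Proof. exact: sigma_algebra_bigcup. Qed.

HB.instance Definition _ := @isMeasurable.Build rV_display
  'rV[R]_n (g_sigma_preimage coors) rV_set0 rV_setC rV_bigcup.

End measurable_rV.

Section volume.
Context {R : realType}.
Local Notation RT := (measurableTypeR R).

Lemma measurable_coord n (i : 'I_n) :
  measurable_fun setT (fun x : 'rV[R]_n => x ord0 i : RT).
Proof.
move=> _ Y mY; rewrite setTI; apply: sub_sigma_algebra => /=.
rewrite -bigcup_seq/=; exists i => /=; first by rewrite mem_index_enum.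
by exists Y => //; rewrite setTI.
Qed.

Lemma measurable_fun_rV d (T : measurableType d) n (f : T -> 'rV[R]_n) :
  (forall i, measurable_fun setT (fun t => f t ord0 i : RT)) ->
  measurable_fun setT f.
Proof.
move=> mf _ Y mY; rewrite setTI.
suff : measurable `<=` [set Z : set 'rV[R]_n | measurable (f @^-1` Z)] by apply.
apply: smallest_sub.
  split => /=; first by rewrite preimage_set0.
  - by move=> A mA; rewrite setTD preimage_setC; exact: measurableC.
  - by move=> A mA; rewrite preimage_bigcup; exact: bigcup_measurable.
move=> Z; rewrite -bigcup_seq => -[i _ [B mB <-]] /=.
by rewrite setTI; have := mf i measurableT B mB; rewrite setTI.
Qed.

Definition cons_rV n (p : R * 'rV[R]_n) : 'rV[R]_n.+1 := row_mx p.1%:M p.2.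

Lemma measurable_cons_rV n :
  measurable_fun setT (@cons_rV n : RT * 'rV[R]_n -> 'rV[R]_n.+1).
Proof.
apply: measurable_fun_rV => i; rewrite /cons_rV.
have -> : i = @unsplit 1 n (@fintype.split 1 n i) by rewrite fintype.splitK.
case: (@fintype.split 1 n i) => j /=.
- rewrite (_ : (fun _ => _) = fst); first exact: measurable_fst.
  by apply/funext => p; rewrite (@row_mxEl _ 1 1 n) [j]ord1 mxE eqxx mulr1n.
- rewrite (_ : (fun _ => _) = fun p : R * 'rV[R]_n => p.2 ord0 j).
    exact: (measurableT_comp (measurable_coord j) measurable_snd).
  by apply/funext => p; rewrite (@row_mxEr _ 1 1 n).
Qed.

Definition uncons_rV n (x : 'rV[R]_n.+1) : R * 'rV[R]_n :=
  (x ord0 ord0, \row_j x ord0 (lift ord0 j)).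

Lemma cons_rVK n : cancel (@cons_rV n) (@uncons_rV n).
Proof.
case=> x v; rewrite /uncons_rV /cons_rV /=; congr pair.
  have -> : ord0 = @lshift 1 n ord0 by exact: val_inj.
  by rewrite (@row_mxEl _ 1 1 n) mxE eqxx mulr1n.
apply/rowP => j; rewrite mxE.
have -> : lift ord0 j = @rshift 1 n j by exact: val_inj.
by rewrite (@row_mxEr _ 1 1 n).
Qed.

Lemma measurable_uncons_rV n :
  measurable_fun setT (@uncons_rV n : 'rV[R]_n.+1 -> RT * 'rV[R]_n).
Proof.
apply/measurable_fun_pairP; split; first exact: measurable_coord.
apply: measurable_fun_rV => i /=.
rewrite (_ : (fun _ => _) = fun x : 'rV[R]_n.+1 => x ord0 (lift ord0 i)).
  exact: measurable_coord.
by apply/funext => x; rewrite mxE.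
Qed.

Section step.
Variables (n : nat) (m : {sigma_finite_measure set 'rV[R]_n -> \bar R}).

Definition volume_step (A : set 'rV[R]_n.+1) : \bar R :=
  ((@lebesgue_measure R) \x m)%E (@cons_rV n @^-1` A).

Let step0 : volume_step set0 = 0%E.
Proof. by rewrite /volume_step preimage_set0 measure0. Qed.

Let step_ge0 A : (0 <= volume_step A)%E.
Proof. exact: measure_ge0. Qed.

Let step_sigma_additive : semi_sigma_additive volume_step.
Proof.
exact: (@measure_semi_sigma_additive _ _ _
  (measure_function_pushforward__canonical__measure_function_Measure
     ((@lebesgue_measure R) \x m)%E (@measurable_cons_rV n))).
Qed.

HB.instance Definition _ := isMeasure.Build _ _ _
  volume_step step0 step_ge0 step_sigma_additive.

Let step_sigma_finite : sigma_finite setT volume_step.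
Proof.
have /sigma_finiteP[F [FT ndF Foo]] := sigma_finiteT (@lebesgue_measure R).
have /sigma_finiteP[G [GT ndG Goo]] := sigma_finiteT m.
exists (fun k => @uncons_rV n @^-1` (F k `*` G k)).
  apply/seteqP; split=> // x _.
  have [k _ Fk] : (\bigcup_i F i) (uncons_rV x).1 by rewrite -FT.
  have [l _ Gl] : (\bigcup_i G i) (uncons_rV x).2 by rewrite -GT.
  exists (maxn k l) => //; split.
    by move: Fk; exact/subsetPset/ndF/leq_maxl.
  by move: Gl; exact/subsetPset/ndG/leq_maxr.
move=> k; have [mF Fk] := Foo k; have [mG Gk] := Goo k; split.
  rewrite -[X in measurable X]setTI; apply: measurable_uncons_rV => //.
  exact: measurableX.
rewrite /volume_step -comp_preimage.
have -> : @uncons_rV n \o @cons_rV n = id.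
  by apply/funext => p /=; rewrite cons_rVK.
by rewrite preimage_id product_measure1E// lte_mul_pinfty// ge0_fin_numE.
Qed.

HB.instance Definition _ := @Measure_isSigmaFinite.Build _ _ _
  volume_step step_sigma_finite.

End step.

(* Lebesgue measure on R^n, as the n-fold product of Lebesgue measure on R *)
Fixpoint volume (n : nat) : {sigma_finite_measure set 'rV[R]_n -> \bar R} :=
  match n with
  | 0 => \d_(0 : 'rV[R]_0)
  | k.+1 => volume_step (volume k)
  end.

End volume.

Section integration.
Context {R : realType}.

Definition cintegral d (T : measurableType d) (mu : {measure set T -> \bar R})
    (f : T -> R[i]) : R[i] :=
  Complex (\int[mu]_x complex.Re (f x)) (\int[mu]_x complex.Im (f x)).

(* The measurable sets of 'rV[R]_n being only the Borel sets, a function is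
   Lebesgue measurable when it agrees a.e. with a measurable one.  The integral
   of the library also has the right value on such functions: for a nonnegative
   function it is a supremum over the simple functions below it. *)
Definition lebesgue_measurable n (f : 'rV[R]_n -> R) : Prop :=
  exists2 g : 'rV[R]_n -> R,
    measurable_fun setT g & {ae volume n, forall x, f x = g x}.

Definition L1 n (f : 'rV[R]_n -> R) : Prop :=
  lebesgue_measurable f /\ (\int[volume n]_x `|f x|%:E < +oo)%E.

Definition cL1 n (f : 'rV[R]_n -> R[i]) : Prop :=
  L1 (fun x => complex.Re (f x)) /\ L1 (fun x => complex.Im (f x)).

(* The a.e. clause makes this hold for every function that is measurable for
   the product of the Lebesgue sigma-algebra of R^n and that of L. *)
Definition jointly_measurable n d (L : measurableType d)
    (f : 'rV[R]_n -> L -> R) : Prop :=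
  exists2 g : 'rV[R]_n * L -> R, measurable_fun setT g &
    forall l, {ae volume n, forall x, f x l = g (x, l)}.

Definition dotrV n (x y : 'rV[R]_n) : R := \sum_(i < n) x ord0 i * y ord0 i.

Definition expi (t : R) : R[i] := Complex (cos t) (sin t).

Definition fourier n (f : 'rV[R]_n -> R[i]) (xi : 'rV[R]_n) : R[i] :=
  cintegral (volume n) (fun x => expi (- (2 * pi * dotrV x xi)) * f x).

End integration.

Section distributions.
Context {R : realType} {n : nat}.
Local Notation fn := ('rV[R]_n -> R[i]).

(* the sequence [:: i1; i2] stands for d/dx_i1 d/dx_i2 *)
Definition pderiv (s : seq 'I_n) (f : 'rV[R]_n -> R) : 'rV[R]_n -> R :=
  foldr (fun i g => 'D_(delta_mx ord0 i : 'rV[R]_n) g) f s.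

Definition smooth (f : 'rV[R]_n -> R) : Prop :=
  forall s x, differentiable (pderiv s f) x.

(* R[i] is not a normed space over R in the library, hence the real and
   imaginary parts *)
Definition cpderiv (s : seq 'I_n) (phi : fn) (x : 'rV[R]_n) : R[i] :=
  Complex (pderiv s (fun y => complex.Re (phi y)) x)
          (pderiv s (fun y => complex.Im (phi y)) x).

Definition schwartz_weight (k : nat) (s : seq 'I_n) (phi : fn)
    (x : 'rV[R]_n) : R :=
  (1 + `|x|) ^+ k * Normc.normc (cpderiv s phi x).

Definition schwartz (phi : fn) : Prop :=
  [/\ smooth (fun x => complex.Re (phi x)),
      smooth (fun x => complex.Im (phi x)) &
      forall k s, exists B, forall x, schwartz_weight k s phi x <= B].

(* A tempered distribution is a functional on all functions of which only the
   values at Schwartz functions matter. *)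
Definition tempered (T : fn -> R[i]) : Prop :=
  (forall (a : R[i]) phi psi, schwartz phi -> schwartz psi ->
     T (fun x => a * phi x + psi x) = a * T phi + T psi) /\
  (forall phi, schwartz phi -> forall eps : R, 0 < eps ->
     exists N : nat, exists2 delta : R, 0 < delta &
       forall psi, schwartz psi ->
         (forall k s x, (k <= N)%N -> (size s <= N)%N ->
            schwartz_weight k s (fun y => psi y - phi y) x < delta) ->
         Normc.normc (T psi - T phi) < eps).

Definition fourier_distr (T : fn -> R[i]) : fn -> R[i] :=
  fun phi => T (fourier phi).

Definition distr_of (f : fn) : fn -> R[i] :=
  fun phi => cintegral (volume n) (fun x => f x * phi x).

Definition tempered_fun (f : fn) : Prop :=
  (forall phi, schwartz phi -> cL1 (fun x => f x * phi x)) /\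
  tempered (distr_of f).

Definition schwartz_off (K : set 'rV[R]_n) (phi : fn) : Prop :=
  schwartz phi /\ closure [set x | phi x != 0] `<=` ~` K.

(* meant for closed K *)
Definition supported_in (T : fn -> R[i]) (K : set 'rV[R]_n) : Prop :=
  forall phi, schwartz_off K phi -> T phi = 0.

Definition rV_toC (x : 'rV[R]_n) : 'rV[R[i]]_n := map_mx (real_complex R) x.

Definition entire (F : 'rV[R[i]]_n -> R[i]) : Prop :=
  forall z, differentiable (F : 'rV[R[i]]_n -> R[i]^o) z.

Definition real_entire (F : 'rV[R[i]]_n -> R[i]) : Prop :=
  entire F /\ forall x, complex.Im (F (rV_toC x)) = 0.

Definition exp_type (K : set 'rV[R]_n) (F : 'rV[R[i]]_n -> R[i]) : Prop :=
  let f := fun x => F (rV_toC x) in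
  tempered_fun f /\ supported_in (fourier_distr (distr_of f)) K.

End distributions.

(* Main.v *)
(* Let rho = |F - G|, W = \int rho dnu, and U = W in case (i), U = - W in case (ii).  Off K the
   transform of G(.;l) is that of - rho(.;l) (resp. rho(.;l)), since F(.;l) has its spectrum in K;
   hence T = calG + U has its spectrum in K.  Let chi be smooth, equal to 1 near K, with Gaussian
   decay.  Then M(z) = \int T(y) chi^(y - z) dy is entire, and \int M g = \int T g for every Gaussian g,
   because g = psi^ with (1 - chi) psi supported off K.  As M - calG is continuous, shrinking
   Gaussians give it the sign of U, and averaging over their centres gives
   \int (M - calG) = \int U.

   T is only known to be integrable against Schwartz functions, while the difference quotients
   of chi^ have to be dominated uniformly; so rapidly decreasing bounds are majorized by
   Schwartz functions. *)
From HB Require Import structures.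
Require Import Defs.
From mathcomp Require Import all_boot all_order all_algebra.
From mathcomp Require Import complex.
From mathcomp Require Import all_classical all_reals all_analysis.
From mathcomp Require Import measurable_realfun.
From mathcomp Require Import ring lra.
Set Implicit Arguments.
Unset Strict Implicit.
Unset Printing Implicit Defensive.
Import Order.TTheory GRing.Theory Num.Theory.
Import numFieldNormedType.Exports.
Local Open Scope classical_set_scope.
Local Open Scope ring_scope.
Local Open Scope complex_scope.
Local Notation normc := Normc.normc.
Local Notation Rea := complex.Re.
Local Notation Ima := complex.Im.

(** * Complex-valued integrals *)

(** Positivity does the analytic work. Beyond integrability against Gaussians, no growth bound for M
    on R^n is at hand. But once M - calG has the sign of U, Tonelli turns the Gaussian identities
    into an equality of masses in [0, +oo], and this equality is what makes M - calG integrable.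
    Only then is M seen to be tempered, and the identities extend from Gaussians to bounded
    continuous test functions, among them the transforms of Schwartz functions; this gives the
    spectrum of M. Gaussians serve because they are positive, of mass one, explicitly transformed,
    and dominated away from their centre by a small multiple of a wider one, so that anything
    integrable against a single Gaussian can be averaged. The decay of chi makes chi^ converge at
    every complex frequency. The measure nu is arbitrary, whereas exchanging integrals calls for
    sigma-finiteness: nu is restricted to the parameters where the mass of rho(.;l) is positive and
    finite. For almost every l the function F(.;l) is integrable, being G(.;l) plus or minus
    rho(.;l), so its spectral condition becomes the vanishing off K of a continuous function. *)

Section complex_numbers.
Context {R : realType}.
Implicit Types (x y : R[i]).

Lemma ReD x y : Rea (x + y) = Rea x + Rea y.
Proof. by case: x y => a b [c d]. Qed.

Lemma ImD x y : Ima (x + y) = Ima x + Ima y.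
Proof. by case: x y => a b [c d]. Qed.

Lemma ReN x : Rea (- x) = - Rea x.
Proof. by case: x. Qed.

Lemma ImN x : Ima (- x) = - Ima x.
Proof. by case: x. Qed.

Lemma ReM x y : Rea (x * y) = Rea x * Rea y - Ima x * Ima y.
Proof. by case: x y => a b [c d]. Qed.

Lemma ImM x y : Ima (x * y) = Rea x * Ima y + Ima x * Rea y.
Proof. by case: x y => a b [c d]. Qed.

Lemma complex_ext x y : Rea x = Rea y -> Ima x = Ima y -> x = y.
Proof. by case: x y => a b [c d] /= -> ->. Qed.

Lemma normc_ge0 x : 0 <= normc x.
Proof. by case: x => a b; exact: sqrtr_ge0. Qed.

Lemma normr_Re_le x : `|Rea x| <= normc x.
Proof. by case: x => a b /=; rewrite -sqrtr_sqr ler_wsqrtr// lerDl sqr_ge0. Qed.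

Lemma normr_Im_le x : `|Ima x| <= normc x.
Proof. by case: x => a b /=; rewrite -sqrtr_sqr ler_wsqrtr// lerDr sqr_ge0. Qed.

Lemma normc_le x : normc x <= `|Rea x| + `|Ima x|.
Proof.
case: x => a b /=; rewrite -[leRHS]ger0_norm ?addr_ge0// -sqrtr_sqr ler_wsqrtr//.
rewrite sqrrD !real_normK ?num_real//.
by rewrite -addrA lerD2l lerDr mulrn_wge0// mulr_ge0.
Qed.

Lemma normc_real (a : R) : normc a%:C = `|a|.
Proof. by rewrite /= expr0n addr0 sqrtr_sqr. Qed.

Lemma normc_norm x : `|x| = (normc x)%:C.
Proof. by case: x. Qed.

End complex_numbers.

Section complex_integral.
Context {R : realType} d (T : measurableType d) (mu : {measure set T -> \bar R}).
Implicit Types (f g : T -> R[i]) (h : T -> R).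

Definition cmeasurable d' (T' : measurableType d') (f : T' -> R[i]) :=
  measurable_fun setT (fun x => Rea (f x)) /\
  measurable_fun setT (fun x => Ima (f x)).

Definition cintegrable f :=
  mu.-integrable setT (fun x => (Rea (f x))%:E) /\
  mu.-integrable setT (fun x => (Ima (f x))%:E).

Lemma integrable_dom h k : measurable_fun setT h ->
  mu.-integrable setT (fun x => (k x)%:E) ->
  (forall x, `|h x| <= k x) -> mu.-integrable setT (fun x => (h x)%:E).
Proof.
move=> mh ik hk; apply: (le_integrable measurableT _ _ ik).
  exact/measurable_EFinP.
move=> x _ /=; rewrite lee_fin (le_trans (hk x))// ler_norm//.
Qed.

Lemma integrable_addr h k : mu.-integrable setT (fun x => (h x)%:E) ->
  mu.-integrable setT (fun x => (k x)%:E) ->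
  mu.-integrable setT (fun x => (h x + k x)%:E).
Proof. by move=> hi ki; exact: (integrableD measurableT hi ki). Qed.

Lemma integrable_subr h k : mu.-integrable setT (fun x => (h x)%:E) ->
  mu.-integrable setT (fun x => (k x)%:E) ->
  mu.-integrable setT (fun x => (h x - k x)%:E).
Proof. by move=> hi ki; exact: (integrableB measurableT hi ki). Qed.

Lemma integrable_mulr (c : R) h : mu.-integrable setT (fun x => (h x)%:E) ->
  mu.-integrable setT (fun x => (c * h x)%:E).
Proof. by move=> hi; exact: (integrableZl measurableT c hi). Qed.

Lemma cmeasurable_norm d' (T' : measurableType d') (f : T' -> R[i]) :
  cmeasurable f -> measurable_fun setT (fun x => normc (f x)).
Proof.
move=> [mr mi].
have ms : measurable_fun setT (fun t : R => Num.sqrt t).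
  by apply: continuous_measurable_fun; exact: sqrt_continuous.
rewrite (_ : (fun _ => _) = fun x => Num.sqrt (Rea (f x) ^+ 2 + Ima (f x) ^+ 2)).
  apply: (measurableT_comp ms).
  by apply: measurable_funD; exact: measurable_funX.
by apply/funext => x; case: (f x).
Qed.

Lemma cintegrable_dom f h : cmeasurable f ->
  mu.-integrable setT (fun x => (h x)%:E) ->
  (forall x, normc (f x) <= h x) -> cintegrable f.
Proof.
move=> [mr mi] ih fh; split; apply: (integrable_dom _ ih) => // x.
- exact: le_trans (normr_Re_le _) (fh x).
- exact: le_trans (normr_Im_le _) (fh x).
Qed.

Lemma cintegrable_measurable f : cintegrable f -> cmeasurable f.
Proof.
by move=> [/measurable_int /measurable_EFinP ? /measurable_int /measurable_EFinP].
Qed.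

Lemma integrable_lty h : measurable_fun setT h ->
  (\int[mu]_x (`|h x|)%:E < +oo)%E -> mu.-integrable setT (fun x => (h x)%:E).
Proof. by move=> mh hoo; apply/integrableP; split=> //; exact/measurable_EFinP. Qed.

Lemma cintegrable_norm f : cintegrable f ->
  mu.-integrable setT (fun x => (normc (f x))%:E).
Proof.
move=> fi; have mf := cintegrable_measurable fi; case: fi => ir ii.
apply: (@integrable_dom _ (fun x => `|Rea (f x)| + `|Ima (f x)|)).
- exact: cmeasurable_norm.
- by apply: integrable_addr; exact: integrable_norm.
- by move=> x; rewrite ger0_norm ?normc_ge0// normc_le.
Qed.

Lemma cmeasurableD d' (T' : measurableType d') (f g : T' -> R[i]) :
  cmeasurable f -> cmeasurable g -> cmeasurable (fun x => f x + g x).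
Proof.
move=> [? ?] [? ?]; split.
  by under eq_fun do rewrite ReD; exact: measurable_funD.
by under eq_fun do rewrite ImD; exact: measurable_funD.
Qed.

Lemma cmeasurableM d' (T' : measurableType d') (f g : T' -> R[i]) :
  cmeasurable f -> cmeasurable g -> cmeasurable (fun x => f x * g x).
Proof.
move=> [? ?] [? ?]; split.
  by under eq_fun do rewrite ReM; apply: measurable_funB; exact: measurable_funM.
by under eq_fun do rewrite ImM; apply: measurable_funD; exact: measurable_funM.
Qed.

Lemma cmeasurable_real d' (T' : measurableType d') (h : T' -> R) :
  measurable_fun setT h -> cmeasurable (fun x => (h x)%:C).
Proof. by move=> mh; split=> //=; exact: measurable_cst. Qed.

Lemma cmeasurable_cst d' (T' : measurableType d') (c : R[i]) :
  cmeasurable (fun _ : T' => c).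
Proof. by split; exact: measurable_cst. Qed.

Lemma cmeasurable_comp d' (T' : measurableType d') d'' (T'' : measurableType d'')
  (f : T' -> R[i]) (k : T'' -> T') : measurable_fun setT k -> cmeasurable f ->
  cmeasurable (fun x => f (k x)).
Proof.
by move=> mk [mr mi]; split; [exact: (measurableT_comp mr)|exact: (measurableT_comp mi)].
Qed.

Lemma cintegrableD f g : cintegrable f -> cintegrable g ->
  cintegrable (fun x => f x + g x).
Proof.
move=> [? ?] [? ?]; split.
  under eq_fun do rewrite ReD.
  exact: (@integrable_addr (fun x => Rea (f x)) (fun x => Rea (g x))).
under eq_fun do rewrite ImD.
exact: (@integrable_addr (fun x => Ima (f x)) (fun x => Ima (g x))).
Qed.

Lemma cintegralD f g : cintegrable f -> cintegrable g ->
  cintegral mu (fun x => f x + g x) = cintegral mu f + cintegral mu g.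
Proof.
move=> [? ?] [? ?]; rewrite /cintegral; apply: complex_ext => /=.
  by rewrite -RintegralD//; apply: eq_Rintegral => x _; rewrite ReD.
by rewrite -RintegralD//; apply: eq_Rintegral => x _; rewrite ImD.
Qed.

Lemma cintegrableZ (c : R[i]) f : cintegrable f -> cintegrable (fun x => c * f x).
Proof.
move=> fi; have mf := cintegrable_measurable fi.
apply: (@cintegrable_dom _ (fun x => normc c * normc (f x))).
- exact: cmeasurableM (cmeasurable_cst _ _) mf.
- by apply: integrable_mulr; exact: cintegrable_norm.
- by move=> x; rewrite Normc.normcM.
Qed.

Lemma cintegralZ (c : R[i]) f : cintegrable f ->
  cintegral mu (fun x => c * f x) = c * cintegral mu f.
Proof.
move=> [fr fi]; rewrite /cintegral; apply: complex_ext; rewrite ?ReM ?ImM/=.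
  rewrite -!RintegralZl// -RintegralB//; last 2 first.
  - exact: integrable_mulr.
  - exact: integrable_mulr.
  by apply: eq_Rintegral => x _; rewrite ReM.
rewrite -!RintegralZl// -RintegralD//; last 2 first.
- exact: integrable_mulr.
- exact: integrable_mulr.
by apply: eq_Rintegral => x _; rewrite ImM.
Qed.

Lemma eq_cintegral f g : f =1 g -> cintegral mu f = cintegral mu g.
Proof. by move=> /funext ->. Qed.

Lemma cintegralN f : cintegrable f ->
  cintegral mu (fun x => - f x) = - cintegral mu f.
Proof.
move=> fi; rewrite -mulN1r -cintegralZ//; apply: eq_cintegral => x.
by rewrite mulN1r.
Qed.

Lemma cintegralB f g : cintegrable f -> cintegrable g ->
  cintegral mu (fun x => f x - g x) = cintegral mu f - cintegral mu g.
Proof.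
move=> fi gi; rewrite -cintegralN// -cintegralD//.
by under [X in cintegrable X]eq_fun do rewrite -mulN1r; exact: cintegrableZ.
Qed.

(** The factor 2 comes from bounding the real and imaginary parts separately; every use tolerates a
    constant. *)
Lemma normc_cintegral_le f h : cintegrable f ->
  mu.-integrable setT (fun x => (h x)%:E) -> (forall x, normc (f x) <= h x) ->
  normc (cintegral mu f) <= 2 * \int[mu]_x h x.
Proof.
move=> [fr fi] ih fh; apply: le_trans (normc_le _) _ => /=.
rewrite mulr_natl mulr2n lerD//.
  apply: (le_trans (le_normr_Rintegral _ _)) => //.
  apply: le_Rintegral => //; first exact: integrable_norm.
  by move=> x _; exact: le_trans (normr_Re_le _) (fh x).
apply: (le_trans (le_normr_Rintegral _ _)) => //.
apply: le_Rintegral => //; first exact: integrable_norm.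
by move=> x _; exact: le_trans (normr_Im_le _) (fh x).
Qed.

Lemma cintegral_real h : cintegral mu (fun x => (h x)%:C) = (\int[mu]_x h x)%:C.
Proof. by rewrite /cintegral/= Rintegral_cst//= mul0r. Qed.

Lemma cintegrable_real h : mu.-integrable setT (fun x => (h x)%:E) ->
  cintegrable (fun x => (h x)%:C).
Proof. by move=> hi; split=> //=; exact: integrable0. Qed.

End complex_integral.

Section complex_fubini.
Context {R : realType} d1 d2 (T1 : measurableType d1) (T2 : measurableType d2).
Variables (m1 : {sigma_finite_measure set T1 -> \bar R}).
Variables (m2 : {sigma_finite_measure set T2 -> \bar R}).

(** Without any integrability: Tonelli makes the integrals of the positive and negative parts
    measurable in the parameter, and [fine] of their difference is measurable whatever happens where
    both are infinite. *)
Lemma measurable_Rintegral_param (f : T1 * T2 -> R) : measurable_fun setT f ->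
  measurable_fun setT (fun x => \int[m2]_y f (x, y)).
Proof.
move=> mf; rewrite /Rintegral; apply: measurableT_comp; first exact: (@fine_measurable R setT measurableT).
have mf' : measurable_fun setT (EFin \o f) by exact/measurable_EFinP.
under eq_fun do rewrite integralE.
apply: emeasurable_funB.
  rewrite (_ : (fun _ => _) = fubini_F m2 ((EFin \o f)^\+)%E).
    exact: measurable_fun_fubini_tonelli_F (measurable_funepos mf') (funepos_ge0 _).
  by apply/funext => x; apply: eq_integral => y _; rewrite !funeposE.
rewrite (_ : (fun _ => _) = fubini_F m2 ((EFin \o f)^\-)%E).
  exact: measurable_fun_fubini_tonelli_F (measurable_funeneg mf') (funeneg_ge0 _).
by apply/funext => x; apply: eq_integral => y _; rewrite !funenegE.
Qed.

Lemma cmeasurable_cintegral_param (f : T1 * T2 -> R[i]) : cmeasurable f ->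
  cmeasurable (fun x => cintegral m2 (fun y => f (x, y))).
Proof.
move=> [mr mi]; split=> /=.
  exact: (@measurable_Rintegral_param (fun z => Rea (f z))).
exact: (@measurable_Rintegral_param (fun z => Ima (f z))).
Qed.

(** The inner integrals are finite only almost everywhere; [fine] may change them on the exceptional
    null sets, hence the two passages through [ae_eq_integral]. *)
Lemma Rintegral_fubini (f : T1 * T2 -> R) : measurable_fun setT f ->
  (\int[m1]_x \int[m2]_y `|f (x, y)|%:E < +oo)%E ->
  \int[m1]_x \int[m2]_y f (x, y) = \int[m2]_y \int[m1]_x f (x, y).
Proof.
move=> mf foo.
have mf' : measurable_fun setT (EFin \o f) by exact/measurable_EFinP.
have fi : (m1 \x m2)%E.-integrable setT (EFin \o f) by exact/integrable12ltyP.
transitivity (fine (\int[m1]_x \int[m2]_y (f (x, y))%:E)%E).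
  congr fine; apply: ae_eq_integral => //.
  - apply/measurable_EFinP; exact: measurable_Rintegral_param.
  - exact: (measurable_fubini_F fi).
  have := ae_integrable1 fi; apply: filterS => x xi _.
  by rewrite /Rintegral fineK//; exact: integrable_fin_num.
transitivity (fine (\int[m2]_y \int[m1]_x (f (x, y))%:E)%E).
  by congr fine; exact: (Fubini fi).
congr fine; apply: ae_eq_integral => //.
- exact: (measurable_fubini_G fi).
- apply/measurable_EFinP/measurableT_comp; first exact: (@fine_measurable R setT measurableT).
  exact: (measurable_fubini_G fi).
have := ae_integrable2 fi; apply: filterS => x xi _.
by rewrite /Rintegral fineK//; exact: integrable_fin_num.
Qed.

Lemma iterated_integral_lty_dom (h k : T1 * T2 -> R) : measurable_fun setT h ->
  measurable_fun setT k -> (forall z, `|h z| <= k z) ->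
  (\int[m1]_x \int[m2]_y (k (x, y))%:E < +oo)%E ->
  (\int[m1]_x \int[m2]_y `|h (x, y)|%:E < +oo)%E.
Proof.
move=> mh mk hk; apply: le_lt_trans.
have k0 z : 0 <= k z by exact: le_trans (hk z).
have mh' : measurable_fun setT (fun z => (`|h z|)%:E).
  by apply/measurable_EFinP; exact: measurableT_comp.
have mk' : measurable_fun setT (fun z => (k z)%:E) by exact/measurable_EFinP.
apply: ge0_le_integral => [//||||x _].
- by move=> x _; apply: integral_ge0 => y _; rewrite lee_fin.
- by apply: (measurable_fun_fubini_tonelli_F _ mh') => z; rewrite lee_fin.
- by apply: (measurable_fun_fubini_tonelli_F _ mk') => z; rewrite lee_fin.
apply: ge0_le_integral => [//|y _|||y _].
- by rewrite lee_fin.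
- exact: (measurableT_comp mh').
- exact: (measurableT_comp mk').
- by rewrite lee_fin.
Qed.

Lemma cintegral_fubini (f : T1 * T2 -> R[i]) : cmeasurable f ->
  (\int[m1]_x \int[m2]_y (normc (f (x, y)))%:E < +oo)%E ->
  cintegral m1 (fun x => cintegral m2 (fun y => f (x, y))) =
  cintegral m2 (fun y => cintegral m1 (fun x => f (x, y))).
Proof.
move=> mf foo; have mn := cmeasurable_norm mf; case: mf => mr mi.
rewrite /cintegral; congr Complex.
  apply: (@Rintegral_fubini (fun z => Rea (f z)) mr).
  apply: (@iterated_integral_lty_dom _ (fun z => normc (f z)) mr mn) foo => z.
  exact: normr_Re_le.
apply: (@Rintegral_fubini (fun z => Ima (f z)) mi).
apply: (@iterated_integral_lty_dom _ (fun z => normc (f z)) mi mn) foo => z.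
exact: normr_Im_le.
Qed.

End complex_fubini.
(** * Derivatives of smooth functions *)

Section row_vectors.
Context {K : numDomainType} {n : nat}.
Implicit Types x : 'rV[K]_n.

Lemma norm_coord_le x i : `|x ord0 i| <= `|x|.
Proof.
rewrite [leRHS]/Num.norm/= mx_normE -[leLHS]nngE num_le.
exact: (le_bigmax _ (fun ij : 'I_1 * 'I_n => `|x ij.1 ij.2|%:nng%R) (ord0, i)).
Qed.

Lemma norm_rV_le x (e : K) : 0 <= e -> (forall i, `|x ord0 i| <= e) -> `|x| <= e.
Proof.
move=> e0 xe; change (mx_norm x <= e).
have [->//|/mx_norm_neq0[[i j] ->/=]] := eqVneq (mx_norm x) 0.
by rewrite (ord1 i).
Qed.

End row_vectors.

Section quadratic_remainder.
Context {K : numFieldType} {V W : normedModType K}.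

(** A remainder of order |h|^2 is o(h), and a bound on it can be integrated. The field is any
    [numFieldType], so that the same criterion gives real derivatives ([flat] at 0, [Lap]) and
    complex ones ([hol_ext]). *)
Lemma differentiable_quadratic (f : V -> W) (x : V) (L : {linear V -> W}) (C r : K) :
  0 <= C -> 0 < r -> continuous L ->
  (forall h, `|h| <= r -> `|f (h + x) - f x - L h| <= C * `|h| ^+ 2) ->
  differentiable f x /\ 'd f x = L :> (V -> W).
Proof.
move=> C0 r0 cL fL.
have fE : f \o shift x = cst (f x) + L +o_ 0 id.
  apply/eqaddoP => _/posnumP[e]; near=> h.
  have -> : (f \o shift x - (cst (f x) + L)) h = f (h + x) - f x - L h.
    by rewrite /= !fctE/= opprD addrA.
  have hr : `|h| <= r.
    by near: h; apply/nbhs_norm0P; exists r => //= h /= /ltW.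
  (* The denominator is [C + 1] because [C] may be 0. *)
  have he : `|h| <= e%:num / (C + 1).
    near: h; apply/nbhs_norm0P; exists (e%:num / (C + 1)) => /=.
      by rewrite divr_gt0// ltr_wpDl.
    by move=> h /= /ltW.
  apply: le_trans (fL _ hr) _; rewrite expr2 mulrA ler_wpM2r//.
  apply: (@le_trans _ _ (C * (e%:num / (C + 1)))); first by rewrite ler_wpM2l.
  rewrite mulrCA ger_pMr// ler_pdivrMr ?ltr_wpDl// mul1r lerDl.
  exact: ler01.
have dfE := diff_unique cL fE.
by split => //; apply/diff_locallyP; rewrite dfE.
Unshelve. all: by end_near. Qed.

End quadratic_remainder.

Section linear_forms.
Context {K : numFieldType} {n : nat}.
Variable c : 'I_n -> K.

Definition lform (h : 'rV[K]_n) : K^o := \sum_j c j * h ord0 j.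

Lemma lform_is_linear : linear lform.
Proof.
move=> a x y; rewrite /lform scaler_sumr -big_split/=; apply: eq_bigr => j _.
by rewrite !mxE mulrDr mulrCA.
Qed.

HB.instance Definition _ := GRing.isLinear.Build K 'rV[K]_n K^o _ lform
  lform_is_linear.

Lemma continuous_lform : continuous lform.
Proof.
move=> x; rewrite /lform.
elim: (index_enum _) => [|j s IH].
  have -> : (fun h : 'rV[K]_n => \sum_(j <- [::]) c j * h ord0 j) = cst 0.
    by apply/funext => h; rewrite big_nil.
  exact: cst_continuous.
have -> : (fun h : 'rV[K]_n => \sum_(k <- j :: s) c k * h ord0 k) =
    (fun h => c j * h ord0 j + \sum_(k <- s) c k * h ord0 k).
  by apply/funext => h; rewrite big_cons.
have cj : {for x, continuous (fun h : 'rV[K]_n => c j * h ord0 j)}.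
  apply: (continuousM (s := cst (c j)) (t := fun h : 'rV[K]_n => h ord0 j)).
    exact: cst_continuous.
  exact: coord_continuous.
exact: (continuousD cj IH).
Qed.

Lemma lform_delta i : lform (delta_mx ord0 i) = c i.
Proof.
rewrite /lform (bigD1 i)//= mxE !eqxx mulr1 big1 ?addr0// => j /negPf ji.
by rewrite mxE ji andbF mulr0.
Qed.

End linear_forms.

Section partial_derivatives.
Context {R : realType} {n : nat}.
Local Notation E := 'rV[R]_n.
Local Notation D i f := ('D_(delta_mx ord0 i : E) f).
Implicit Types (f g : E -> R) (s : seq 'I_n).

Lemma pderiv_rcons s i f : pderiv (rcons s i) f = pderiv s (D i f).
Proof. by rewrite /pderiv foldr_rcons. Qed.

Lemma pderiv_cat s1 s2 f : pderiv (s1 ++ s2) f = pderiv s1 (pderiv s2 f).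
Proof. by rewrite /pderiv foldr_cat. Qed.

Lemma smooth_diff f x : smooth f -> differentiable f x.
Proof. by move/(_ [::] x). Qed.

Lemma smooth_derivable f x v : smooth f -> derivable f x v.
Proof. by move=> fs; exact/diff_derivable/smooth_diff. Qed.

Lemma smooth_pderiv s f : smooth f -> smooth (pderiv s f).
Proof. by move=> fs t x; rewrite -pderiv_cat; exact: fs. Qed.

Lemma smooth_derive i f : smooth f -> smooth (D i f).
Proof. by move=> fs; exact: (smooth_pderiv [:: i]). Qed.

Lemma smooth_continuous f : smooth f -> continuous f.
Proof. by move=> fs x; apply: differentiable_continuous; exact: smooth_diff. Qed.

(** A finite order to induct on: by the Leibniz rule, order k + 1 for a product follows from order k
    for two products, whose sum can then be differentiated termwise. *)
Definition smooth_upto k f := forall s x, (size s < k)%N -> differentiable (pderiv s f) x.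

Lemma pderivD_upto s f g : smooth_upto (size s) f -> smooth_upto (size s) g ->
  pderiv s (f \+ g) = pderiv s f \+ pderiv s g.
Proof.
elim: s => [//|i s IH] fs gs; rewrite [LHS]/= -/(pderiv s (f \+ g)) IH; last 2 first.
- by move=> t x ts; apply: fs; exact: ltnW.
- by move=> t x ts; apply: gs; exact: ltnW.
apply/funext => x /=; rewrite -!/(pderiv s _) deriveD//.
- by apply: diff_derivable; exact: fs.
- by apply: diff_derivable; exact: gs.
Qed.

Lemma smooth_uptoW f : smooth f -> forall k, smooth_upto k f.
Proof. by move=> fs k s x _; exact: fs. Qed.

Lemma pderivD s f g : smooth f -> smooth g ->
  pderiv s (f \+ g) = pderiv s f \+ pderiv s g.
Proof. by move=> fs gs; apply: pderivD_upto; exact: smooth_uptoW. Qed.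

Lemma smoothD f g : smooth f -> smooth g -> smooth (f \+ g).
Proof.
by move=> fs gs s x; rewrite pderivD//; apply: differentiableD; [exact: fs|exact: gs].
Qed.

Lemma deriveM_fun i f g : smooth f -> smooth g ->
  D i (f \* g) = (D i f \* g) \+ (f \* D i g).
Proof.
move=> fs gs; apply/funext => x /=.
rewrite (deriveM (smooth_derivable fs) (smooth_derivable gs)) addrC.
by rewrite [X in _ = X + _]mulrC.
Qed.

Lemma smooth_uptoM k f g : smooth f -> smooth g -> smooth_upto k (f \* g).
Proof.
elim: k f g => [|k IH] f g fs gs s x; first by rewrite ltn0.
case/lastP: s => [_|s i] /=.
  by apply: differentiableM; exact: smooth_diff.
rewrite size_rcons ltnS => sk; rewrite pderiv_rcons deriveM_fun//.
rewrite pderivD_upto.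
- apply: differentiableD; apply: IH => //; exact: smooth_derive.
- move=> t y ts; apply: IH => //; first exact: smooth_derive.
  exact: leq_trans ts (ltnW sk).
- move=> t y ts; apply: IH => //; first exact: smooth_derive.
  exact: leq_trans ts (ltnW sk).
Qed.

Lemma smoothM f g : smooth f -> smooth g -> smooth (f \* g).
Proof. by move=> fs gs s x; exact: (@smooth_uptoM (size s).+1). Qed.

Definition pderivs_in (P : (E -> R) -> Prop) f := smooth f /\ forall s, P (pderiv s f).

(** Induction on the multi-index from its last entry, the derivative taken first: the Leibniz rule
    passes it to one factor, which stays in its own class. Three classes are allowed so that factors
    of different kinds can be combined, such as slow times rapid. *)
Lemma pderivs_inM (P1 P2 P3 : (E -> R) -> Prop) :
  (forall f g, P3 f -> P3 g -> P3 (f \+ g)) ->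
  (forall f g, P1 f -> P2 g -> P3 (f \* g)) ->
  forall f g, pderivs_in P1 f -> pderivs_in P2 g -> pderivs_in P3 (f \* g).
Proof.
move=> P3D P12 f g [fs fP] [gs gP]; split; first exact: smoothM.
move=> s; elim/last_ind : s f g fs fP gs gP => [|s i IH] f g fs fP gs gP.
  by apply: P12; [exact: (fP [::])|exact: (gP [::])].
rewrite pderiv_rcons deriveM_fun//.
have fis := smooth_derive i fs; have gis := smooth_derive i gs.
rewrite pderivD//; [|exact: smoothM|exact: smoothM].
apply: P3D; apply: IH => // t.
- by rewrite -pderiv_rcons; exact: fP.
- by rewrite -pderiv_rcons; exact: gP.
Qed.

Lemma pderivs_inD (P : (E -> R) -> Prop) :
  (forall f g, P f -> P g -> P (f \+ g)) ->
  forall f g, pderivs_in P f -> pderivs_in P g -> pderivs_in P (f \+ g).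
Proof.
move=> PD f g [fs fP] [gs gP]; split; first exact: smoothD.
by move=> s; rewrite pderivD//; exact: PD.
Qed.

Lemma pderivs_in_pderiv P s f : pderivs_in P f -> pderivs_in P (pderiv s f).
Proof.
move=> [fs fP]; split; first exact: smooth_pderiv.
by move=> t; rewrite -pderiv_cat.
Qed.

Lemma pderivs_in_derive P i f : pderivs_in P f -> pderivs_in P (D i f).
Proof. exact: (@pderivs_in_pderiv P [:: i]). Qed.

Lemma pderivs_inS (P Q : (E -> R) -> Prop) f :
  (forall g, P g -> Q g) -> pderivs_in P f -> pderivs_in Q f.
Proof. by move=> PQ [fs fP]; split=> // s; exact: PQ. Qed.

(** [J] lists a function of one variable and its successive derivatives; along an affine form the
    chain rule only contributes one coefficient [c i] per derivative. Constants, coordinates, sines,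
    cosines and [flat] all become smooth functions on R^n this way. *)
Lemma pderiv_jet (J : nat -> R -> R) (c : 'I_n -> R) (b : R) s :
  (forall k (t : R), is_derive t (1 : R) (J k) (J k.+1 t)) ->
  let l := fun x : E => b + lform c x in
  pderiv s (J 0 \o l) = fun x => \prod_(i <- s) c i * J (size s) (l x).
Proof.
move=> Jd l; elim: s => [|i s IH].
  by apply/funext => x; rewrite big_nil mul1r.
rewrite [LHS]/= -/(pderiv s _) IH; apply/funext => x.
have dl : is_diff x l (lform c).
  have dc : is_diff x (lform c : E -> R^o) (lform c).
    apply: DiffDef; first exact: (linear_differentiable _ (@continuous_lform _ _ c)).
    exact: (diff_lin _ (@continuous_lform _ _ c)).
  apply: (is_diff_eq (is_diffD (is_diff_cst b x) dc)).
  by rewrite add0r.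
have dJ k : is_diff (l x) (J k) ( *:%R^~ (J k.+1 (l x))).
  have Jk := Jd k (l x).
  have Jk' : derivable (J k) (l x) 1 by exact: ex_derive.
  apply: DiffDef; first exact/derivable1_diffP.
  by rewrite deriv1E// derive1E (derive_val (is_derive := Jk)).
have dJl := is_diff_comp dl (dJ (size s)).
rewrite deriveMl; last first.
  by apply: diff_derivable; exact: (ex_diff (is_diff_def := dJl)).
rewrite deriveE; last exact: (ex_diff (is_diff_def := dJl)).
rewrite (diff_val (is_diff_def := dJl)) /= lform_delta big_cons.
by rewrite /GRing.scale/= mulrCA mulrA.
Qed.

End partial_derivatives.
(** * Growth and decay *)

Section growth.
Context {R : realType} {V : normedModType R}.
Implicit Types (f g : V -> R) (Z : R).

Definition poly_growth f := exists k B, forall x, `|f x| <= B * (1 + `|x|) ^+ k.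

(* [rapid 0] is rapid decay in the sense of the Schwartz space; the exponential
   weight makes the Fourier integral converge at complex frequencies. *)
Definition rapid Z f := forall k, exists B, forall x,
  expR (Z * `|x|) * (1 + `|x|) ^+ k * `|f x| <= B.

Lemma weight_ge1 (x : V) : 1 <= 1 + `|x|.
Proof. by rewrite lerDl. Qed.

Lemma weight_gt0 (x : V) : 0 < 1 + `|x|.
Proof. by rewrite ltr_pwDl. Qed.

Lemma weightX_ge0 (x : V) k : 0 <= (1 + `|x|) ^+ k.
Proof. by rewrite exprn_ge0// ltW// weight_gt0. Qed.

Lemma weightX_gt0 (x : V) k : 0 < (1 + `|x|) ^+ k.
Proof. by rewrite exprn_gt0// weight_gt0. Qed.

Lemma poly_growth_bound f : poly_growth f ->
  exists k B, 0 <= B /\ forall x, `|f x| <= B * (1 + `|x|) ^+ k.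
Proof.
move=> [k [B fB]]; exists k, `|B|; split=> // x.
by rewrite (le_trans (fB x))// ler_wpM2r ?weightX_ge0// ler_norm.
Qed.

Lemma poly_growthM f g : poly_growth f -> poly_growth g -> poly_growth (f \* g).
Proof.
move=> [k [B fB]] [l [C gC]]; exists (k + l)%N, (B * C) => x.
by rewrite normrM exprD mulrACA; apply: ler_pM.
Qed.

Lemma poly_growthD f g : poly_growth f -> poly_growth g -> poly_growth (f \+ g).
Proof.
move=> /poly_growth_bound[k [B [B0 fB]]] /poly_growth_bound[l [C [C0 gC]]].
exists (k + l)%N, (B + C) => x; rewrite (le_trans (ler_normD _ _))// mulrDl.
apply: lerD.
  apply: le_trans (fB x) _; rewrite ler_wpM2l// exprD ler_peMr ?weightX_ge0//.
  by rewrite exprn_ege1 ?weight_ge1.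
apply: le_trans (gC x) _; rewrite ler_wpM2l// exprD ler_peMl ?weightX_ge0//.
by rewrite exprn_ege1 ?weight_ge1.
Qed.

Lemma poly_growth_bounded f B : (forall x, `|f x| <= B) -> poly_growth f.
Proof. by move=> fB; exists 0%N, B => x; rewrite expr0 mulr1. Qed.

Lemma rapid_bound Z f k : rapid Z f -> exists2 B, 0 <= B & forall x,
  `|f x| <= B * expR (- (Z * `|x|)) / (1 + `|x|) ^+ k.
Proof.
move=> /(_ k)[B fB]; exists `|B| => // x.
rewrite ler_pdivlMr ?weightX_gt0// expRN ler_pdivlMr ?expR_gt0//.
apply: le_trans (ler_norm B).
rewrite (_ : _ * _ * _ = expR (Z * `|x|) * (1 + `|x|) ^+ k * `|f x|)//.
by ring.
Qed.

Lemma rapidD Z f g : rapid Z f -> rapid Z g -> rapid Z (f \+ g).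
Proof.
move=> fr gr k; have [B fB] := fr k; have [C gC] := gr k; exists (B + C) => x.
by apply: le_trans (lerD (fB x) (gC x)); rewrite -mulrDr ler_wpM2l ?ler_normD.
Qed.

Lemma rapidM Z f g : poly_growth f -> rapid Z g -> rapid Z (f \* g).
Proof.
move=> /poly_growth_bound[k [B [B0 fB]]] gr l.
have [C gC] := gr (k + l)%N; exists (B * C) => x.
apply: le_trans (ler_wpM2l B0 (gC x)); rewrite normrM exprD.
rewrite [leRHS](_ : _ = expR (Z * `|x|) * (1 + `|x|) ^+ l *
  ((B * (1 + `|x|) ^+ k) * `|g x|)); last by ring.
by rewrite ler_wpM2l ?ler_wpM2r.
Qed.

Lemma rapid_le Z Z' f : Z <= Z' -> rapid Z' f -> rapid Z f.
Proof.
move=> ZZ fr k; have [B fB] := fr k; exists B => x.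
apply: le_trans (fB x); rewrite -!mulrA ler_wpM2r//.
by rewrite ler_expR ler_wpM2r.
Qed.

Lemma rapid_dom Z f g C : (forall x, `|f x| <= C * `|g x|) -> rapid Z g -> rapid Z f.
Proof.
move=> fg gr k; have [B gB] := gr k; exists (`|C| * B) => x.
apply: le_trans (ler_wpM2l (normr_ge0 C) (gB x)); rewrite mulrCA.
apply: ler_wpM2l; first by rewrite mulr_ge0 ?expR_ge0 ?weightX_ge0.
by apply: (le_trans (fg x)); rewrite ler_wpM2r// ler_norm.
Qed.

Lemma rapid_poly_growth Z f : 0 <= Z -> rapid Z f -> poly_growth f.
Proof.
move=> Z0 /(rapid_le Z0)/(_ 0%N)[B fB]; apply: (@poly_growth_bounded _ B) => x.
by apply: le_trans (fB x); rewrite mul0r expR0 expr0 !mul1r.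
Qed.

Lemma rapid_gauss (q : V -> R) c C : 0 < c ->
  (forall x, q x <= C - c * `|x| ^+ 2) -> forall Z, rapid Z (expR \o q).
Proof.
(* As 1 + t <= e^t, the weights are at most e^((Z + k) |x|), and (Z + k) t - c t^2 has maximum (Z +
   k)^2 / (4 c); the difference is the completed square below. *)
move=> c0 qC Z k; exists (expR (C + (Z + k%:R) ^+ 2 / (4 * c))) => x /=.
rewrite ger0_norm ?expR_ge0//.
have wk : (1 + `|x|) ^+ k <= expR (k%:R * `|x|).
  by rewrite mulrC expRM_natr lerXn2r ?nnegrE ?expR_ge0 ?expR_ge1Dx.
apply: (@le_trans _ _ (expR (Z * `|x|) * expR (k%:R * `|x|) * expR (q x))).
  by rewrite ler_wpM2r ?expR_ge0// ler_wpM2l ?expR_ge0.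
rewrite -!expRD ler_expR (le_trans (lerD (lexx _) (qC x)))//.
rewrite -subr_ge0 (_ : _ - _ =
  ((Z + k%:R) / (2 * c) - `|x|) ^+ 2 * c).
  by rewrite mulr_ge0 ?sqr_ge0// ltW.
by field; rewrite gt_eqF.
Qed.

End growth.

Section smooth_growth.
Context {R : realType} {n : nat}.
Local Notation E := 'rV[R]_n.
Local Notation D i f := ('D_(delta_mx ord0 i : E) f).
Implicit Types (f g : E -> R) (s : seq 'I_n).

Notation slow := (pderivs_in (@poly_growth R E)).

Lemma slowM f g : slow f -> slow g -> slow (f \* g).
Proof. by apply: pderivs_inM; [exact: poly_growthD|exact: poly_growthM]. Qed.

Lemma slowD f g : slow f -> slow g -> slow (f \+ g).
Proof. by apply: pderivs_inD; exact: poly_growthD. Qed.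

Lemma slow_rapid Z f g : slow f -> pderivs_in (rapid Z) g ->
  pderivs_in (rapid Z) (f \* g).
Proof. by apply: pderivs_inM => u v; [exact: rapidD|exact: rapidM]. Qed.

Lemma lform_le (c : 'I_n -> R) (x : E) :
  `|lform c x| <= (\sum_j `|c j|) * `|x|.
Proof.
rewrite /lform mulr_suml (le_trans (ler_norm_sum _ _ _))//.
by apply: ler_sum => j _; rewrite normrM ler_wpM2l// norm_coord_le.
Qed.

Lemma slow_jet (J : nat -> R -> R) (c : 'I_n -> R) (b : R) :
  (forall k (t : R), is_derive t (1 : R) (J k) (J k.+1 t)) ->
  (forall k, poly_growth (J k)) ->
  slow (fun x => J 0%N (b + lform c x)).
Proof.
move=> Jd Jg; split.
  move=> s x; rewrite (pderiv_jet c b s Jd).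
  apply: differentiableM; first exact: differentiable_cst.
  apply: (@differentiable_comp _ _ _ _ (fun x => b + lform c x)).
    apply: (@differentiableD _ _ _ (cst b) (lform c)).
      exact: differentiable_cst.
    by apply: linear_differentiable; exact: continuous_lform.
  by apply/derivable1_diffP; apply: ex_derive.
move=> s; rewrite (pderiv_jet c b s Jd).
apply: (@poly_growthM _ _ (cst _) (fun x => J (size s) (b + lform c x))).
  by apply: (@poly_growth_bounded _ _ _ `|\prod_(i <- s) c i|).
have [k [B [B0 JB]]] := poly_growth_bound (Jg (size s)).
(* Chosen so that 1 + |b + lform c x| <= C (1 + |x|). *)
pose C := 1 + `|b| + \sum_j `|c j|.
have S0 : 0 <= \sum_j `|c j| by apply: sumr_ge0.
exists k, (B * C ^+ k) => x; apply: le_trans (JB _) _.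
rewrite -mulrA ler_wpM2l// -exprMn lerXn2r ?nnegrE ?addr_ge0//.
  by rewrite mulr_ge0 ?addr_ge0.
apply: (@le_trans _ _ (1 + (`|b| + (\sum_j `|c j|) * `|x|))).
  by rewrite lerD2l (le_trans (ler_normD _ _))// lerD2l lform_le.
rewrite /C; have x0 := normr_ge0 x; have b0 := normr_ge0 b.
rewrite mulrDr mulr1 !mulrDl mul1r.
have := mulr_ge0 b0 x0.
lra.
Qed.

Lemma slow_cst (a : R) : slow (fun=> a).
Proof.
pose J k := if k is 0 then (cst a : R -> R) else cst 0.
apply: (@slow_jet J (fun=> 0) 0).
  by case=> [|k] t; apply: is_derive_cst.
by case=> [|k]; [apply: (@poly_growth_bounded _ _ _ `|a|)|
  apply: (@poly_growth_bounded _ _ _ 0) => x; rewrite normr0].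
Qed.

Lemma slow_lform (c : 'I_n -> R) : slow (fun x => lform c x).
Proof.
pose J k := if k is 0 then (id : R -> R) else if k is 1 then cst 1 else cst 0.
have /= := @slow_jet J c 0.
under [X in _ -> _ -> pderivs_in _ X]eq_fun do rewrite add0r.
apply.
  by case=> [|[|k]] t; [exact: is_derive_id|exact: is_derive_cst|exact: is_derive_cst].
case=> [|[|k]].
- by exists 1%N, 1 => x; rewrite mul1r expr1 lerDr.
- by apply: (@poly_growth_bounded _ _ _ 1) => x; rewrite normr1.
- by apply: (@poly_growth_bounded _ _ _ 0) => x; rewrite normr0.
Qed.

Lemma slow_coord j : slow (fun x => x ord0 j).
Proof.
have := slow_lform (fun i => (i == j)%:R).
under [X in pderivs_in _ X -> _]eq_fun => x.
  rewrite /lform (bigD1 j)//= eqxx mul1r big1 ?addr0; last first.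
    by move=> i /negPf ->; rewrite mul0r.
  over.
by [].
Qed.

Lemma slow_cos (c : 'I_n -> R) : slow (fun x => cos (lform c x)).
Proof.
(* The cycle cos, -sin, -cos, sin: the sign flips on entering odd orders, hence [uphalf]. For the
   sine it flips on entering even orders, hence [k./2] there. *)
pose J k (t : R) := (-1) ^+ uphalf k * (if odd k then sin t else cos t).
have -> : (fun x => cos (lform c x)) = (fun x => J 0%N (0 + lform c x)).
  by apply/funext => x; rewrite /J/= mul1r add0r.
apply: slow_jet.
  move=> k t; rewrite /J uphalf_half /=; case: (odd k) => /=.
    exact: is_derive_eq.
  by apply: is_derive_eq; rewrite exprS mulN1r mulNr; rewrite /GRing.scale/= mulrN.
move=> k; apply: (@poly_growth_bounded _ _ _ 1) => t.
rewrite /J normrM normrX normrN1 expr1n mul1r ler_norml.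
by case: ifP; rewrite ?cos_geN1 ?cos_le1 ?sin_geN1 ?sin_le1.
Qed.

Lemma slow_sin (c : 'I_n -> R) : slow (fun x => sin (lform c x)).
Proof.
pose J k (t : R) := (-1) ^+ k./2 * (if odd k then cos t else sin t).
have -> : (fun x => sin (lform c x)) = (fun x => J 0%N (0 + lform c x)).
  by apply/funext => x; rewrite /J/= mul1r add0r.
apply: slow_jet.
  move=> k t; rewrite /J/= uphalf_half; case: (odd k) => /=.
    by apply: is_derive_eq; rewrite exprS mulN1r mulNr; rewrite /GRing.scale/= mulrN.
  exact: is_derive_eq.
move=> k; apply: (@poly_growth_bounded _ _ _ 1) => t.
rewrite /J normrM normrX normrN1 expr1n mul1r ler_norml.
by case: ifP; rewrite ?cos_geN1 ?cos_le1 ?sin_geN1 ?sin_le1.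
Qed.

Lemma slow_sum (I : Type) (r : seq I) (f : I -> E -> R) :
  (forall i, slow (f i)) -> slow (fun x => \sum_(i <- r) f i x).
Proof.
move=> fs; elim: r => [|i r IH].
  by under eq_fun do rewrite big_nil; exact: slow_cst.
by under eq_fun do rewrite big_cons; exact: slowD.
Qed.

Lemma slow_prod (I : Type) (r : seq I) (f : I -> E -> R) :
  (forall i, slow (f i)) -> slow (fun x => \prod_(i <- r) f i x).
Proof.
move=> fs; elim: r => [|i r IH].
  by under eq_fun do rewrite big_nil; exact: slow_cst.
by under eq_fun do rewrite big_cons; exact: slowM.
Qed.

(** Differentiating p e^q in direction i replaces p by D_i p + p D_i q, which is slow again. *)
Lemma pderiv_expR (q : E -> R) s : slow q ->
  exists2 p, slow p & pderiv s (expR \o q) = p \* (expR \o q).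
Proof.
move=> qs; elim: s => [|i s [p ps IH]].
  by exists (fun=> 1); [exact: slow_cst|apply/funext => x /=; rewrite mul1r].
exists (D i p \+ p \* D i q).
  by apply: slowD; [|apply: slowM => //]; exact: pderivs_in_derive.
rewrite [LHS]/= -/(pderiv s _) IH; apply/funext => x /=.
have qd : differentiable q x by apply: smooth_diff; case: qs.
have eq : is_diff x (expR \o q) (( *:%R^~ (expR (q x))) \o 'd q x).
  apply: is_diff_comp; first exact: differentiableP.
  apply: DiffDef; first by apply/derivable1_diffP; exact: derivable_expR.
  by rewrite deriv1E; [rewrite derive1E derive_val|exact: derivable_expR].
rewrite deriveM; last 2 first.
- by apply: smooth_derivable; case: ps.
- by apply: diff_derivable; exact: (ex_diff (is_diff_def := eq)).
rewrite [in X in _ *: X + _]deriveE; last exact: (ex_diff (is_diff_def := eq)).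
rewrite (diff_val (is_diff_def := eq)) /= -deriveE// /GRing.scale/=.
by rewrite mulrDl addrC mulrA [expR _ * _]mulrC.
Qed.

Lemma smooth_expR (q : E -> R) : slow q -> smooth (expR \o q).
Proof.
move=> qs s x; have [p ps ->] := pderiv_expR s qs.
apply: differentiableM; first by apply: smooth_diff; case: ps.
apply: differentiable_comp; first by apply: smooth_diff; case: qs.
by apply/derivable1_diffP; exact: derivable_expR.
Qed.

Lemma rapid_expR (q : E -> R) c C : slow q -> 0 < c ->
  (forall x, q x <= C - c * `|x| ^+ 2) ->
  forall Z, pderivs_in (rapid Z) (expR \o q).
Proof.
move=> qs c0 qC Z; split; first exact: smooth_expR.
move=> s; have [p [_ pg] ->] := pderiv_expR s qs.
by apply: rapidM; [exact: (pg [::])|exact: (rapid_gauss c0 qC)].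
Qed.

End smooth_growth.
Notation slow := (pderivs_in (@poly_growth _ _)).
(** * Bump functions and plateaus *)

Section flat_function.
Context {R : realType}.
Implicit Types (p : {poly R}) (t : R).

(* [flat 1] is the function exp(-1/t) extended by 0 to t <= 0; its derivatives
   are the [flat p]. *)
Definition flat p t : R := if 0 < t then p.[t^-1] * expR (- t^-1) else 0.

(** Induction on the Horner form: half of the exponential rate absorbs the new factor, as u e^(- a u
    / 2) <= 2 / a, and the other half is left to the induction hypothesis. *)
Lemma poly_expR_bounded p (a : R) : 0 < a ->
  exists2 C, 0 <= C & forall u, 0 <= u -> `|p.[u]| * expR (- (a * u)) <= C.
Proof.
elim/poly_ind: p a => [|p c IH] a a0.
  by exists 0 => // u _; rewrite horner0 normr0 mul0r.
have a2 : 0 < a / 2 by rewrite divr_gt0.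
have [C C0 pC] := IH _ a2.
exists (C * (2 / a) + `|c|); first by rewrite addr_ge0// mulr_ge0// divr_ge0// ltW.
move=> u u0; rewrite hornerMXaddC.
have eu : u * expR (- (a / 2 * u)) <= 2 / a.
  rewrite expRN ler_pdivrMr ?expR_gt0//.
  apply: (@le_trans _ _ (2 / a * (a / 2 * u))).
    by rewrite (_ : 2 / a * (a / 2 * u) = u)//; field; rewrite gt_eqF.
  rewrite ler_wpM2l ?divr_ge0 ?(ltW a0)//.
  by apply: le_trans (expR_ge1Dx _); rewrite lerDr.
apply: (@le_trans _ _ ((`|p.[u]| * u + `|c|) * expR (- (a * u)))).
  rewrite ler_wpM2r ?expR_ge0// (le_trans (ler_normD _ _))//.
  by rewrite normrM (ger0_norm u0).
rewrite mulrDl; apply: lerD; last first.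
  by rewrite ler_piMr// -expR0 ler_expR oppr_le0 mulr_ge0// ltW.
have -> : - (a * u) = - (a / 2 * u) + - (a / 2 * u) by field.
by rewrite expRD mulrACA; apply: ler_pM => //;
  [by rewrite mulr_ge0 ?expR_ge0|exact: pC].
Qed.

Lemma flat_bounded p : exists2 C, 0 <= C & forall t, `|flat p t| <= C.
Proof.
have [C C0 pC] := @poly_expR_bounded p 1 ltr01.
exists C => // t; rewrite /flat; case: ifPn => [t0|_]; last by rewrite normr0.
rewrite normrM (ger0_norm (expR_ge0 _)) -[X in - X]mul1r; apply: pC.
by rewrite invr_ge0 ltW.
Qed.

Lemma flat_le0 p t : t <= 0 -> flat p t = 0.
Proof. by move=> t0; rewrite /flat ltNge t0. Qed.

(** For t > 0 the quotient of [flat p t] by t^2 is [flat ('X^2 * p) t], which is bounded. This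
    yields the zero derivative at the origin. *)
Lemma flat_quadratic p : exists2 C, 0 <= C & forall t, `|flat p t| <= C * `|t| ^+ 2.
Proof.
have [C C0 pC] := flat_bounded ('X^2 * p); exists C => // t.
have := pC t; rewrite /flat; case: ifPn => [t0|_ _]; last first.
  by rewrite normr0 mulr_ge0.
rewrite hornerM hornerXn -mulrA normrM ger0_norm ?exprn_ge0 ?invr_ge0 ?(ltW t0)//.
by rewrite (gtr0_norm t0) exprVn mulrC ler_pdivrMr// exprn_gt0.
Qed.

(** For t > 0 the derivative of p(1/t) e^(-1/t) is t^-2 (p - p')(1/t) e^(-1/t), of the same shape,
    so the family is closed under differentiation. At 0 the quadratic bound decides. *)
Lemma is_derive_flat p t : is_derive t (1 : R) (flat p) (flat ('X^2 * (p - p^`())) t).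
Proof.
have [t0|t0|t0] := ltrgtP t 0.
- rewrite (flat_le0 _ (ltW t0)).
  apply: (@near_eq_is_derive _ _ _ (cst 0)).
  by near=> s; rewrite flat_le0// ltW//; near: s; exact: lt_nbhsl.
- have -> : flat ('X^2 * (p - p^`())) t =
    p.[t^-1] * (expR (- t^-1) * - (- t ^- 2)) + expR (- t^-1) * (- t ^- 2 * p^`().[t^-1]).
    by rewrite /flat t0 hornerM hornerXn hornerD hornerN exprVn; ring.
  have tn0 : t != 0 by rewrite gt_eqF.
  have iv : is_derive t (1 : R) (fun s : R => s^-1) (- t ^- 2).
    have := @is_deriveV R id t 1 1 tn0 (is_derive_id (t : R) (1 : R)).
    by rewrite /GRing.scale/= mulr1.
  have dp : is_derive t (1 : R) (fun s => p.[s^-1]) (- t ^- 2 * p^`().[t^-1]).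
    by apply: is_derive_eq; rewrite mulrC.
  have de : is_derive t (1 : R) (fun s => expR (- s^-1)) (expR (- t^-1) * - (- t ^- 2)).
    by apply: (@is_derive1_comp _ expR (fun s : R => - s^-1)).
  have D : is_derive t (1 : R) (fun s => p.[s^-1] * expR (- s^-1))
      (p.[t^-1] * (expR (- t^-1) * - (- t ^- 2)) +
       expR (- t^-1) * (- t ^- 2 * p^`().[t^-1])) by exact: is_derive_eq.
  apply: near_eq_is_derive D.
  by near=> s; rewrite /flat ifT//; near: s; exact: lt_nbhsr.
- rewrite t0 (flat_le0 _ (lexx 0)).
  have [C C0 pC] := flat_quadratic p.
  have [] := @differentiable_quadratic R R R (flat p) 0 \0 C 1 C0 ltr01.
    exact: cst_continuous.
    by move=> h _; rewrite addr0 (flat_le0 _ (lexx 0)) !subr0.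
  move=> fd fE; apply: DeriveDef; first exact/derivable1_diffP.
  by rewrite deriveE// fE.
Unshelve. all: by end_near. Qed.

Lemma flat1_ge0 t : 0 <= flat 1 t.
Proof. by rewrite /flat; case: ifP => // _; rewrite hornerC mul1r expR_ge0. Qed.

Lemma flat1_gt0 t : 0 < t -> 0 < flat 1 t.
Proof. by move=> t0; rewrite /flat t0 hornerC mul1r expR_gt0. Qed.

Lemma flat1_lower t : 1 <= t -> expR (- 1) <= flat 1 t.
Proof.
move=> t1; have t0 := lt_le_trans ltr01 t1.
by rewrite /flat t0 hornerC mul1r ler_expR lerN2 invf_le1.
Qed.

Lemma slow_flat n (c : 'I_n -> R) (b : R) :
  slow (fun x : 'rV[R]_n => flat 1 (b + lform c x)).
Proof.
pose P := fix P k : {poly R} := if k is k.+1 then 'X^2 * (P k - (P k)^`()) else 1.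
apply: (@slow_jet _ _ (fun k => flat (P k)) c b) => k.
  by move=> t; exact: is_derive_flat.
by have [C _ PC] := flat_bounded (P k); exact: poly_growth_bounded PC.
Qed.

End flat_function.

Section schwartz_functions.
Context {R : realType} {n : nat}.
Local Notation E := 'rV[R]_n.
Implicit Types (x : E) (phi : E -> R[i]).

(** The norm of row vectors is the sup norm, which is not smooth; Gaussians are built on the squared
    Euclidean length instead, comparable to [|x| ^+ 2] up to the factor [n]. *)
Definition sqnorm x : R := \sum_(j < n) x ord0 j ^+ 2.

Lemma sqnorm_ge x : `|x| ^+ 2 <= sqnorm x.
Proof.
have s0 : 0 <= sqnorm x by apply: sumr_ge0 => j _; rewrite sqr_ge0.
rewrite -ler_sqrt ?sqrtr_sqr ?normr_id// ?sqr_ge0//.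
apply: norm_rV_le => [|i]; first exact: sqrtr_ge0.
rewrite -sqrtr_sqr ler_sqrt// /sqnorm (bigD1 i)//= lerDl.
by apply: sumr_ge0 => j _; rewrite sqr_ge0.
Qed.

Lemma sqnorm_le x : sqnorm x <= n%:R * `|x| ^+ 2.
Proof.
rewrite mulr_natl -[n in _ *+ n]card_ord -sumr_const ler_sum// => j _.
by rewrite -real_normK ?num_real// lerXn2r ?nnegrE// norm_coord_le.
Qed.

Lemma slow_sqnorm : slow sqnorm.
Proof. by apply: slow_sum => j; apply: slowM; exact: slow_coord. Qed.

Lemma slow_coordM (c : R) j : slow (fun x : E => c * x ord0 j).
Proof. by apply: slowM; [exact: slow_cst|exact: slow_coord]. Qed.

Lemma slow_flat_coord (b c : R) j : slow (fun x : E => flat 1 (b + c * x ord0 j)).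
Proof.
have := slow_flat (fun i : 'I_n => if i == j then c else 0) b.
rewrite (_ : (fun x : E => _) = (fun x : E => flat 1 (b + c * x ord0 j)))//.
apply/funext => x; rewrite /lform (bigD1 j)//= eqxx big1 ?addr0// => i /negPf ->.
by rewrite mul0r.
Qed.

Definition gaussq (c : R) x := - (c * sqnorm x).

Lemma slow_gaussq c : slow (gaussq c).
Proof.
rewrite (_ : gaussq c = (fun=> - c) \* sqnorm); last first.
  by apply/funext => x; rewrite /gaussq/= mulNr.
by apply: slowM; [exact: slow_cst|exact: slow_sqnorm].
Qed.

Lemma rapid_gaussq c Z : 0 < c -> pderivs_in (rapid Z) (expR \o gaussq c).
Proof.
move=> c0; apply: (@rapid_expR _ _ _ c 0 (slow_gaussq c) c0) => x.
by rewrite sub0r lerN2 ler_wpM2l ?sqnorm_ge// ltW.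
Qed.

(** With y = x - x0, the product over j of [flat 1] at r + y_j and at r - y_j is positive exactly on
    an open cube, which is a ball of the sup norm. The Gaussian factor makes the decay estimates
    automatic: slow times rapid is rapid. *)
Lemma bump_exists (x0 : E) (r : R) : 0 < r ->
  exists phi : E -> R, [/\ pderivs_in (rapid 0) phi, forall x, 0 <= phi x,
    forall x, r <= `|x - x0| -> phi x = 0 & forall x, `|x - x0| < r -> 0 < phi x].
Proof.
move=> r0.
pose b x := \prod_(j < n) (flat 1 (r - x0 ord0 j + 1 * x ord0 j) *
                           flat 1 (r + x0 ord0 j + (-1) * x ord0 j)).
have bE x : b x = \prod_(j < n) (flat 1 (r + (x - x0) ord0 j) *
                           flat 1 (r - (x - x0) ord0 j)).
  by apply: eq_bigr => j _; rewrite !mxE; congr (flat 1 _ * flat 1 _); ring.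
exists (b \* (expR \o gaussq 1)); split.
- apply: slow_rapid; last exact: rapid_gaussq.
  by apply: slow_prod => j; apply: slowM; exact: slow_flat_coord.
- move=> x /=; rewrite mulr_ge0 ?expR_ge0//.
  by apply: prodr_ge0 => j _; rewrite mulr_ge0 ?flat1_ge0.
- move=> x rx /=; suff -> : b x = 0 by rewrite mul0r.
  have [j xj] : exists j, r <= `|(x - x0) ord0 j|.
    apply: contrapT => /forallNP xr; move: rx; apply/negP; rewrite -ltNge.
    have [xx|/mx_norm_neq0[[i j] xij]] := eqVneq (mx_norm (x - x0)) 0.
      by change (mx_norm (x - x0) < r); rewrite xx.
    change (mx_norm (x - x0) < r); rewrite xij/= (ord1 i) ltNge.
    by apply/negP; exact: xr.
  rewrite bE (bigD1 j)//=; apply/eqP; rewrite !mulf_eq0; apply/orP; left.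
  move: xj; rewrite ler_normr => /orP[xj|xj]; apply/orP.
    by right; rewrite flat_le0// subr_le0.
  by left; rewrite flat_le0//; move: xj; set y := (x - x0) _ _ => yr; lra.
- move=> x xr /=; rewrite mulr_gt0 ?expR_gt0// bE.
  apply: prodr_gt0 => j _; have xj := le_lt_trans (norm_coord_le (x - x0) j) xr.
  move: xj; rewrite ltr_norml => /andP[xl xu].
  by rewrite mulr_gt0// flat1_gt0//; [rewrite -ltrBlDl sub0r|rewrite subr_gt0].
Qed.

(** Here chi = e^q, where q is minus the sum of x_j^2 (f(x_j - A) + f(- x_j - A)) and f is [flat 1].
    All terms vanish when |x| <= A. When |x| > A + 1, the largest coordinate meets f on [1, +oo),
    where f >= e^-1, so that q <= - e^-1 |x|^2; the constant e^-1 (A + 1)^2 in [q_le] takes care of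
    the ball of radius A + 1. *)
Lemma plateau_exists (A : R) : 0 <= A ->
  exists chi : E -> R, [/\ forall Z, pderivs_in (rapid Z) chi,
    slow (fun x => 1 - chi x) & forall x, `|x| <= A -> chi x = 1].
Proof.
move=> A0.
pose q x := \sum_(j < n) (- 1) * (x ord0 j * x ord0 j *
  (flat 1 (- A + 1 * x ord0 j) + flat 1 (- A + (- 1) * x ord0 j))).
have qs : slow q.
  apply: slow_sum => j; apply: slowM; first exact: slow_cst.
  apply: slowM; first by apply: slowM; exact: slow_coord.
  by apply: slowD; exact: slow_flat_coord.
have q_le x : q x <= expR (- 1) * (A + 1) ^+ 2 - expR (- 1) * `|x| ^+ 2.
  have q0 i : 0 <= x ord0 i * x ord0 i *
      (flat 1 (- A + 1 * x ord0 i) + flat 1 (- A + (- 1) * x ord0 i)).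
    by rewrite -expr2 mulr_ge0 ?sqr_ge0// addr_ge0 ?flat1_ge0.
  have [xA|xA] := leP `|x| (A + 1).
    apply: (@le_trans _ _ 0).
      by apply: sumr_le0 => j _; rewrite mulN1r oppr_le0.
    rewrite subr_ge0 ler_wpM2l ?expR_ge0// lerXn2r ?nnegrE// addr_ge0//.
  have [j xj] : exists j, `|x| = `|x ord0 j|.
    have : mx_norm x != 0.
      by apply: contraTN xA => /eqP xx; rewrite -leNgt [leLHS]xx addr_ge0.
    by move=> /mx_norm_neq0[[i j] xij]; exists j; rewrite [LHS]xij/= (ord1 i).
  apply: (@le_trans _ _ (- (expR (- 1) * `|x| ^+ 2))); last first.
    by rewrite lerDr mulr_ge0 ?expR_ge0// exprn_ge0// addr_ge0.
  rewrite /q (bigD1 j)//= -[leRHS]addr0; apply: lerD; last first.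
    by apply: sumr_le0 => i _; rewrite mulN1r oppr_le0.
  rewrite mulN1r lerN2 -expr2 -(real_normK (num_real (x ord0 j))) -xj mulrC ler_wpM2l ?sqr_ge0//.
  have [xp|xn] := leP 0 (x ord0 j).
    rewrite -[leLHS]addr0 lerD ?flat1_ge0// flat1_lower// mul1r.
    by move: xA; rewrite xj ger0_norm// => xA; rewrite addrC lerBrDr addrC ltW.
  rewrite -[leLHS]add0r lerD ?flat1_ge0// flat1_lower// mulN1r.
  by move: xA; rewrite xj ltr0_norm// => xA; rewrite addrC lerBrDr addrC ltW.
have chir Z : pderivs_in (rapid Z) (expR \o q).
  by apply: (rapid_expR qs _ q_le); exact: expR_gt0.
exists (expR \o q); split=> //.
  have -> : (fun x => 1 - (expR \o q) x) = (fun=> 1) \+ ((fun=> -1) \* (expR \o q)).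
    by apply/funext => x /=; rewrite mulN1r.
  apply: slowD; first exact: slow_cst.
  apply: slowM; first exact: slow_cst.
  by apply: pderivs_inS (chir 0) => f; exact: rapid_poly_growth.
move=> x xA /=; rewrite /q big1 ?expR0// => j _.
have := le_trans (norm_coord_le x j) xA; rewrite ler_norml => /andP[xl xu].
rewrite !flat_le0 ?addr0 ?mulr0//.
  by rewrite mulN1r addrC -opprB opprK; lra.
by rewrite mul1r; lra.
Qed.

Lemma schwartzP phi : schwartz phi <->
  pderivs_in (rapid 0) (fun x => Rea (phi x)) /\
  pderivs_in (rapid 0) (fun x => Ima (phi x)).
Proof.
split=> [[rs js ph]|[[rs rr] [js ir]]].
  split; split=> // s k; have [B phB] := ph k s; exists B => x;
    apply: le_trans (phB x); rewrite mul0r expR0 mul1r /schwartz_weight;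
    rewrite ler_wpM2l ?weightX_ge0//.
    exact: (normr_Re_le (cpderiv s phi x)).
  exact: (normr_Im_le (cpderiv s phi x)).
split=> // k s; have [B rB] := rr s k; have [C iC] := ir s k; exists (B + C) => x.
apply: le_trans (lerD (rB x) (iC x)); rewrite mul0r expR0 mul1r -mulrDr.
by rewrite /schwartz_weight ler_wpM2l ?weightX_ge0//; exact: normc_le.
Qed.

Lemma rapidC Z : pderivs_in (rapid Z) (fun _ : E => 0).
Proof.
have -> : (fun _ : E => 0 : R) = (fun=> 0) \* (expR \o gaussq 1).
  by apply/funext => x /=; rewrite mul0r.
by apply: slow_rapid; [exact: slow_cst|exact: rapid_gaussq].
Qed.

Lemma schwartz_real (phi : E -> R) : pderivs_in (rapid 0) phi ->
  schwartz (fun x => (phi x)%:C).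
Proof. by move=> ps; apply/schwartzP; split=> //; exact: rapidC. Qed.

End schwartz_functions.
(** * Lebesgue measure on R^n *)

Section volume_theory.
Context {R : realType}.
Local Notation leb := (@lebesgue_measure R).
Local Notation RT := (measurableTypeR R).

Lemma cons_rV0 n (p : R * 'rV[R]_n) : cons_rV p ord0 ord0 = p.1.
Proof. by have := cons_rVK p; case: p => a v [-> _]. Qed.

Lemma cons_rV_lift n (p : R * 'rV[R]_n) j : cons_rV p ord0 (lift ord0 j) = p.2 ord0 j.
Proof.
have := cons_rVK p; case: p => a v [_ /rowP/(_ j)] /=.
by rewrite mxE.
Qed.

(** Measurable sets are generated by the coordinates, so boxes are measurable; an open set is the
    union of the boxes with rational centre and radius 1/(k+1) that it contains, enumerated through
    [unpickle]. *)
Lemma open_measurable_rV n (U : set 'rV[R]_n) : open U -> measurable U.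
Proof.
move=> oU.
pose box (q : 'rV[rat]_n) (k : nat) : set 'rV[R]_n :=
  [set x | forall i, `|x ord0 i - ratr (q ord0 i)| < k.+1%:R^-1].
have mbox q k : measurable (box q k).
  have -> : box q k = \bigcap_(i in [set: 'I_n])
      ((fun x : 'rV[R]_n => x ord0 i : RT) @^-1` (ball (ratr (q ord0 i) : R) k.+1%:R^-1)).
    by apply/seteqP; split=> x /= xq i; [move=> _|]; have := xq i;
      rewrite /ball/= distrC => // /(_ I).
  apply: fin_bigcap_measurable => // i _.
  rewrite -[X in measurable X]setTI; apply: measurable_coord => //.
  exact: measurable_ball.
pose F (m : nat) := if unpickle m is Some (q, k) then
  (if `[< box q k `<=` U >] then box q k else set0) else set0.
have -> : U = \bigcup_m F m.
  apply/seteqP; split=> [x Ux|x [m _]].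
    have /nbhs_ballP[e /= e0 eU] : nbhs x U by exact: open_nbhs_nbhs.
    (* Half of [e], since points of a box of radius 1/(k+1) are only within 2/(k+1) of each
       other. *)
    have [k ke] : exists k : nat, k.+1%:R^-1 < e / 2.
      have e2 : 0 < e / 2 by rewrite divr_gt0.
      have [k _ /(_ _ (leqnn k))] := near_infty_natSinv_lt (PosNum e2).
      by exists k.
    have qx i : exists q : rat, `|x ord0 i - ratr q| < k.+1%:R^-1.
      have k0 : 0 < k.+1%:R^-1 :> R by rewrite invr_gt0.
      have [|q] := @rat_in_itvoo R (x ord0 i - k.+1%:R^-1) (x ord0 i + k.+1%:R^-1).
        by rewrite ltrBlDr -addrA ltrDl addr_gt0.
      rewrite in_itv/= => /andP[ql qu]; exists q.
      by move: ql; rewrite ltrBlDr => ql; rewrite ltr_distl ltrBlDr qu ql.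
    have [q qE] := choice qx.
    pose qv : 'rV[rat]_n := \row_i q i.
    exists (pickle (qv, k)) => //; rewrite /F pickleK asboolT.
      by move=> i; rewrite mxE; exact: qE.
    move=> y yq; apply: eU; rewrite -ball_normE/=.
    apply: (@le_lt_trans _ _ (k.+1%:R^-1 + k.+1%:R^-1)); last first.
      by rewrite [ltRHS]splitr ltrD.
    apply: norm_rV_le => [|i]; first by rewrite addr_ge0.
    rewrite !mxE; have := yq i; rewrite mxE => yqi.
    rewrite -(subrK (ratr (q i)) (x ord0 i)) -addrA.
    apply: le_trans (ler_normD _ _) _; apply: lerD; first exact/ltW/qE.
    by rewrite distrC ltW.
  rewrite /F; case: unpickle => // -[q k]; case: ifPn => // /asboolP; exact.
apply: bigcupT_measurable => m; rewrite /F.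
by case: unpickle => // -[q k]; case: ifP.
Qed.

Lemma continuous_measurable_rV n (f : 'rV[R]_n -> R) :
  continuous f -> measurable_fun setT f.
Proof.
move=> /continuousP cf; apply: (measurability _ (RGenOpens.measurableE R)).
move=> _ [_ [a [b ->] <-]]; rewrite setTI; apply: open_measurable_rV.
exact/cf/interval_open.
Qed.

Lemma measurable_normrV n : measurable_fun setT (fun x : 'rV[R]_n => `|x|).
Proof. by apply: continuous_measurable_rV => x; exact: norm_continuous. Qed.

Lemma measurable_addrV n (a : 'rV[R]_n) : 
  measurable_fun setT (fun x : 'rV[R]_n => x + a).
Proof.
apply: measurable_fun_rV => i.
rewrite (_ : (fun x => _) = fun x : 'rV[R]_n => x ord0 i + a ord0 i).
  by apply: measurable_funD => //; exact: measurable_coord.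
by apply/funext => x; rewrite mxE.
Qed.

Local Open Scope ereal_scope.

Lemma ge0_integral_volumeS n (f : 'rV[R]_n.+1 -> \bar R) :
  measurable_fun setT f -> (forall x, 0 <= f x) ->
  \int[volume n.+1]_x f x = \int[leb]_t \int[volume n]_v f (cons_rV (t, v)).
Proof.
move=> mf f0.
have mc := @measurable_cons_rV R n.
transitivity (\int[pushforward (leb \x volume n) (@cons_rV R n)]_x f x).
  exact: eq_measure_integral.
rewrite ge0_integral_pushforward//= preimage_setT.
have mfc : measurable_fun setT (f \o @cons_rV R n) by exact: measurableT_comp.
exact: (@fubini_tonelli1 _ _ _ _ R leb (volume n) _ mfc (fun x => f0 _)).
Qed.

Lemma integral_volume0 (f : 'rV[R]_0 -> \bar R) :
  measurable_fun setT f -> \int[volume 0]_x f x = f 0%R.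
Proof.
by move=> mf; rewrite integral_dirac// diracE mem_set// mul1e.
Qed.

(** The image of [leb] under the shift agrees with [leb] on half-open intervals, which determine
    Lebesgue measure. *)
Lemma ge0_integral_lebesgue_shift (f : R -> \bar R) (a : R) :
  measurable_fun setT (f : RT -> \bar R) -> (forall x, 0 <= f x) ->
  \int[leb]_x f (x + a)%R = \int[leb]_x f x.
Proof.
move=> mf f0; pose sh (x : R) : RT := (x + a)%R.
have msh : measurable_fun setT (sh : RT -> RT) by exact: measurable_funD.
transitivity (\int[pushforward leb sh]_x f x).
  by rewrite ge0_integral_pushforward.
apply: eq_measure_integral => A mA _; apply/esym/lebesgue_measure_unique => //.
move=> _ [[u v]] _ <-.
change (leb `]u, v]%classic = leb (sh @^-1` `]u, v]%classic)).
have -> : sh @^-1` `]u, v]%classic = `](u - a)%R, (v - a)%R]%classic.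
  by apply/seteqP; split=> x /=; rewrite !in_itv/= /sh ltrBlDr lerBrDr.
rewrite !lebesgue_measure_itv/= !lte_fin ltrD2r.
by case: ifPn => //; rewrite -!EFinB => _; congr _%:E; ring.
Qed.

Lemma ge0_integral_volume_shift n (f : 'rV[R]_n -> \bar R) (a : 'rV[R]_n) :
  measurable_fun setT f -> (forall x, 0 <= f x) ->
  \int[volume n]_x f (x + a)%R = \int[volume n]_x f x.
Proof.
elim: n f a => [|n IH] f a mf f0.
  by apply: eq_integral => x _; congr f; apply/rowP => -[].
have mfa : measurable_fun setT (fun x : 'rV[R]_n.+1 => f (x + a)%R).
  exact: (measurableT_comp mf (measurable_addrV a)).
rewrite (ge0_integral_volumeS mfa (fun x => f0 _)) (ge0_integral_volumeS mf f0).
have mc := @measurable_cons_rV R n.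
have mfc : measurable_fun setT (f \o @cons_rV R n) by exact: measurableT_comp.
pose a' : 'rV[R]_n := (\row_j a ord0 (lift ord0 j))%R.
transitivity (\int[leb]_t \int[volume n]_v f (cons_rV (t + a ord0 ord0, v)%R)).
  apply: eq_integral => t _.
  rewrite -(IH (fun v => f (cons_rV (t + a ord0 ord0, v)%R)) a').
  - apply: eq_integral => v _; congr f; apply/rowP => j; rewrite mxE.
    case: (unliftP ord0 j) => [k ->|->]; rewrite ?cons_rV0 ?cons_rV_lift//=.
    by rewrite !mxE.
  - by apply: (measurableT_comp mfc); exact: measurable_pair1.
  - by move=> v; exact: f0.
rewrite (ge0_integral_lebesgue_shift (f := fun t => \int[volume n]_v f (cons_rV (t, v))))//.
  exact: (measurable_fun_fubini_tonelli_F _ mfc (fun x => f0 _)).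
by move=> t; exact: integral_ge0.
Qed.

Lemma ge0_integral_volume_prod n (f : 'I_n -> R -> R) (c : 'I_n -> R) :
  (forall j, measurable_fun setT (f j)) -> (forall j t, 0 <= f j t)%R ->
  (forall j, \int[leb]_t (f j t)%:E = (c j)%:E) ->
  \int[volume n]_x (\prod_(j < n) f j (x ord0 j))%:E = (\prod_(j < n) c j)%:E.
Proof.
elim: n f c => [|n IH] f c mf f0 fc.
  rewrite integral_volume0; first by rewrite !big_ord0.
  by apply/measurable_EFinP; under eq_fun do rewrite big_ord0; exact: measurable_cst.
rewrite ge0_integral_volumeS; last 2 first.
- apply/measurable_EFinP; apply: measurable_prod => j _.
  exact: (measurableT_comp (mf j) (measurable_coord j)).
- by move=> x; rewrite lee_fin; apply: prodr_ge0.
transitivity (\int[leb]_t ((f ord0 t)%:E * (\prod_(j < n) c (lift ord0 j))%:E)).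
  apply: eq_integral => t _.
  rewrite -(IH (fun j => f (lift ord0 j)))// -ge0_integralZl//; last 3 first.
  - apply/measurable_EFinP; apply: measurable_prod => j _.
    exact: (measurableT_comp (mf _) (measurable_coord j)).
  - by move=> x _; rewrite lee_fin; apply: prodr_ge0.
  - by rewrite lee_fin.
  apply: eq_integral => v _; rewrite -EFinM big_ord_recl cons_rV0.
  by under eq_bigr do rewrite cons_rV_lift.
have cc : (0 <= \prod_(j < n) c (lift ord0 j))%R.
  by apply: prodr_ge0 => j _; rewrite -lee_fin -fc integral_ge0// => t _; rewrite lee_fin.
rewrite ge0_integralZr//; first by rewrite fc -EFinM big_ord_recl.
- by apply/measurable_EFinP; exact: mf.
- by move=> t _; rewrite lee_fin.
Qed.

Lemma integral_inv_oneDsqr : \int[leb]_t ((1 + t ^+ 2)^-1)%:E = pi%:E.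
Proof.
rewrite (ge0_symfun_integralT (f := fun t : R => (oneDsqr t)^-1%R)).
- rewrite -set_itvcy integral0y_oneDsqr -EFinM; congr _%:E.
  by field.
- by move=> t; rewrite invr_ge0 (le_trans ler01).
- exact: continuous_oneDsqrV.
- by move=> t; rewrite /oneDsqr/= sqrrN.
Qed.

(** The exponent grants every coordinate a factor (1 + |x|)^2 >= 1 + x_j^2, so the weight is
    dominated by a product of n functions 1 / (1 + t^2), of integral pi^n. It is the reference
    majorant for rapidly decreasing integrands. *)
Lemma integrable_weight n :
  (volume n).-integrable setT (fun x : 'rV[R]_n => (((1 + `|x|) ^+ (2 * n))^-1)%:E).
Proof.
have mo : measurable_fun setT (fun t : R => (1 + t ^+ 2)^-1)%R.
  by apply: continuous_measurable_fun; exact: continuous_oneDsqrV.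
have iprod : (volume n).-integrable setT
    (fun x : 'rV[R]_n => (\prod_(j < n) (1 + x ord0 j ^+ 2)^-1)%:E).
  apply: integrable_lty.
    apply: measurable_prod => j _; exact: (measurableT_comp mo (measurable_coord j)).
  under eq_integral => x _.
    rewrite ger0_norm; last first.
      by apply: prodr_ge0 => j _; rewrite invr_ge0 addr_ge0 ?sqr_ge0.
    over.
  rewrite (@ge0_integral_volume_prod n (fun=> fun t => (1 + t ^+ 2)^-1)%R (fun=> pi)) ?ltry//.
    by move=> j t; rewrite invr_ge0 addr_ge0 ?sqr_ge0.
  by move=> j; exact: integral_inv_oneDsqr.
apply: (integrable_dom _ iprod).
  have mw : measurable_fun setT (fun t : R => ((1 + `|t|) ^+ (2 * n))^-1)%R.
    apply: continuous_measurable_fun => t; apply: cvgV.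
      by rewrite gt_eqF// exprn_gt0// ltr_pwDl.
    apply: (cvg_comp (fun t : R => 1 + `|t|)%R (fun s : R => s ^+ (2 * n))%R).
      by apply: cvgD; [exact: cvg_cst|exact: norm_continuous].
    exact: exprn_continuous.
  have := measurableT_comp mw (@measurable_normrV n).
  by rewrite (_ : _ \o _ = fun x : 'rV[R]_n => ((1 + `|x|) ^+ (2 * n))^-1)%R//;
    apply/funext => x /=; rewrite normr_id.
move=> x; rewrite ger0_norm ?invr_ge0 ?weightX_ge0// prodfV lef_pV2.
- rewrite exprM -[n in (_ ^+ n)%R]card_ord -prodr_const ler_prod// => j _.
  rewrite addr_ge0 ?sqr_ge0//= sqrrD expr1n mul1r -(real_normK (num_real (x ord0 j))).
  rewrite -addrA lerD2l; apply: ler_wpDl; first by rewrite mulrn_wge0.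
  by rewrite lerXn2r ?nnegrE// norm_coord_le.
- by rewrite posrE weightX_gt0.
- by rewrite posrE prodr_gt0// => j _; rewrite ltr_pwDl// sqr_ge0.
Qed.

Lemma rapid_integrable n (f : 'rV[R]_n -> R) Z : (0 <= Z)%R ->
  measurable_fun setT f -> rapid Z f -> (volume n).-integrable setT (fun x => (f x)%:E).
Proof.
move=> Z0 mf /(rapid_le Z0)/(_ (2 * n)%N)[B fB].
apply: (integrable_dom mf (integrable_mulr B (integrable_weight n))) => x.
by rewrite ler_pdivlMr ?weightX_gt0// mulrC; have := fB x; rewrite mul0r expR0 mul1r.
Qed.

Lemma integral_volume_shift n (f : 'rV[R]_n -> R) (a : 'rV[R]_n) :
  measurable_fun setT f ->
  (\int[volume n]_x f (x + a) = \int[volume n]_x f x)%R.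
Proof.
move=> mf; have mE : measurable_fun setT (EFin \o f) by exact/measurable_EFinP.
rewrite /Rintegral; congr fine; rewrite integralE [RHS]integralE; congr (_ - _).
  rewrite -(ge0_integral_volume_shift a (measurable_funepos mE))//.
  by apply: eq_integral => x _; rewrite !funeposE.
rewrite -(ge0_integral_volume_shift a (measurable_funeneg mE))//.
by apply: eq_integral => x _; rewrite !funenegE.
Qed.

End volume_theory.

(** * Taylor bounds for the complex exponential *)

Section exponential_bounds.
Context {R : realType}.
Implicit Types (a b t : R).

Lemma mean_value_le (f f' : R -> R) b K : (forall t : R, is_derive t (1 : R) f (f' t)) ->
  (forall t, `|t| <= `|b| -> `|f' t| <= K) -> `|f b - f 0| <= K * `|b|.
Proof.
move=> fd fK.
have cf A : {within A, continuous f}.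
  by apply: continuous_subspaceT => t; apply/differentiable_continuous/derivable1_diffP;
    apply: ex_derive.
have [b0|b0] := leP 0 b.
  have [c + ->] := MVT_segment b0 (fun t _ => fd t) (cf _).
  rewrite in_itv/= subr0 => /andP[c0 cb]; rewrite normrM ler_wpM2r// fK//.
  by rewrite !ger0_norm.
have [c + E] := MVT_segment (ltW b0) (fun t _ => fd t) (cf _).
rewrite distrC E in_itv/= sub0r => /andP[bc c0]; rewrite normrM normrN ler_wpM2r// fK//.
by rewrite (ltr0_norm b0) ler0_norm// lerN2.
Qed.

Lemma normr_sin_le b : `|sin b| <= `|b|.
Proof.
have := @mean_value_le sin cos b 1; rewrite sin0 subr0 mul1r; apply => t.
by move=> _; rewrite ler_norml cos_geN1 cos_le1.
Qed.

Lemma normr_cosB1_le b : `|cos b - 1| <= `|b|.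
Proof.
have := @mean_value_le cos (fun t => - sin t) b 1; rewrite cos0 mul1r; apply => t.
by move=> _; rewrite normrN ler_norml sin_geN1 sin_le1.
Qed.

Lemma normr_cosB1_le2 b : `|cos b - 1| <= `|b| ^+ 2.
Proof.
have := @mean_value_le cos (fun t => - sin t) b `|b|; rewrite cos0 -expr2; apply => t.
by rewrite normrN; exact/le_trans/normr_sin_le.
Qed.

Lemma normr_sinB_le b : `|sin b - b| <= `|b| ^+ 2.
Proof.
have := @mean_value_le (fun t => sin t - t) (fun t => cos t - 1) b `|b|.
rewrite sin0 !subr0 -expr2; apply => t.
exact/le_trans/normr_cosB1_le.
Qed.

Lemma expR_ge1 a : 0 <= a -> 1 <= expR a.
Proof. by move=> a0; rewrite -expR0 ler_expR. Qed.

Lemma expR_subr1_le a : expR a - 1 <= a * expR a.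
Proof.
have : (1 - a) * expR a <= 1.
  rewrite -ler_pdivlMr ?expR_gt0// div1r -expRN.
  by have := expR_ge1Dx (- a).
lra.
Qed.

Lemma normr_expRB1_le a : `|expR a - 1| <= `|a| * expR `|a|.
Proof.
have [a0|a0] := leP 0 a.
  by rewrite (ger0_norm a0) ger0_norm ?subr_ge0 ?expR_ge1// expR_subr1_le.
rewrite ltr0_norm ?subr_lt0 ?expR_lt1// opprB.
apply: (@le_trans _ _ (- a)); first by have := expR_ge1Dx a; lra.
by rewrite (ltr0_norm a0) ler_peMr ?expR_ge1// oppr_ge0 ltW.
Qed.

Lemma normr_expRB1B_le a : `|expR a - 1 - a| <= `|a| ^+ 2 * expR `|a|.
Proof.
have E : expR a - 1 - a <= a * (expR a - 1) by have := expR_subr1_le a; lra.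
rewrite ger0_norm; last by have := expR_ge1Dx a; lra.
apply: (le_trans E); apply: (le_trans (ler_norm _)).
by rewrite normrM expr2 -mulrA ler_wpM2l// normr_expRB1_le.
Qed.

Definition cexp (z : R[i]) : R[i] :=
  Complex (expR (Rea z) * cos (Ima z)) (expR (Rea z) * sin (Ima z)).

Lemma cexpD (z w : R[i]) : cexp (z + w) = cexp z * cexp w.
Proof.
by apply: complex_ext; rewrite ?ReM ?ImM/= ReD ImD expRD ?cosD ?sinD; ring.
Qed.

Lemma normc_cexp (z : R[i]) : normc (cexp z) = expR (Rea z).
Proof.
by rewrite /cexp/= !exprMn -mulrDr cos2Dsin2 mulr1 sqrtr_sqr ger0_norm.
Qed.

Lemma cexpi t : cexp (Complex 0 t) = expi t.
Proof. by rewrite /cexp/= expR0 !mul1r. Qed.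

Lemma normc_expi t : normc (expi t) = 1.
Proof. by rewrite -cexpi normc_cexp/= expR0. Qed.

Lemma normc_cexpB1_le (z : R[i]) : normc (cexp z - 1) <= 4 * normc z * expR (normc z).
Proof.
have ra := normr_Re_le z; have ia := normr_Im_le z.
set r := normc z in ra ia *; set a := Rea z in ra *; set b := Ima z in ia *.
have r0 : 0 <= r by exact: normc_ge0.
have er : expR `|a| <= expR r by rewrite ler_expR.
have er1 : 1 <= expR r by rewrite expR_ge1.
have rer : r <= r * expR r by rewrite ler_peMr.
apply: le_trans (normc_le _) _; rewrite !(ReD, ImD, ReN, ImN) /cexp/= -/a -/b subr0.
have -> : expR a * cos b - 1 = (expR a - 1) * cos b + (cos b - 1) by ring.
have e1 : `|(expR a - 1) * cos b| <= r * expR r.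
  rewrite normrM -[leRHS]mulr1; apply: ler_pM => //; last first.
    by rewrite ler_norml cos_geN1 cos_le1.
  by apply: le_trans (normr_expRB1_le a) _; apply: ler_pM => //; exact: expR_ge0.
have e2 : `|cos b - 1| <= r * expR r.
  by apply: le_trans (normr_cosB1_le b) _; exact: le_trans rer.
have e3 : `|expR a * sin b| <= r * expR r.
  rewrite normrM mulrC; apply: ler_pM => //.
    exact: le_trans (normr_sin_le b) _.
  by rewrite ger0_norm ?expR_ge0// ler_expR (le_trans (ler_norm a)).
have := ler_normD ((expR a - 1) * cos b) (cos b - 1).
have := mulr_ge0 r0 (expR_ge0 r).
rewrite -mulrA; lra.
Qed.

(** For z = a + ib the real part is (e^a - 1 - a) + e^a (cos b - 1), the imaginary part (e^a - 1)
    sin b + (sin b - b): four terms, each at most |z|^2 e^|z|. *)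
Lemma normc_cexpB1B_le (z : R[i]) :
  normc (cexp z - 1 - z) <= 4 * normc z ^+ 2 * expR (normc z).
Proof.
have ra := normr_Re_le z; have ia := normr_Im_le z.
set r := normc z in ra ia *; set a := Rea z in ra *; set b := Ima z in ia *.
have r0 : 0 <= r by exact: normc_ge0.
have er1 : 1 <= expR r by rewrite expR_ge1.
have rer : r ^+ 2 <= r ^+ 2 * expR r by rewrite ler_peMr// sqr_ge0.
have b2 : `|b| ^+ 2 <= r ^+ 2 by rewrite lerXn2r// nnegrE.
have ea : expR a <= expR r by rewrite ler_expR (le_trans (ler_norm a)).
apply: le_trans (normc_le _) _; rewrite !(ReD, ImD, ReN, ImN) /cexp/= -/a -/b subr0.
have -> : expR a * cos b - 1 - a = (expR a - 1 - a) + expR a * (cos b - 1) by ring.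
have -> : expR a * sin b - b = (expR a - 1) * sin b + (sin b - b) by ring.
have e1 : `|expR a - 1 - a| <= r ^+ 2 * expR r.
  apply: le_trans (normr_expRB1B_le a) _; apply: ler_pM => //.
  - by rewrite lerXn2r// nnegrE.
  - by rewrite ler_expR.
have e2 : `|expR a * (cos b - 1)| <= r ^+ 2 * expR r.
  rewrite normrM mulrC; apply: ler_pM => //.
    exact: le_trans (normr_cosB1_le2 b) b2.
  by rewrite ger0_norm ?expR_ge0.
have e3 : `|(expR a - 1) * sin b| <= r ^+ 2 * expR r.
  rewrite normrM expr2 -mulrA [X in _ <= _ * X]mulrC mulrA; apply: ler_pM => //.
    apply: le_trans (normr_expRB1_le a) _; apply: ler_pM => //.
    by rewrite ler_expR.
  exact: le_trans (normr_sin_le b) ia.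
have e4 : `|sin b - b| <= r ^+ 2 * expR r.
  by apply: le_trans rer; exact: le_trans (normr_sinB_le b) b2.
have := ler_normD (expR a - 1 - a) (expR a * (cos b - 1)).
have := ler_normD ((expR a - 1) * sin b) (sin b - b).
rewrite -mulrA; lra.
Qed.

End exponential_bounds.

(** * Dominated convergence and integrals of derivatives *)

Section dominated.
Context {R : realType} d (T : measurableType d) (mu : {measure set T -> \bar R}).

Lemma dominated_cvg_Rintegral (f_ : nat -> T -> R) (f g : T -> R) :
  (forall k, measurable_fun setT (f_ k)) -> measurable_fun setT f ->
  (forall x, f_ ^~ x @ \oo --> f x) ->
  mu.-integrable setT (fun x => (g x)%:E) ->
  (forall k x, `|f_ k x| <= g x) ->
  (fun k => \int[mu]_x f_ k x) @ \oo --> \int[mu]_x f x.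
Proof.
move=> mf_ mf cf ig fg.
have cf' x : (fun k => (f_ k x)%:E) @ \oo --> (f x)%:E.
  by apply/cvg_EFin; [exact: nearW|exact: cf].
have [fi _ fl] := @dominated_convergence _ _ _ mu setT measurableT
  (fun k x => (f_ k x)%:E) (fun x => (f x)%:E) (fun x => (g x)%:E)
  (fun k => (measurable_EFinP _ _).2 (mf_ k)) ((measurable_EFinP _ _).2 mf)
  (aeW _ (fun x _ => cf' x)) ig
  (aeW _ (fun x k _ => fg k x)).
apply: fine_cvg; rewrite fineK; first exact: fl.
exact: integrable_fin_num.
Qed.

End dominated.

Section integral_of_derivative.
Context {R : realType} {n : nat}.
Local Notation E := 'rV[R]_n.
Local Notation e_ j := (delta_mx ord0 j : E).

Lemma norm_delta_le j : `|e_ j| <= 1.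
Proof. by apply: norm_rV_le => // i; rewrite mxE; case: (_ && _); rewrite ?normr1 ?normr0. Qed.

Lemma is_derive_line (h : E -> R) (x v : E) (s : R) :
  (forall y, differentiable h y) ->
  is_derive s (1 : R) (fun s => h (x + s *: v)) ('D_v h (x + s *: v)).
Proof.
move=> dh.
have dl : is_diff s (fun s : R => x + s *: v) (fun t => t *: v).
  by apply: is_diff_eq; rewrite add0r.
have dhl : is_diff s (h \o (fun s : R => x + s *: v))
    ('d h (x + s *: v) \o (fun t => t *: v)).
  by apply: is_diff_comp; exact: differentiableP.
apply: DeriveDef.
  by apply: diff_derivable; exact: (ex_diff (is_diff_def := dhl)).
rewrite deriveE; last exact: (ex_diff (is_diff_def := dhl)).
by rewrite (diff_val (is_diff_def := dhl)) /= scale1r deriveE.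
Qed.

Lemma weight_shift_le (x y : E) : `|y| <= 1 -> 1 + `|x| <= 2 * (1 + `|x + y|).
Proof.
move=> y1; have : `|x| <= `|x + y| + `|y|.
  by rewrite -[in leLHS](addrK y x) (le_trans (ler_normB _ _)).
have := normr_ge0 (x + y); lra.
Qed.

(** The difference quotients [q k] have integral 0 by translation invariance. By the mean value
    theorem they are values of the derivative at distance at most 1, over which the weight varies by
    a factor at most 2 ^ (2 n); dominated convergence then concludes. *)
Lemma integral_derive_eq0 (h : E -> R) j B :
  (forall x, differentiable h x) -> measurable_fun setT h ->
  measurable_fun setT ('D_(e_ j) h) ->
  (forall x, `|h x| <= B / (1 + `|x|) ^+ (2 * n)) ->
  (forall x, `|'D_(e_ j) h x| <= B / (1 + `|x|) ^+ (2 * n)) ->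
  \int[volume n]_x 'D_(e_ j) h x = 0.
Proof.
move=> dh mh mDh hB DhB.
pose t k : R := k.+1%:R^-1.
have t0 k : 0 < t k by rewrite invr_gt0.
have t1 k : t k <= 1 by rewrite invf_le1// ler1n.
pose q k x := (t k)^-1 * (h (x + t k *: e_ j) - h x).
have B0 : 0 <= B.
  have := hB 0; rewrite normr0 addr0 expr1n divr1; exact: le_trans.
have mhs k : measurable_fun setT (fun x : E => h (x + t k *: e_ j)).
  exact: (measurableT_comp mh (measurable_addrV _)).
have mq k : measurable_fun setT (q k).
  by apply: measurable_funM => //; exact: measurable_funB.
have hi : (volume n).-integrable setT (fun x => (h x)%:E).
  exact: (integrable_dom mh (integrable_mulr B (integrable_weight n))).
have int_q k : \int[volume n]_x q k x = 0.
  have hsi : (volume n).-integrable setT (fun x => (h (x + t k *: e_ j))%:E).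
    apply: (integrable_dom (mhs k)
      (integrable_mulr (B * 2 ^+ (2 * n)) (integrable_weight n))) => x.
    apply: le_trans (hB _) _; rewrite -mulrA ler_wpM2l//.
    rewrite ler_pdivlMr ?weightX_gt0// mulrC ler_pdivrMr ?weightX_gt0//.
    rewrite -exprMn lerXn2r ?nnegrE ?mulr_ge0 ?(ltW (weight_gt0 _))//.
    apply: weight_shift_le; rewrite normrZ (gtr0_norm (t0 k)).
    by rewrite mulr_ile1// ?(ltW (t0 k))// norm_delta_le.
  rewrite /q RintegralZl//; last exact: integrable_subr.
  by rewrite RintegralB// (integral_volume_shift _ mh) subrr mulr0.
have qcvg x : q ^~ x @ \oo --> 'D_(e_ j) h x.
  have := diff_derivable (v := e_ j) (dh x) => /cvg_ex[l hl].
  have -> : 'D_(e_ j) h x = l by apply: cvg_lim.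
  have /cvgr_dnbhsP/(_ t) := hl.
  have -> : (fun k => (t k)^-1 *: ((h \o shift x) (t k *: e_ j) - h x)) = q ^~ x.
    by apply/funext => k; rewrite /q/= [_ *: e_ j + x]addrC.
  apply; split=> [k|]; first by rewrite gt_eqF.
  exact: cvg_harmonic.
have qB k x : `|q k x| <= B * 2 ^+ (2 * n) * (((1 + `|x|) ^+ (2 * n))^-1).
  have cl A : {within A, continuous (fun s : R => h (x + s *: e_ j))}.
    apply: continuous_subspaceT => s; apply/differentiable_continuous.
    apply/derivable1_diffP.
    have D := is_derive_line x (e_ j) s dh; exact: ex_derive.
  have [c] := MVT_segment (ltW (t0 k)) (fun s _ => is_derive_line x (e_ j) s dh) (cl _).
  rewrite in_itv/= => /andP[c0 ct]; rewrite scale0r addr0 subr0 => hc.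
  rewrite /q hc mulrC mulfK ?gt_eqF//.
  apply: le_trans (DhB _) _; rewrite -mulrA ler_wpM2l//.
  rewrite ler_pdivlMr ?weightX_gt0// mulrC ler_pdivrMr ?weightX_gt0//.
  rewrite -exprMn lerXn2r ?nnegrE ?mulr_ge0 ?(ltW (weight_gt0 _))//.
  apply: weight_shift_le; rewrite normrZ (ger0_norm c0).
  by rewrite mulr_ile1// ?norm_delta_le// (le_trans ct).
have := dominated_cvg_Rintegral mq mDh qcvg
  (integrable_mulr (B * 2 ^+ (2 * n)) (integrable_weight n)) qB.
under [X in X @ _ --> _ -> _]eq_fun do rewrite int_q.
by move=> /cvg_lim <-//; rewrite lim_cst.
Qed.

End integral_of_derivative.
(** * The Fourier-Laplace transform *)

Section fourier_kernel.
Context {R : realType} {n : nat}.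
Local Notation E := 'rV[R]_n.
Local Notation C := R[i].
Local Notation D j f := ('D_(delta_mx ord0 j : E) f).
Implicit Types (f : E -> R) (w h : 'rV[C]_n) (x : E) (Z : R).

Definition kap : C := Complex 0 (- (2 * pi)).

(** The Fourier kernel e^(-2 pi i w.x) at a complex frequency, so that [Phi] is the Fourier-Laplace
    transform of a real function. *)
Definition ker w x : C := cexp (kap * \sum_j w ord0 j * (x ord0 j)%:C).

Definition Phi f w : C := cintegral (volume n) (fun x => (f x)%:C * ker w x).

(** The exponential rate of [ker w]: its modulus is e^(2 pi Im w . x), and the l1 norm of Im w is
    dual to the sup norm of x. *)
Definition im_size w : R := 2 * pi * \sum_j `|Ima (w ord0 j)|.

(** A real-valued substitute for the norm of ['rV[C]_n], which takes its values in C. *)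
Definition size1 w : R := \sum_j normc (w ord0 j).

Lemma size1_ge0 w : 0 <= size1 w.
Proof. by apply: sumr_ge0 => j _; exact: normc_ge0. Qed.

Lemma normc_coord_le w j : normc (w ord0 j) <= size1 w.
Proof. by rewrite /size1 (bigD1 j)//= lerDl sumr_ge0// => i _; exact: normc_ge0. Qed.

Lemma normc_sum_le (I : Type) (r : seq I) (F : I -> C) :
  normc (\sum_(i <- r) F i) <= \sum_(i <- r) normc (F i).
Proof.
elim: r => [|i r IH]; first by rewrite !big_nil Normc.normc0.
by rewrite !big_cons (le_trans (le_normcD _ _))// lerD2l.
Qed.

Lemma normc_kap : normc kap = 2 * pi.
Proof.
by rewrite /kap/= expr0n/= add0r sqrtr_sqr normrN ger0_norm// mulr_ge0 ?pi_ge0.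
Qed.

Lemma Re_realM (a : R) (z : C) : Rea (a%:C * z) = a * Rea z.
Proof. by rewrite ReM/= mul0r subr0. Qed.

Lemma Im_realM (a : R) (z : C) : Ima (a%:C * z) = a * Ima z.
Proof. by rewrite ImM/= mul0r addr0. Qed.

Lemma Re_sum (I : Type) (r : seq I) (F : I -> C) :
  Rea (\sum_(i <- r) F i) = \sum_(i <- r) Rea (F i).
Proof. exact: (big_morph _ (@ReD R) (erefl _)). Qed.

Lemma Im_sum (I : Type) (r : seq I) (F : I -> C) :
  Ima (\sum_(i <- r) F i) = \sum_(i <- r) Ima (F i).
Proof. exact: (big_morph _ (@ImD R) (erefl _)). Qed.

Lemma Re_kap_dot w x : Rea (kap * \sum_j w ord0 j * (x ord0 j)%:C) =
  lform (fun j => 2 * pi * Ima (w ord0 j)) x.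
Proof.
rewrite ReM/= mul0r sub0r mulNr opprK Im_sum mulr_sumr; apply: eq_bigr => j _.
by rewrite ImM/= mulr0 add0r mulrA.
Qed.

Lemma Im_kap_dot w x : Ima (kap * \sum_j w ord0 j * (x ord0 j)%:C) =
  lform (fun j => - (2 * pi) * Rea (w ord0 j)) x.
Proof.
rewrite ImM/= mul0r add0r Re_sum mulr_sumr; apply: eq_bigr => j _.
by rewrite ReM/= mulr0 subr0 mulrA.
Qed.

Lemma Re_ker w x : Rea (ker w x) =
  expR (lform (fun j => 2 * pi * Ima (w ord0 j)) x) *
  cos (lform (fun j => - (2 * pi) * Rea (w ord0 j)) x).
Proof. by rewrite -Re_kap_dot -Im_kap_dot. Qed.

Lemma Im_ker w x : Ima (ker w x) =
  expR (lform (fun j => 2 * pi * Ima (w ord0 j)) x) *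
  sin (lform (fun j => - (2 * pi) * Rea (w ord0 j)) x).
Proof. by rewrite -Re_kap_dot -Im_kap_dot. Qed.

Lemma normc_ker_le w x Z : im_size w <= Z -> normc (ker w x) <= expR (Z * `|x|).
Proof.
move=> wZ; rewrite normc_cexp Re_kap_dot ler_expR.
apply: le_trans (ler_norm _) _; apply: le_trans (lform_le _ _) _.
rewrite ler_wpM2r// (le_trans _ wZ)// /im_size mulr_sumr ler_sum// => j _.
by rewrite normrM ger0_norm// mulr_ge0 ?pi_ge0.
Qed.

Lemma normc_kap_dot_le h x :
  normc (kap * \sum_j h ord0 j * (x ord0 j)%:C) <= 2 * pi * size1 h * `|x|.
Proof.
rewrite Normc.normcM normc_kap -mulrA ler_wpM2l ?mulr_ge0 ?pi_ge0//.
apply: le_trans (normc_sum_le _ _) _; rewrite /size1 mulr_suml ler_sum// => j _.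
rewrite Normc.normcM normc_real ler_wpM2l ?normc_ge0// norm_coord_le//.
Qed.

Lemma kerD w h x : ker (w + h) x = ker w x * ker h x.
Proof.
rewrite /ker -cexpD -mulrDr -big_split/=; congr (cexp (_ * _)).
by apply: eq_bigr => j _; rewrite mxE mulrDl.
Qed.

Lemma smooth_Re_ker w : smooth (fun x => Rea (ker w x)).
Proof.
have -> : (fun y => Rea (ker w y)) = _ := funext (Re_ker w).
apply: smoothM.
  by apply: (@smooth_expR _ _ (fun x => lform _ x)); exact: slow_lform.
by case: (slow_cos (fun j => - (2 * pi) * Rea (w ord0 j))).
Qed.

Lemma smooth_Im_ker w : smooth (fun x => Ima (ker w x)).
Proof.
have -> : (fun y => Ima (ker w y)) = _ := funext (Im_ker w).
apply: smoothM.
  by apply: (@smooth_expR _ _ (fun x => lform _ x)); exact: slow_lform.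
by case: (slow_sin (fun j => - (2 * pi) * Rea (w ord0 j))).
Qed.

Lemma smooth_measurable f : smooth f -> measurable_fun setT f.
Proof. by move=> fs; apply: continuous_measurable_rV; exact: smooth_continuous. Qed.

Lemma cmeasurable_ker w : cmeasurable (ker w).
Proof.
by split; apply: smooth_measurable; [exact: smooth_Re_ker|exact: smooth_Im_ker].
Qed.

Lemma is_derive_comp_lform (u : R -> R) (c : 'I_n -> R) x (v : E) (du : R) :
  is_derive (lform c x : R) (1 : R) u du ->
  is_derive x v (fun y => u (lform c y)) (du * lform c v).
Proof.
move=> ud.
have dc : is_diff x (lform c : E -> R^o) (lform c).
  apply: DiffDef; first exact: (linear_differentiable _ (@continuous_lform _ _ c)).
  exact: (diff_lin _ (@continuous_lform _ _ c)).
have ud' : derivable u (lform c x : R) 1 by exact: ex_derive.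
have du' : is_diff (lform c x : R) u ( *:%R^~ du).
  apply: DiffDef; first exact/derivable1_diffP.
  by rewrite deriv1E// derive1E (derive_val (is_derive := ud)).
have duc := is_diff_comp dc du'.
apply: DeriveDef; first by apply: diff_derivable; exact: (ex_diff (is_diff_def := duc)).
rewrite deriveE; last exact: (ex_diff (is_diff_def := duc)).
by rewrite (diff_val (is_diff_def := duc)) /= /GRing.scale/= mulrC.
Qed.

Lemma derive_Re_ker w j x : D j (fun y => Rea (ker w y)) x =
  Rea (kap * w ord0 j * ker w x).
Proof.
have -> : (fun y => Rea (ker w y)) = _ := funext (Re_ker w).
have dE := @is_derive_comp_lform expR (fun j => 2 * pi * Ima (w ord0 j)) x
  (delta_mx ord0 j) _ (is_derive_expR _).
have dC := @is_derive_comp_lform cos (fun j => - (2 * pi) * Rea (w ord0 j)) x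
  (delta_mx ord0 j) _ (is_derive_cos _).
have := is_deriveM dE dC => dM; rewrite (derive_val (is_derive := dM)).
rewrite !lform_delta ReM Re_ker Im_ker ReM ImM /= /GRing.scale/=; ring.
Qed.

Lemma derive_Im_ker w j x : D j (fun y => Ima (ker w y)) x =
  Ima (kap * w ord0 j * ker w x).
Proof.
have -> : (fun y => Ima (ker w y)) = _ := funext (Im_ker w).
have dE := @is_derive_comp_lform expR (fun j => 2 * pi * Ima (w ord0 j)) x
  (delta_mx ord0 j) _ (is_derive_expR _).
have dC := @is_derive_comp_lform sin (fun j => - (2 * pi) * Rea (w ord0 j)) x
  (delta_mx ord0 j) _ (is_derive_sin _).
have := is_deriveM dE dC => dM; rewrite (derive_val (is_derive := dM)).
rewrite !lform_delta ImM Re_ker Im_ker ReM ImM /= /GRing.scale/=; ring.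
Qed.

Lemma rapid_expw_bound Z f : rapid Z f -> exists2 B, 0 <= B &
  forall x, `|f x| * expR (Z * `|x|) <= B / (1 + `|x|) ^+ (2 * n).
Proof.
move=> /(rapid_bound (2 * n))[B B0 fB]; exists B => // x.
apply: (le_trans (ler_wpM2r (expR_ge0 (Z * `|x|)) (fB x))).
by rewrite mulrAC -[X in X / _]mulrA -expRD addNr expR0 mulr1.
Qed.

Lemma integrable_expw Z f : measurable_fun setT f -> rapid Z f ->
  (volume n).-integrable setT (fun x => (`|f x| * expR (Z * `|x|))%:E).
Proof.
move=> mf /rapid_expw_bound[B B0 fB].
apply: (integrable_dom _ (integrable_mulr B (integrable_weight n))) => [|x].
  apply: measurable_funM; first exact: measurableT_comp.
  apply: measurableT_comp => //.
  by apply: measurable_funM => //; exact: measurable_normrV.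
by rewrite ger0_norm// mulr_ge0 ?expR_ge0.
Qed.

Lemma normc_fker_le f w x Z : im_size w <= Z ->
  normc ((f x)%:C * ker w x) <= `|f x| * expR (Z * `|x|).
Proof.
by move=> wZ; rewrite Normc.normcM normc_real ler_wpM2l// normc_ker_le.
Qed.

Lemma cintegrable_fker f w Z : measurable_fun setT f -> rapid Z f -> im_size w <= Z ->
  cintegrable (volume n) (fun x => (f x)%:C * ker w x).
Proof.
move=> mf fr wZ; apply: (cintegrable_dom _ (integrable_expw mf fr)).
  by apply: cmeasurableM; [exact: cmeasurable_real|exact: cmeasurable_ker].
by move=> x; exact: normc_fker_le.
Qed.

(** Integration by parts: [G] is the derivative of f times the kernel, and its integral vanishes
    because the weight [Z] of [f] outweighs the growth of the kernel. *)
Lemma Phi_derive f w j Z : pderivs_in (rapid Z) f -> im_size w <= Z ->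
  Phi (D j f) w = - (kap * w ord0 j * Phi f w).
Proof.
move=> fr wZ; have fjr := pderivs_in_derive j fr.
have [fs fP] := fr; have [fjs fjP] := fjr.
have mf := smooth_measurable fs; have mfj := smooth_measurable fjs.
have fi := cintegrable_fker mf (fP [::]) wZ.
have fji := cintegrable_fker mfj (fjP [::]) wZ.
pose G x := (D j f x)%:C * ker w x + kap * w ord0 j * ((f x)%:C * ker w x).
have mG : cmeasurable G.
  apply: cmeasurableD; first exact: cintegrable_measurable fji.
  apply: cmeasurableM; first exact: cmeasurable_cst.
  exact: cintegrable_measurable fi.
have ReG : D j (fun x => Rea ((f x)%:C * ker w x)) = (fun x => Rea (G x)).
  apply/funext => x; under eq_fun do rewrite Re_realM.
  rewrite deriveM; [|exact: smooth_derivable|exact/smooth_derivable/smooth_Re_ker].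
  rewrite derive_Re_ker /G; case: (ker w x) (w ord0 j) => [kr ki] [wr wi].
  by rewrite /GRing.scale/=; ring.
have ImG : D j (fun x => Ima ((f x)%:C * ker w x)) = (fun x => Ima (G x)).
  apply/funext => x; under eq_fun do rewrite Im_realM.
  rewrite deriveM; [|exact: smooth_derivable|exact/smooth_derivable/smooth_Im_ker].
  rewrite derive_Im_ker /G; case: (ker w x) (w ord0 j) => [kr ki] [wr wi].
  by rewrite /GRing.scale/=; ring.
have [B B0 fB] := rapid_expw_bound (fP [::]).
have [B1 B10 fjB] := rapid_expw_bound (fjP [::]).
(* [integral_derive_eq0] takes a single constant for the function and its derivative; the summand 1
   secures [B <= B2]. *)
pose B2 := B1 + (normc (kap * w ord0 j) + 1) * B.
have BB2 : B <= B2.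
  by rewrite /B2 mulrDl mul1r addrA lerDr addr_ge0// mulr_ge0// normc_ge0.
have hB x : normc ((f x)%:C * ker w x) <= B2 / (1 + `|x|) ^+ (2 * n).
  apply: (le_trans (normc_fker_le f x wZ)); apply: le_trans (fB x) _.
  by rewrite ler_wpM2r// invr_ge0 weightX_ge0.
have GB x : normc (G x) <= B2 / (1 + `|x|) ^+ (2 * n).
  apply: le_trans (le_normcD _ _) _; rewrite [leRHS]mulrDl lerD//.
    exact: (le_trans (normc_fker_le (D j f) x wZ) (fjB x)).
  rewrite Normc.normcM -mulrA; apply: ler_pM; rewrite ?normc_ge0//; first by rewrite lerDl.
  exact: (le_trans (normc_fker_le f x wZ) (fB x)).
have intG : cintegral (volume n) G = 0.
  apply: complex_ext => /=.
    rewrite -ReG; apply: (@integral_derive_eq0 _ _ _ _ B2).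
    - move=> x; apply: smooth_diff; under eq_fun do rewrite Re_realM.
      by apply: smoothM => //; exact: smooth_Re_ker.
    - by case: (cintegrable_measurable fi).
    - by rewrite ReG; case: mG.
    - by move=> x; apply: le_trans (normr_Re_le _) (hB x).
    - by move=> x; rewrite (congr1 (@^~ x) ReG : D j _ x = _); apply: le_trans (normr_Re_le _) (GB x).
  rewrite -ImG; apply: (@integral_derive_eq0 _ _ _ _ B2).
  - move=> x; apply: smooth_diff; under eq_fun do rewrite Im_realM.
    by apply: smoothM => //; exact: smooth_Im_ker.
  - by case: (cintegrable_measurable fi).
  - by rewrite ImG; case: mG.
  - by move=> x; apply: le_trans (normr_Im_le _) (hB x).
  - by move=> x; rewrite (congr1 (@^~ x) ImG : D j _ x = _); apply: le_trans (normr_Im_le _) (GB x).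
move: intG; rewrite /G cintegralD//; last exact: cintegrableZ.
by rewrite cintegralZ// => /eqP; rewrite addr_eq0 => /eqP.
Qed.

End fourier_kernel.

(** * Decay of the Fourier-Laplace transform and of its Taylor remainders *)

Section fourier_decay.
Context {R : realType} {n : nat}.
Local Notation E := 'rV[R]_n.
Local Notation C := R[i].
Local Notation D j f := ('D_(delta_mx ord0 j : E) f).
Implicit Types (f : E -> R) (w h : 'rV[C]_n) (x : E) (Z : R).

Notation rapidS Z := (pderivs_in (@rapid R E Z)).

Lemma normcD_le (a b : C) : normc (a + b) <= normc a + normc b.
Proof. exact: le_normcD. Qed.

Lemma normc_sub_le (a b : C) : normc (a - b) <= normc a + normc b.
Proof. by apply: le_trans (normcD_le _ _) _; rewrite normcN. Qed.

(** The source of the margin [2 * pi] in the hypotheses below: a complex shift of [size1] at most 1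
    raises the exponential rate by no more. *)
Lemma im_sizeD w h Z : im_size w <= Z -> size1 h <= 1 -> im_size (w + h) <= Z + 2 * pi.
Proof.
move=> wZ h1; have p0 : 0 <= 2 * pi :> R by rewrite mulr_ge0 ?pi_ge0.
apply: (@le_trans _ _ (im_size w + 2 * pi * size1 h)).
  rewrite /im_size -mulrDr ler_wpM2l// -big_split ler_sum// => j _.
  rewrite mxE ImD (le_trans (ler_normD _ _))// lerD2l.
  exact: normr_Im_le.
by rewrite lerD// -[leRHS]mulr1 ler_wpM2l.
Qed.

Lemma kap_neq0 : kap != 0 :> C.
Proof.
by rewrite eq_complex/= eqxx/= oppr_eq0 mulf_eq0 pnatr_eq0/= gt_eqF// pi_gt0.
Qed.

(** A factor w_j is traded for a derivative of f. Every decay estimate below is an induction on the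
    power of w_j by means of this trade. *)
Lemma coord_Phi f w j Z : rapidS Z f -> im_size w <= Z ->
  w ord0 j * Phi f w = - (kap^-1 * Phi (D j f) w).
Proof.
move=> fr wZ; rewrite (Phi_derive j fr wZ) mulrN opprK !mulrA mulVf ?mul1r//.
exact: kap_neq0.
Qed.

Lemma Phi_bounded f Z : measurable_fun setT f -> rapid Z f ->
  exists2 B, 0 <= B & forall w, im_size w <= Z -> normc (Phi f w) <= B.
Proof.
move=> mf fr; have fi := integrable_expw mf fr.
exists (2 * \int[volume n]_x (`|f x| * expR (Z * `|x|))).
  by rewrite mulr_ge0// Rintegral_ge0// => x _; rewrite mulr_ge0 ?expR_ge0.
move=> w wZ; apply: normc_cintegral_le => //; first exact: cintegrable_fker fr wZ.
by move=> x; exact: normc_fker_le.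
Qed.

Lemma Phi_decay_coord j N f Z : rapidS Z f -> exists2 B, 0 <= B &
  forall w, im_size w <= Z -> normc (w ord0 j) ^+ N * normc (Phi f w) <= B.
Proof.
elim: N f => [|N IH] f fr.
  have [B B0 fB] := Phi_bounded (smooth_measurable fr.1) (fr.2 [::]).
  by exists B => // w wZ; rewrite expr0 mul1r fB.
have [B B0 fB] := IH _ (pderivs_in_derive j fr).
exists (normc (kap^-1 : C) * B); first by rewrite mulr_ge0 ?normc_ge0.
move=> w wZ; rewrite exprSr -mulrA -Normc.normcM (coord_Phi _ fr wZ).
rewrite normcN Normc.normcM mulrCA ler_wpM2l ?normc_ge0//.
exact: fB.
Qed.

Lemma normc_coord_shift_le w h j N : size1 h <= 1 ->
  normc (w ord0 j) ^+ N <= 2 ^+ N * (1 + normc ((w + h) ord0 j) ^+ N).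
Proof.
move=> h1; set a := normc (w ord0 j); set b := normc _.
have b0 : 0 <= b by exact: normc_ge0.
have ab : a <= b + 1.
  rewrite /a -(addrK (h ord0 j) (w ord0 j)) (le_trans (normc_sub_le _ _))//.
  by rewrite /b mxE lerD2l (le_trans _ h1)// normc_coord_le.
have [b1|b1] := leP b 1.
  apply: (@le_trans _ _ (2 ^+ N)).
    by rewrite lerXn2r ?nnegrE ?normc_ge0// (le_trans ab)//; lra.
  by rewrite ler_peMr ?exprn_ge0// lerDl exprn_ge0.
apply: (@le_trans _ _ ((2 * b) ^+ N)).
  by rewrite lerXn2r ?nnegrE ?normc_ge0 ?mulr_ge0// (le_trans ab)//; lra.
by rewrite exprMn ler_wpM2l ?exprn_ge0// lerDr.
Qed.

Lemma Phi_shift_decay_coord j N f Z : rapidS (Z + 2 * pi) f -> exists2 B, 0 <= B &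
  forall w h, im_size w <= Z -> size1 h <= 1 ->
    normc (w ord0 j) ^+ N * normc (Phi f (w + h)) <= B.
Proof.
move=> fr; have [B B0 fB] := Phi_decay_coord j N fr.
have [B1 B10 fB1] := Phi_decay_coord j 0 fr.
exists (2 ^+ N * (B1 + B)); first by rewrite mulr_ge0 ?exprn_ge0 ?addr_ge0.
move=> w h wZ h1; have whZ := im_sizeD wZ h1.
apply: le_trans (ler_wpM2r (normc_ge0 _) (normc_coord_shift_le w j N h1)) _.
rewrite -mulrA ler_wpM2l ?exprn_ge0// mulrDl lerD//; last exact: fB.
exact: fB1.
Qed.

Definition Phi_diff f w h := Phi f (w + h) - Phi f w.

(** The partial derivative of [Phi f] in w_k is [kap] times the transform of x_k f, so this is the
    first-order Taylor remainder at w. *)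
Definition Phi_rem f w h :=
  Phi_diff f w h - \sum_k kap * h ord0 k * Phi (fun x => x ord0 k * f x) w.

Lemma rapidS_coordM Z k f : rapidS Z f -> rapidS Z (fun x => x ord0 k * f x).
Proof. by move=> fr; apply: slow_rapid => //; exact: slow_coord. Qed.

Lemma leDpi Z : Z <= Z + 2 * pi.
Proof. by rewrite lerDl mulr_ge0 ?pi_ge0. Qed.

Lemma Phi_diffE f w h Z : rapidS (Z + 2 * pi) f -> im_size w <= Z -> size1 h <= 1 ->
  Phi_diff f w h = cintegral (volume n) (fun x => (f x)%:C * ker w x * (ker h x - 1)).
Proof.
move=> fr wZ h1; have mf := smooth_measurable fr.1.
have wZ' := le_trans wZ (leDpi Z).
rewrite /Phi_diff /Phi -cintegralB; last 2 first.
- exact: cintegrable_fker (fr.2 [::]) (im_sizeD wZ h1).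
- exact: cintegrable_fker (fr.2 [::]) wZ'.
by apply: eq_cintegral => x; rewrite kerD mulrBr mulr1 mulrA.
Qed.

Lemma normr_expw_le (r k : R) m : 0 <= r -> (0 <= k <= 1) ->
  (2 * pi * k * r) ^+ m * expR (2 * pi * k * r) <=
  k ^+ m * ((2 * pi * r) ^+ m * expR (2 * pi * r)).
Proof.
move=> r0 /andP[k0 k1]; have p0 : 0 <= 2 * pi :> R by rewrite mulr_ge0 ?pi_ge0.
rewrite (_ : 2 * pi * k * r = k * (2 * pi * r)); last by ring.
rewrite exprMn -[leLHS]mulrA ler_wpM2l ?exprn_ge0// ler_wpM2l ?exprn_ge0 ?mulr_ge0 ?pi_ge0//.
by rewrite ler_expR ler_piMl// mulr_ge0.
Qed.

(** The margin pays for the factor e^(2 pi |x|) left by the Taylor bounds of the kernel, and rapid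
    decay pays for the power of |x|. *)
Lemma integrable_expw_norm f m Z : measurable_fun setT f -> rapid (Z + 2 * pi) f ->
  (volume n).-integrable setT
    (fun x => (`|f x| * expR (Z * `|x|) * ((2 * pi * `|x|) ^+ m * expR (2 * pi * `|x|)))%:E).
Proof.
move=> mf fr.
pose g x := (2 * pi * `|x|) ^+ m * f x.
have mg : measurable_fun setT g.
  apply: measurable_funM => //; apply: measurable_funX.
  by apply: measurable_funM => //; exact: measurable_normrV.
have gr : rapid (Z + 2 * pi) g.
  apply: (@rapidM _ _ _ (fun x => (2 * pi * `|x|) ^+ m)) => //.
  exists m, ((2 * pi) ^+ m) => x.
  rewrite ger0_norm ?exprn_ge0 ?mulr_ge0 ?pi_ge0// exprMn ler_wpM2l//.
    by rewrite exprn_ge0 ?mulr_ge0 ?pi_ge0.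
  by rewrite lerXn2r ?nnegrE// lerDr.
have := integrable_expw mg gr; apply: eq_integrable => // x _.
congr _%:E; rewrite /g normrM (ger0_norm (x := (2 * pi * `|x|) ^+ m)); last first.
  by rewrite exprn_ge0 ?mulr_ge0 ?pi_ge0.
by rewrite (mulrDl Z) expRD; ring.
Qed.

Lemma Phi_diff_bounded f Z : rapidS (Z + 2 * pi) f -> exists2 B, 0 <= B &
  forall w h, im_size w <= Z -> size1 h <= 1 -> normc (Phi_diff f w h) <= B * size1 h.
Proof.
move=> fr.
have mf := smooth_measurable fr.1.
have gi := integrable_expw_norm 1 mf (fr.2 [::]).
set I := \int[volume n]_x (`|f x| * expR (Z * `|x|) * ((2 * pi * `|x|) ^+ 1 * expR (2 * pi * `|x|))).
have I0 : 0 <= I.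
  by apply: Rintegral_ge0 => x _; rewrite !mulr_ge0 ?expR_ge0 ?pi_ge0.
exists (2 * (4 * I)); first by rewrite !mulr_ge0.
move=> w h wZ h1; rewrite (Phi_diffE fr wZ h1).
have bnd x : normc ((f x)%:C * ker w x * (ker h x - 1)) <=
   4 * (size1 h * (`|f x| * expR (Z * `|x|) * ((2 * pi * `|x|) ^+ 1 * expR (2 * pi * `|x|)))).
  rewrite Normc.normcM.
  apply: (@le_trans _ _ (`|f x| * expR (Z * `|x|) *
      (4 * ((2 * pi * size1 h * `|x|) ^+ 1 * expR (2 * pi * size1 h * `|x|))))).
    apply: ler_pM; rewrite ?normc_ge0//; first exact: normc_fker_le.
    apply: le_trans (normc_cexpB1_le _) _; rewrite -mulrA ler_wpM2l//.
    rewrite expr1; apply: ler_pM; rewrite ?normc_ge0 ?expR_ge0//.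
      exact: normc_kap_dot_le.
    by rewrite ler_expR normc_kap_dot_le.
  rewrite mulrCA ler_wpM2l// [leRHS]mulrCA.
  rewrite ler_wpM2l ?mulr_ge0 ?expR_ge0//.
  have := @normr_expw_le `|x| (size1 h) 1 (normr_ge0 x).
  rewrite expr1; apply; by rewrite size1_ge0.
apply: le_trans (normc_cintegral_le (h := fun x =>
  4 * (size1 h * (`|f x| * expR (Z * `|x|) * ((2 * pi * `|x|) ^+ 1 * expR (2 * pi * `|x|)))))
  _ _ bnd) _.
- apply: (cintegrable_dom _ _ bnd).
    apply: cmeasurableM; first apply: cmeasurableM.
    + exact: cmeasurable_real.
    + exact: cmeasurable_ker.
    + by apply: cmeasurableD; [exact: cmeasurable_ker|exact: cmeasurable_cst].
  by do 2 apply: integrable_mulr.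
- by do 2 apply: integrable_mulr.
rewrite RintegralZl//; last exact: integrable_mulr.
by rewrite RintegralZl// -/I; lra.
Qed.

Lemma Phi_diff_decay_coord j N f Z : rapidS (Z + 2 * pi) f -> exists2 B, 0 <= B &
  forall w h, im_size w <= Z -> size1 h <= 1 ->
    normc (w ord0 j) ^+ N * normc (Phi_diff f w h) <= B * size1 h.
Proof.
elim: N f => [|N IH] f fr.
  have [B B0 fB] := Phi_diff_bounded fr; exists B => // w h wZ h1.
  by rewrite expr0 mul1r fB.
have [B B0 fB] := IH _ (pderivs_in_derive j fr).
have [B1 B10 fB1] := Phi_shift_decay_coord j N fr.
exists (normc (kap^-1 : C) * B + B1); first by rewrite addr_ge0 ?mulr_ge0 ?normc_ge0.
move=> w h wZ h1; rewrite exprSr -mulrA -Normc.normcM.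
have whZ := im_sizeD wZ h1; have wZ' := le_trans wZ (leDpi Z).
(* At w + h the trade of [coord_Phi] needs the factor w_j + h_j; the surplus h_j Phi f (w + h) is
   itself of order [size1 h]. *)
have -> : w ord0 j * Phi_diff f w h =
    - (kap^-1 * Phi_diff (D j f) w h) - h ord0 j * Phi f (w + h).
  rewrite /Phi_diff mulrBr (coord_Phi j fr wZ').
  have := coord_Phi j fr whZ; rewrite mxE mulrDl => /eqP; rewrite eq_sym -subr_eq => /eqP <-.
  by ring.
apply: le_trans (ler_wpM2l _ (normc_sub_le _ _)) _; first by rewrite exprn_ge0// normc_ge0.
rewrite normcN !Normc.normcM mulrDr [leRHS]mulrDl lerD//.
  by rewrite mulrCA -mulrA ler_wpM2l ?normc_ge0// fB.
rewrite mulrCA mulrC; apply: ler_pM; rewrite ?normc_ge0//.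
- by rewrite mulr_ge0 ?exprn_ge0 ?normc_ge0.
- exact: fB1.
- exact: normc_coord_le.
Qed.

Lemma derive_coordM k j f : smooth f ->
  D j (fun x => x ord0 k * f x) = fun x => (k == j)%:R * f x + x ord0 k * D j f x.
Proof.
move=> fs; apply/funext => x.
have cs : smooth (fun x : E => x ord0 k) := (slow_coord k).1.
rewrite deriveM; [|exact: smooth_derivable|exact: smooth_derivable].
rewrite addrC /GRing.scale/= mulrC; congr (_ + _); congr (_ * _).
have dl := @is_derive_comp_lform _ _ id (fun i => (i == k)%:R) x (delta_mx ord0 j) 1
  (is_derive_id _ _).
have lE y : lform (fun i : 'I_n => (i == k)%:R) y = y ord0 k :> R.
  rewrite /lform (bigD1 k)//= eqxx mul1r big1 ?addr0// => i /negPf ->.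
  by rewrite mul0r.
rewrite (_ : (fun y : E => y ord0 k) = fun y => id (lform (fun i : 'I_n => (i == k)%:R) y)).
  by rewrite (derive_val (is_derive := dl)) mul1r lform_delta eq_sym.
by apply/funext => y; rewrite lE.
Qed.

Lemma Phi_lin (a : R) f g w Z : rapidS Z f -> rapidS Z g -> im_size w <= Z ->
  Phi (fun x => a * f x + g x) w = a%:C * Phi f w + Phi g w.
Proof.
move=> fr gr wZ.
have fi := cintegrable_fker (smooth_measurable fr.1) (fr.2 [::]) wZ.
have gi := cintegrable_fker (smooth_measurable gr.1) (gr.2 [::]) wZ.
rewrite /Phi -cintegralZ// -cintegralD//; last exact: cintegrableZ.
by apply: eq_cintegral => x; rewrite rmorphD rmorphM/= mulrDl mulrA.
Qed.

Lemma Phi_rem_bounded f Z : rapidS (Z + 2 * pi) f -> exists2 B, 0 <= B &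
  forall w h, im_size w <= Z -> size1 h <= 1 -> normc (Phi_rem f w h) <= B * size1 h ^+ 2.
Proof.
move=> fr.
have mf := smooth_measurable fr.1.
have gi := integrable_expw_norm 2 mf (fr.2 [::]).
set I := \int[volume n]_x (`|f x| * expR (Z * `|x|) * ((2 * pi * `|x|) ^+ 2 * expR (2 * pi * `|x|))).
have I0 : 0 <= I.
  by apply: Rintegral_ge0 => x _; rewrite !mulr_ge0 ?expR_ge0 ?pi_ge0.
exists (2 * (4 * I)); first by rewrite !mulr_ge0.
move=> w h wZ h1.
have wZ' := le_trans wZ (leDpi Z).
have ci k : cintegrable (volume n) (fun x => (x ord0 k * f x)%:C * ker w x).
  have kfr := rapidS_coordM k fr.
  exact: cintegrable_fker (smooth_measurable kfr.1) (kfr.2 [::]) wZ'.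
have di : cintegrable (volume n) (fun x => (f x)%:C * ker w x * (ker h x - 1)).
  have i1 := cintegrable_fker mf (fr.2 [::]) (im_sizeD wZ h1).
  have i2 := cintegrable_fker mf (fr.2 [::]) wZ'.
  have := cintegrableD i1 (cintegrableZ (-1) i2).
  rewrite (_ : (fun _ => _) = (fun x => (f x)%:C * ker w x * (ker h x - 1)))//.
  by apply/funext => x; rewrite kerD; ring.
have sumE (s : seq 'I_n) :
    cintegrable (volume n) (fun x => \sum_(k <- s) kap * h ord0 k * ((x ord0 k * f x)%:C * ker w x)) /\
    cintegral (volume n) (fun x => \sum_(k <- s) kap * h ord0 k * ((x ord0 k * f x)%:C * ker w x))
    = \sum_(k <- s) kap * h ord0 k * Phi (fun x => x ord0 k * f x) w.
  elim: s => [|k s [si sE]].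
    under eq_fun do rewrite big_nil; rewrite big_nil; split.
      by apply: (cintegrable_real (h := fun=> 0)); exact: integrable0.
    by rewrite (cintegral_real _ (fun=> 0)) Rintegral_cst// mul0r.
  under eq_fun do rewrite big_cons; rewrite big_cons; split.
    by apply: cintegrableD => //; exact: cintegrableZ.
  by rewrite cintegralD// ?sE ?cintegralZ//; exact: cintegrableZ.
have [si sE] := sumE (index_enum _).
rewrite /Phi_rem (Phi_diffE fr wZ h1) -sE -cintegralB//.
rewrite (eq_cintegral (volume n) (g := fun x => (f x)%:C * ker w x *
   (ker h x - 1 - kap * \sum_k h ord0 k * (x ord0 k)%:C))); last first.
  move=> x; rewrite [in RHS]mulrBr; congr (_ - _).
  rewrite mulr_sumr mulr_sumr; apply: eq_bigr => k _.
  by rewrite rmorphM/=; ring.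
have bnd x : normc ((f x)%:C * ker w x * (ker h x - 1 - kap * \sum_k h ord0 k * (x ord0 k)%:C)) <=
   4 * (size1 h ^+ 2 * (`|f x| * expR (Z * `|x|) * ((2 * pi * `|x|) ^+ 2 * expR (2 * pi * `|x|)))).
  rewrite Normc.normcM.
  apply: (@le_trans _ _ (`|f x| * expR (Z * `|x|) *
      (4 * ((2 * pi * size1 h * `|x|) ^+ 2 * expR (2 * pi * size1 h * `|x|))))).
    apply: ler_pM; rewrite ?normc_ge0//; first exact: normc_fker_le.
    apply: le_trans (normc_cexpB1B_le _) _; rewrite -mulrA ler_wpM2l//.
    apply: ler_pM; rewrite ?exprn_ge0 ?normc_ge0 ?expR_ge0//.
      rewrite lerXn2r ?nnegrE ?normc_ge0 ?normc_kap_dot_le//.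
      by rewrite !mulr_ge0 ?pi_ge0 ?size1_ge0.
    by rewrite ler_expR normc_kap_dot_le.
  rewrite mulrCA ler_wpM2l// [leRHS]mulrCA.
  rewrite ler_wpM2l ?mulr_ge0 ?expR_ge0//.
  by apply: normr_expw_le => //; rewrite size1_ge0.
apply: le_trans (normc_cintegral_le (h := fun x =>
  4 * (size1 h ^+ 2 * (`|f x| * expR (Z * `|x|) * ((2 * pi * `|x|) ^+ 2 * expR (2 * pi * `|x|)))))
  _ _ bnd) _.
- apply: (cintegrable_dom _ _ bnd).
    apply: cmeasurableM; first apply: cmeasurableM.
    + exact: cmeasurable_real.
    + exact: cmeasurable_ker.
    + under eq_fun do rewrite mulr_sumr -sumrN.
      apply: cmeasurableD; first by apply: cmeasurableD; [exact: cmeasurable_ker|exact: cmeasurable_cst].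
      elim: (index_enum _) => [|k s IHs].
        by under eq_fun do rewrite big_nil; exact: cmeasurable_cst.
      under eq_fun do rewrite big_cons -mulN1r.
      apply: cmeasurableD => //; do 3 (apply: cmeasurableM; first exact: cmeasurable_cst).
      by apply: cmeasurable_real; exact: measurable_coord.
  by do 2 apply: integrable_mulr.
- by do 2 apply: integrable_mulr.
rewrite RintegralZl//; last exact: integrable_mulr.
by rewrite RintegralZl// -/I; lra.
Qed.

(** Multiplying the remainder by w_j gives the remainder of D_j f up to a constant, minus h_j
    [Phi_diff f w h]: the Kronecker term in D_j (x_k f) supplies exactly the h_j Phi f w that
    completes the difference. That term is of second order by the previous estimate. *)
Lemma Phi_rem_decay_coord j N f Z : rapidS (Z + 2 * pi) f -> exists2 B, 0 <= B &
  forall w h, im_size w <= Z -> size1 h <= 1 ->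
    normc (w ord0 j) ^+ N * normc (Phi_rem f w h) <= B * size1 h ^+ 2.
Proof.
elim: N f => [|N IH] f fr.
  have [B B0 fB] := Phi_rem_bounded fr; exists B => // w h wZ h1.
  by rewrite expr0 mul1r fB.
have [B B0 fB] := IH _ (pderivs_in_derive j fr).
have [B1 B10 fB1] := Phi_diff_decay_coord j N fr.
exists (normc (kap^-1 : C) * B + B1); first by rewrite addr_ge0 ?mulr_ge0 ?normc_ge0.
move=> w h wZ h1; rewrite exprSr -mulrA -Normc.normcM.
have whZ := im_sizeD wZ h1; have wZ' := le_trans wZ (leDpi Z).
have -> : w ord0 j * Phi_rem f w h =
    - (kap^-1 * Phi_rem (D j f) w h) - h ord0 j * Phi_diff f w h.
  rewrite /Phi_rem mulrBr mulr_sumr.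
  have -> : w ord0 j * Phi_diff f w h =
      - (kap^-1 * Phi_diff (D j f) w h) - h ord0 j * Phi f (w + h).
    rewrite /Phi_diff mulrBr (coord_Phi j fr wZ').
    have := coord_Phi j fr whZ; rewrite mxE mulrDl => /eqP; rewrite eq_sym -subr_eq => /eqP <-.
    by ring.
  rewrite (eq_bigr (fun k => - (kap^-1 * (kap * h ord0 k * Phi (fun x => x ord0 k * D j f x) w))
     - h ord0 k * (k == j)%:R%:C * Phi f w)); last first.
    move=> k _; rewrite mulrCA (coord_Phi j (rapidS_coordM k fr) wZ') derive_coordM//; last exact: fr.1.
    rewrite (@Phi_lin _ f (fun x => x ord0 k * D j f x) w _ fr _ wZ'); last first.
      by apply: rapidS_coordM; exact: pderivs_in_derive.
    have := kap_neq0 => k0; field.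
    exact: k0.
  rewrite sumrB sumrN -mulr_sumr.
  have -> : \sum_(k < n) h ord0 k * (k == j)%:R%:C * Phi f w = h ord0 j * Phi f w.
    rewrite (bigD1 j)//= eqxx mulr1 big1 ?addr0// => k /negPf ->.
    by rewrite mulr0 mul0r.
  by rewrite /Phi_diff; ring.
apply: le_trans (ler_wpM2l _ (normc_sub_le _ _)) _; first by rewrite exprn_ge0// normc_ge0.
rewrite normcN !Normc.normcM mulrDr [leRHS]mulrDl lerD//.
  by rewrite mulrCA -mulrA ler_wpM2l ?normc_ge0// fB.
rewrite mulrCA expr2 [leRHS]mulrA [leRHS]mulrC; apply: ler_pM; rewrite ?normc_ge0//.
- by rewrite mulr_ge0 ?exprn_ge0 ?normc_ge0.
- exact: normc_coord_le.
- exact: fB1.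
Qed.

Definition Re_rV w : E := map_mx (@complex.Re R) w.

(* Turns the coordinatewise estimates into one in the sup norm. *)
Lemma weight_coord_le w N (a A0 : R) (A : 'I_n -> R) : 0 <= a -> a <= A0 ->
  (forall j, normc (w ord0 j) ^+ N * a <= A j) ->
  (1 + `|Re_rV w|) ^+ N * a <= 2 ^+ N * (A0 + \sum_j A j).
Proof.
move=> a0 aA wA.
have Ap j : 0 <= A j by apply: le_trans (wA j); rewrite mulr_ge0 ?exprn_ge0 ?normc_ge0.
have [w1|w1] := leP `|Re_rV w| 1.
  apply: ler_pM; rewrite ?exprn_ge0 ?addr_ge0//.
    by rewrite lerXn2r ?nnegrE ?addr_ge0//; lra.
  by rewrite (le_trans aA)// lerDl sumr_ge0.
have [j wj] : exists j, `|Re_rV w| <= normc (w ord0 j).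
  have : mx_norm (Re_rV w) != 0.
    by apply: contraTN w1 => /eqP xx; rewrite -leNgt [leLHS]xx.
  move=> /mx_norm_neq0[[i j] xij]; exists j.
  by rewrite [leLHS]xij/= (ord1 i) mxE normr_Re_le.
apply: (@le_trans _ _ (2 ^+ N * (normc (w ord0 j) ^+ N * a))).
  rewrite mulrA -exprMn ler_wpM2r// lerXn2r ?nnegrE ?addr_ge0 ?mulr_ge0 ?normc_ge0//.
  by rewrite (@le_trans _ _ (2 * `|Re_rV w|)) ?ler_wpM2l//; lra.
rewrite ler_wpM2l ?exprn_ge0// (le_trans (wA j))//.
rewrite (bigD1 j)//= addrCA lerDl addr_ge0//; first exact: le_trans a0 aA.
exact: sumr_ge0.
Qed.

Lemma Phi_decay N f Z : rapidS Z f -> exists2 B, 0 <= B &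
  forall w, im_size w <= Z -> (1 + `|Re_rV w|) ^+ N * normc (Phi f w) <= B.
Proof.
move=> fr; have [A0 A00 fA0] := Phi_bounded (smooth_measurable fr.1) (fr.2 [::]).
have /choice[A fA] j : exists B, 0 <= B /\
    forall w, im_size w <= Z -> normc (w ord0 j) ^+ N * normc (Phi f w) <= B.
  by have [B ? ?] := Phi_decay_coord j N fr; exists B.
exists (2 ^+ N * (A0 + \sum_j A j)).
  by rewrite mulr_ge0 ?exprn_ge0// addr_ge0// sumr_ge0// => j _; case: (fA j).
move=> w wZ; apply: weight_coord_le; rewrite ?normc_ge0 ?fA0// => j.
by case: (fA j) => _; exact.
Qed.

(** The uniformity in h is what later dominates the difference quotients of [hol_ext] by one
    integrable function. *)
Lemma Phi_rem_decay N f Z : rapidS (Z + 2 * pi) f -> exists2 B, 0 <= B &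
  forall w h, im_size w <= Z -> size1 h <= 1 ->
    (1 + `|Re_rV w|) ^+ N * normc (Phi_rem f w h) <= B * size1 h ^+ 2.
Proof.
move=> fr.
have /choice[A fA] j : exists B, 0 <= B /\ forall w h, im_size w <= Z -> size1 h <= 1 ->
    normc (w ord0 j) ^+ N * normc (Phi_rem f w h) <= B * size1 h ^+ 2.
  by have [B ? ?] := Phi_rem_decay_coord j N fr; exists B.
have [A0 A00 fA0] := Phi_rem_bounded fr.
exists (2 ^+ N * (A0 + \sum_j A j)).
  by rewrite mulr_ge0 ?exprn_ge0// addr_ge0// sumr_ge0// => j _; case: (fA j).
move=> w h wZ h1; rewrite -mulrA mulrDl mulr_suml; apply: weight_coord_le.
- exact: normc_ge0.
- exact: fA0.
- by move=> j; case: (fA j) => _; exact.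
Qed.

End fourier_decay.
(** * Schwartz majorants *)

Section laplace.
Context {R : realType} {n : nat}.
Local Notation E := 'rV[R]_n.
Implicit Types (f : E -> R) (x u : E).

Lemma dotrVE x u : dotrV x u = lform (fun j => u ord0 j) x.
Proof. by apply: eq_bigr => j _; rewrite mulrC. Qed.

Lemma dotrVC x u : dotrV x u = dotrV u x.
Proof. by apply: eq_bigr => j _; rewrite mulrC. Qed.

Lemma dotrVDl x y u : dotrV (x + y) u = dotrV x u + dotrV y u.
Proof. by rewrite !dotrVE; exact: raddfD. Qed.

Lemma normr_dotrV_le x u : `|dotrV x u| <= n%:R * `|x| * `|u|.
Proof.
apply: le_trans (ler_norm_sum _ _ _) _.
apply: (@le_trans _ _ (\sum_(j < n) `|x| * `|u|)); last first.
  by rewrite sumr_const card_ord -mulrA mulr_natl.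
by apply: ler_sum => j _; rewrite normrM ler_pM// norm_coord_le.
Qed.

Lemma measurable_dotrV x : measurable_fun setT (dotrV x).
Proof.
apply: measurable_sum => j; apply: measurable_funM => //.
exact: measurable_coord.
Qed.

Lemma Rintegral_sum_lin d (T : measurableType d) (mu : {measure set T -> \bar R})
    (I : Type) (s : seq I) (c : I -> R) (F : I -> T -> R) :
  (forall i, mu.-integrable setT (fun t => (F i t)%:E)) ->
  mu.-integrable setT (fun t => (\sum_(i <- s) c i * F i t)%:E) /\
  \int[mu]_t (\sum_(i <- s) c i * F i t) = \sum_(i <- s) c i * \int[mu]_t F i t.
Proof.
move=> Fi; elim: s => [|i s [si sE]].
  under eq_fun do rewrite big_nil; rewrite big_nil; split; first exact: integrable0.
  by under eq_Rintegral do rewrite big_nil; rewrite Rintegral_cst// mul0r.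
under eq_fun do rewrite big_cons; rewrite big_cons; split.
  by apply: integrable_addr => //; exact: integrable_mulr.
under eq_Rintegral do rewrite big_cons.
rewrite (RintegralD measurableT (integrable_mulr (c i) (Fi i)) si) sE RintegralZl//.
exact: Fi.
Qed.

(** The factor 2 comes from |x - u|^2 = |x|^2 + |u|^2 - 2 x.u: a convolution with the Gaussian is
    the Gaussian times a Laplace transform, which makes it easy to differentiate. *)
Definition Lap f x : R := \int[volume n]_u (f u * expR (2 * dotrV x u)).

Definition superrapid f := measurable_fun setT f /\ forall Z, rapid Z f.

Lemma superrapidM (p f : E -> R) : measurable_fun setT p -> poly_growth p ->
  superrapid f -> superrapid (fun u => p u * f u).
Proof.
move=> mp pp [mf fr]; split; first exact: measurable_funM.
by move=> Z; exact: (rapidM pp (fr Z)).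
Qed.

Lemma measurable_Lap_integrand f x : measurable_fun setT f ->
  measurable_fun setT (fun u => f u * expR (2 * dotrV x u)).
Proof.
move=> mf; apply: measurable_funM => //; apply: measurableT_comp => //.
by apply: measurable_funM => //; exact: measurable_dotrV.
Qed.

Lemma integrable_Lap f x : superrapid f ->
  (volume n).-integrable setT (fun u => (f u * expR (2 * dotrV x u))%:E).
Proof.
move=> [mf fr].
apply: (integrable_dom _ (integrable_expw mf (fr (2 * n%:R * `|x|)))) => [|u].
  exact: measurable_Lap_integrand.
rewrite normrM ler_wpM2l// ger0_norm ?expR_ge0// ler_expR -!mulrA ler_wpM2l//.
by rewrite (le_trans (ler_norm _))// mulrA normr_dotrV_le.
Qed.

(** For |h| <= 1 the Taylor remainder of e^(2 h.u) is at most |h|^2 (2 n |u|)^2 e^(2 n |u|); the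
    polynomial goes into [g], the exponential into the rate, and [I] is the resulting quadratic
    constant. *)
Lemma differentiable_Lap f x : superrapid f ->
  differentiable (Lap f) x /\
  'd (Lap f) x = lform (fun k => Lap (fun u => 2 * u ord0 k * f u) x) :> (E -> R^o).
Proof.
move=> fs; have [mf fr] := fs.
have cs k : superrapid (fun u => 2 * u ord0 k * f u).
  apply: superrapidM => //.
    by apply: measurable_funM => //; exact: measurable_coord.
  exact: (slow_coordM 2 k).2 [::].
pose Z := 2 * n%:R * `|x|.
pose g u := (2 * n%:R * `|u|) ^+ 2 * f u.
have gs : superrapid g.
  apply: superrapidM => //.
    apply: measurable_funX; apply: measurable_funM => //; exact: measurable_normrV.
  exists 2%N, ((2 * n%:R) ^+ 2) => u.
  by rewrite ger0_norm ?exprn_ge0 ?mulr_ge0// exprMn ler_wpM2l// lerXn2r ?nnegrE// lerDr.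
have gi := integrable_expw gs.1 (gs.2 (Z + 2 * n%:R)).
set I := \int[volume n]_u (`|g u| * expR ((Z + 2 * n%:R) * `|u|)).
have I0 : 0 <= I by apply: Rintegral_ge0 => u _; rewrite mulr_ge0 ?expR_ge0.
apply: (@differentiable_quadratic _ _ _ (Lap f : E -> R^o) x _ I 1) => //.
  exact: continuous_lform.
move=> h h1.
have [si sE] := Rintegral_sum_lin (index_enum _) (fun k => h ord0 k)
  (fun k => integrable_Lap x (cs k)).
have -> : Lap f (h + x) - Lap f x - lform (fun k => Lap (fun u => 2 * u ord0 k * f u) x) h =
    \int[volume n]_u (f u * expR (2 * dotrV x u) *
      (expR (2 * dotrV h u) - 1 - 2 * dotrV h u)).
  rewrite /lform; under eq_bigr do rewrite mulrC.
  rewrite -sE /Lap -RintegralB//; last 2 first.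
  - exact: integrable_Lap.
  - exact: integrable_Lap.
  rewrite -RintegralB//; last by apply: integrable_subr; exact: integrable_Lap.
  apply: eq_Rintegral => u _; rewrite dotrVDl mulrDr expRD.
  rewrite (_ : \sum_(i <- _) _ = f u * expR (2 * dotrV x u) * (2 * dotrV h u)).
    by ring.
  by rewrite /dotrV !mulr_sumr; apply: eq_bigr => k _; ring.
have bnd u : `|f u * expR (2 * dotrV x u) * (expR (2 * dotrV h u) - 1 - 2 * dotrV h u)| <=
    `|h| ^+ 2 * (`|g u| * expR ((Z + 2 * n%:R) * `|u|)).
  have -> : `|g u| = (2 * n%:R * `|u|) ^+ 2 * `|f u|.
    by rewrite /g normrM (ger0_norm (exprn_ge0 _ _))// !mulr_ge0.
  rewrite [X in X <= _]normrM [X in X * _ <= _]normrM (ger0_norm (expR_ge0 _)).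
  have hu : `|2 * dotrV h u| <= 2 * n%:R * `|h| * `|u|.
    by rewrite normrM ger0_norm// -!mulrA ler_wpM2l// mulrA normr_dotrV_le.
  have hu1 : 2 * n%:R * `|h| * `|u| <= 2 * n%:R * `|u|.
    by rewrite ler_wpM2r// ler_piMr ?mulr_ge0.
  rewrite [X in _ <= X](_ : _ = `|f u| * expR (Z * `|u|) *
     ((2 * n%:R * `|h| * `|u|) ^+ 2 * expR (2 * n%:R * `|u|))); last first.
    by rewrite (mulrDl Z) expRD; ring.
  apply: ler_pM; rewrite ?mulr_ge0 ?expR_ge0//.
    rewrite ler_wpM2l// ler_expR /Z -!mulrA ler_wpM2l//.
    by rewrite (le_trans (ler_norm _))// mulrA normr_dotrV_le.
  apply: le_trans (normr_expRB1B_le _) _; apply: ler_pM; rewrite ?exprn_ge0 ?expR_ge0//.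
    by rewrite lerXn2r ?nnegrE ?(le_trans _ hu).
  by rewrite ler_expR (le_trans hu).
have mF : measurable_fun setT (fun u => f u * expR (2 * dotrV x u) *
    (expR (2 * dotrV h u) - 1 - 2 * dotrV h u)).
  apply: measurable_funM; first exact: measurable_Lap_integrand.
  have md : measurable_fun setT (fun u => 2 * dotrV h u).
    by apply: measurable_funM => //; exact: measurable_dotrV.
  apply: measurable_funB => //; apply: measurable_funB => //.
  exact: measurableT_comp.
have ib := integrable_mulr (`|h| ^+ 2) gi.
apply: le_trans (le_normr_Rintegral _ _) _ => //; first exact: (integrable_dom mF ib bnd).
apply: le_trans (le_Rintegral _ _ _ (fun u _ => bnd u)) _ => //.
  by apply: integrable_norm; exact: (integrable_dom mF ib bnd).
by rewrite RintegralZl// mulrC.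
Qed.

Lemma pderiv_Lap s f : superrapid f ->
  pderiv s (Lap f) = Lap (fun u => (\prod_(i <- s) (2 * u ord0 i)) * f u).
Proof.
move=> fs; elim: s => [|i s IH].
  by congr Lap; apply/funext => u; rewrite big_nil mul1r.
rewrite [LHS]/= -/(pderiv s _) IH; apply/funext => x.
have ps : superrapid (fun u => (\prod_(i <- s) (2 * u ord0 i)) * f u).
  have pp : slow (fun u : E => \prod_(i <- s) (2 * u ord0 i)) := slow_prod s (slow_coordM 2).
  by apply: superrapidM => //; [exact: smooth_measurable pp.1|exact: pp.2 [::]].
have [dL LE] := differentiable_Lap x ps.
rewrite deriveE// LE lform_delta; congr (Lap _ x); apply/funext => u.
by rewrite big_cons mulrA.
Qed.

Lemma smooth_Lap f : superrapid f -> smooth (Lap f).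
Proof.
move=> fs s x; rewrite (pderiv_Lap s fs).
have pp : slow (fun u : E => \prod_(i <- s) (2 * u ord0 i)) := slow_prod s (slow_coordM 2).
apply: (differentiable_Lap x _).1; apply: superrapidM => //.
  exact: smooth_measurable pp.1.
exact: pp.2 [::].
Qed.

Lemma sqnormB x u : sqnorm (x - u) = sqnorm x + sqnorm u - 2 * dotrV x u.
Proof.
rewrite /sqnorm /dotrV mulr_sumr -sumrN -!big_split/=; apply: eq_bigr => j _.
by rewrite !mxE; ring.
Qed.

(** Peetre's inequality: it transfers polynomial weights between the two factors of a
    convolution. *)
Lemma weight_le_sub x u : 1 + `|x| <= (1 + `|u|) * (1 + `|x - u|).
Proof.
have := ler_normD (x - u) u; rewrite subrK => h.
by have := normr_ge0 u; have := normr_ge0 (x - u); nra.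
Qed.

Notation gaussian := (expR \o gaussq 1 : E -> R).

Lemma superrapid_gaussian f : measurable_fun setT f -> poly_growth f ->
  superrapid (fun u => f u * gaussian u).
Proof.
move=> mf pf; have gs Z : pderivs_in (rapid Z) gaussian := rapid_gaussq Z ltr01.
apply: superrapidM => //; split; first exact: smooth_measurable (gs 0).1.
by move=> Z; exact: (gs Z).2 [::].
Qed.

Lemma gaussian_LapE f x : superrapid (fun u => f u * gaussian u) ->
  gaussian x * Lap (fun u => f u * gaussian u) x =
  \int[volume n]_u (f u * gaussian (x - u)).
Proof.
move=> sr; rewrite -RintegralZl//; last exact: integrable_Lap.
apply: eq_Rintegral => u _ /=; rewrite /gaussq !mul1r sqnormB.
rewrite (_ : - (_ + _ - _) = - sqnorm x + - sqnorm u + 2 * dotrV x u); last by ring.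
by rewrite !expRD; ring.
Qed.

Lemma measurable_subrV x : measurable_fun setT (fun u : E => x - u).
Proof.
apply: measurable_fun_rV => i.
rewrite (_ : (fun _ => _) = fun u : E => x ord0 i - u ord0 i); last first.
  by apply/funext => u; rewrite !mxE.
by apply: measurable_funB => //; exact: measurable_coord.
Qed.

Lemma gaussian_Lap_bounded f m : measurable_fun setT f -> rapid 0 f ->
  exists B, forall x, (1 + `|x|) ^+ m *
    `|gaussian x * Lap (fun u => f u * gaussian u) x| <= B.
Proof.
move=> mf rf.
have sr := superrapid_gaussian mf (rapid_poly_growth (lexx 0) rf).
have [C hC] := (rapid_gaussq (R := R) (n := n) 0 ltr01).2 [::] m.
have {}hC v : (1 + `|v|) ^+ m * gaussian v <= C.
  have := hC v; rewrite /= mul0r expR0 mul1r ger0_norm ?expR_ge0//.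
have mw : measurable_fun setT (fun u : E => (1 + `|u|) ^+ m).
  by apply: measurable_funX; apply: measurable_funD => //; exact: measurable_normrV.
have iw : (volume n).-integrable setT (fun u => (C * ((1 + `|u|) ^+ m * `|f u|))%:E).
  apply: integrable_mulr; apply: (@rapid_integrable _ _ _ 0) => //.
    by apply: measurable_funM => //; exact: measurableT_comp.
  apply: rapidM.
    by exists m, 1 => u; rewrite mul1r ger0_norm// weightX_ge0.
  by apply: (rapid_dom (C := 1) (g := f)) rf => u; rewrite mul1r normr_id.
exists (\int[volume n]_u (C * ((1 + `|u|) ^+ m * `|f u|))) => x.
rewrite (gaussian_LapE x sr).
rewrite -[X in X * _]ger0_norm ?weightX_ge0// -normrM.
have bnd u : `|(1 + `|x|) ^+ m * (f u * gaussian (x - u))| <= C * ((1 + `|u|) ^+ m * `|f u|).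
  rewrite !normrM (ger0_norm (weightX_ge0 _ _)) (ger0_norm (expR_ge0 _)).
  apply: (@le_trans _ _ (((1 + `|u|) * (1 + `|x - u|)) ^+ m * (`|f u| * gaussian (x - u)))).
    rewrite ler_wpM2r ?mulr_ge0 ?expR_ge0//.
    by rewrite lerXn2r ?nnegrE ?mulr_ge0 ?addr_ge0// weight_le_sub.
  rewrite exprMn [X in X <= _](_ : _ = ((1 + `|x - u|) ^+ m * gaussian (x - u)) *
    ((1 + `|u|) ^+ m * `|f u|)); last by ring.
  by rewrite ler_wpM2r ?mulr_ge0 ?weightX_ge0.
have ms : measurable_fun setT (fun u : E => gaussian (x - u)).
  exact: (measurableT_comp (smooth_measurable (rapid_gaussq 0 ltr01).1) (measurable_subrV x)).
have mF : measurable_fun setT (fun u : E => (1 + `|x|) ^+ m * (f u * gaussian (x - u))).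
  by apply: measurable_funM => //; exact: measurable_funM.
have iF := integrable_dom mF iw bnd.
have i0 : (volume n).-integrable setT (fun u : E => (f u * gaussian (x - u))%:E).
  apply: (integrable_dom _ (integrable_mulr 1 iw)) => [|u]; first exact: measurable_funM.
  rewrite mul1r (le_trans _ (bnd u))// [X in _ <= X]normrM (ger0_norm (weightX_ge0 _ _)).
  by rewrite ler_peMl// exprn_ege1// lerDl.
rewrite -RintegralZl//; apply: le_trans (le_normr_Rintegral _ _) _ => //.
by apply: le_Rintegral => //; exact: integrable_norm.
Qed.

(** Smoothing of a function that is merely measurable. Each of the factors [gaussian] and [Lap] is
    differentiated separately, and the decay comes from their product, the growth of [Lap] alone
    being of Gaussian type. *)
Lemma schwartz_gauss_conv f : measurable_fun setT f -> rapid 0 f ->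
  pderivs_in (rapid 0) (fun x => \int[volume n]_u (f u * gaussian (x - u))).
Proof.
move=> mf rf.
have sr := superrapid_gaussian mf (rapid_poly_growth (lexx 0) rf).
rewrite (_ : (fun x => _) = gaussian \* Lap (fun u => f u * gaussian u)); last first.
  by apply/funext => x; rewrite -(gaussian_LapE x sr).
(* [P1] and [P2] contain all derivatives of the respective factors. A product of one of each is a
   slow multiple of the Gaussian convolution of q f for a slow q, to which [gaussian_Lap_bounded]
   applies. *)
pose P1 (g : E -> R) := exists2 p, slow p & g = p \* gaussian.
pose P2 (g : E -> R) := exists2 p, slow p & g = Lap (fun u => p u * f u * gaussian u).
apply: (@pderivs_inM _ _ P1 P2); first exact: rapidD.
- move=> _ _ [p sp ->] [q sq ->].
  rewrite (_ : _ \* _ = p \* (gaussian \* Lap (fun u => q u * f u * gaussian u))); last first.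
    by apply/funext => x /=; rewrite mulrA.
  apply: rapidM; first exact: sp.2 [::].
  move=> m; have [||B hB] := @gaussian_Lap_bounded (fun u => q u * f u) m.
  + by apply: measurable_funM => //; exact: smooth_measurable sq.1.
  + by apply: rapidM => //; exact: sq.2 [::].
  by exists B => x; rewrite mul0r expR0 mul1r.
- split; first exact: smooth_expR (slow_gaussq 1).
  by move=> s; have [p sp ->] := pderiv_expR s (slow_gaussq (R := R) (n := n) 1); exists p.
- split; first exact: smooth_Lap.
  move=> s; rewrite (pderiv_Lap s sr); eexists; first exact: (slow_prod s (slow_coordM 2)).
  by congr Lap; apply/funext => u; rewrite mulrA.
Qed.

Definition cube x : R := \prod_(j < n) \1_(`[(-1)%R, 1%R]%classic) (x ord0 j).

Lemma cube_ge0 x : 0 <= cube x.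
Proof. by apply: prodr_ge0 => j _; rewrite indicE. Qed.

Lemma cubeE x : cube x != 0 -> cube x = 1 /\ `|x| <= 1.
Proof.
rewrite /cube prodf_seq_neq0 => /allP h.
have hj j : x ord0 j \in `[(-1)%R, 1%R]%classic.
  by have := h j (mem_index_enum _); rewrite indicE /= pnatr_eq0 eqb0 negbK.
split; first by apply: big1 => j _; rewrite indicE hj.
by apply: norm_rV_le => // j; rewrite ler_norml; have := hj j; rewrite inE /= in_itv.
Qed.

Lemma measurable_cube : measurable_fun setT cube.
Proof.
apply: measurable_prod => j _.
apply: (measurableT_comp (f := \1_(`[(-1)%R, 1%R]%classic) : R -> R)).
  exact: measurable_indic.
exact: measurable_coord.
Qed.

Lemma integral_cube : (\int[volume n]_x (cube x)%:E = (2 ^+ n)%:E)%E.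
Proof.
rewrite (@ge0_integral_volume_prod _ _ (fun _ => \1_(`[(-1)%R, 1%R]%classic)) (fun=> 2)).
- by rewrite prodr_const card_ord.
- by move=> j; exact: measurable_indic.
- by move=> j t; rewrite indicE.
- move=> j; rewrite integral_indic// setIT [LHS]lebesgue_measure_itv/= lte_fin ifT; last by lra.
  by rewrite -EFinB opprK.
Qed.

Lemma measurable_inv_weight : measurable_fun setT (fun x => (1 + `|x|)^-1).
Proof.
apply: continuous_measurable_rV => x.
apply: (@cvgV _ _ (nbhs x) _ (fun y : E => 1 + `|y|) (1 + `|x|)).
  by rewrite gt_eqF// weight_gt0.
by apply: cvgD; [exact: cvg_cst|exact: norm_continuous].
Qed.

(** The best bound implied by the constants, the infimum [H] over N, decreases rapidly but is only
    measurable. Its Gaussian convolution is Schwartz, and it stays above a fixed multiple of [a]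
    because the bound at x persists, up to 2^N, on the unit cube around x. *)
Lemma schwartz_majorant (C : nat -> R) : exists Psi : E -> R,
  [/\ pderivs_in (rapid 0) Psi, forall x, 0 <= Psi x &
      forall x (a : R), (forall N, (1 + `|x|) ^+ N * a <= C N) -> a <= Psi x].
Proof.
(* The maximum with 0 guards against negative constants; 2^N absorbs the change of the weight over
   distance 1. *)
pose c N := Num.max 0 (C N) * 2 ^+ N.
have c0 N : 0 <= c N by rewrite mulr_ge0 ?exprn_ge0// le_max lexx.
pose hN N (u : E) := c N / (1 + `|u|) ^+ N.
have hN0 N u : 0 <= hN N u by rewrite divr_ge0 ?weightX_ge0.
(* The tail infimum from index 0 is the full infimum, in a form known to be measurable. *)
pose H u := infs (hN ^~ u) 0.
have lb u : has_lbound (range (hN ^~ u)) by exists 0 => _ [N _ <-].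
have HE u : H u = inf (range (hN ^~ u)).
  by rewrite /H /infs /sdrop; congr inf; apply/seteqP; split => _ [N _ <-]; exists N.
have Hle N u : H u <= hN N u by rewrite HE; apply: ge_inf => //; exists N.
have Hge u a : (forall N, a <= hN N u) -> a <= H u.
  move=> ha; rewrite HE; apply: lb_le_inf; first by exists (hN 0%N u), 0%N.
  by move=> _ [N _ <-].
have H0 u : 0 <= H u by apply: Hge.
have mH : measurable_fun setT H.
  apply: measurable_fun_infs => // N; apply: measurable_funM => //.
  rewrite (_ : (fun _ => _) = fun u : E => ((1 + `|u|)^-1) ^+ N); last first.
    by apply/funext => u; rewrite exprVn.
  by apply: measurable_funX; exact: measurable_inv_weight.
have rH : rapid 0 H.
  move=> k; exists (c k) => u; rewrite mul0r expR0 mul1r ger0_norm// mulrC.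
  by move: (Hle k u); rewrite /hN ler_pdivlMr ?weightX_gt0.
pose P x := \int[volume n]_u (H u * gaussian (x - u)).
have sP : pderivs_in (rapid 0) P := schwartz_gauss_conv mH rH.
(* Volume of the cube of side 2 times a lower bound of the Gaussian on it, the squared Euclidean
   length being at most n there. *)
pose kappa : R := 2 ^+ n * expR (- n%:R).
have k0 : 0 < kappa by rewrite mulr_gt0 ?exprn_gt0 ?expR_gt0.
exists (fun x => kappa^-1 * P x); split.
- have := slow_rapid (slow_cst kappa^-1) sP; exact.
- move=> x; rewrite mulr_ge0 ?invr_ge0 ?(ltW k0)//; apply: Rintegral_ge0 => u _.
  by rewrite mulr_ge0 ?expR_ge0.
move=> x a ha; rewrite ler_pdivlMl//.
have [a0|a0] := leP a 0.
  apply: (@le_trans _ _ 0); first by rewrite pmulr_rle0.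
  by apply: Rintegral_ge0 => u _; rewrite mulr_ge0 ?expR_ge0.
have bnd u : a * expR (- n%:R) * cube (u - x) <= H u * gaussian (x - u).
  have [->|/cubeE[-> ux1]] := eqVneq (cube (u - x)) 0.
    by rewrite mulr0 mulr_ge0 ?expR_ge0.
  rewrite mulr1; apply: ler_pM; rewrite ?(ltW a0) ?expR_ge0//.
    apply: Hge => N; rewrite ler_pdivlMr ?weightX_gt0// /c mulrC.
    apply: (@le_trans _ _ ((2 * (1 + `|x|)) ^+ N * a)).
      rewrite ler_wpM2r ?(ltW a0)// lerXn2r ?nnegrE ?mulr_ge0 ?addr_ge0//.
      by have := weight_le_sub u x; have := normr_ge0 x; nra.
    rewrite exprMn -mulrA mulrC ler_wpM2r ?exprn_ge0// le_max ha orbT//.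
  rewrite /= ler_expR /gaussq mul1r lerN2 (le_trans (sqnorm_le _))//.
  by rewrite ler_piMr// exprn_ile1// distrC.
have mcx : measurable_fun setT (fun u : E => cube (u - x)).
  exact: (measurableT_comp measurable_cube (measurable_addrV (- x))).
have icx : (\int[volume n]_u (cube (u - x))%:E = (2 ^+ n)%:E)%E.
  rewrite (@ge0_integral_volume_shift _ _ (fun u => (cube u)%:E)) ?integral_cube//.
    by apply/measurable_EFinP; exact: measurable_cube.
  by move=> u; rewrite lee_fin cube_ge0.
have Icx : (volume n).-integrable setT (fun u : E => (cube (u - x))%:E).
  apply: integrable_lty => //; under eq_integral do rewrite ger0_norm ?cube_ge0//.
  by rewrite icx ltry.
rewrite (_ : kappa * a = \int[volume n]_u (a * expR (- n%:R) * cube (u - x))); last first.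
  by rewrite RintegralZl// /Rintegral icx /kappa /=; ring.
apply: le_Rintegral => //; first exact: integrable_mulr.
apply: (integrable_dom (k := H)) => [||u].
- apply: measurable_funM => //.
  exact: (measurableT_comp (smooth_measurable (rapid_gaussq 0 ltr01).1) (measurable_subrV x)).
- exact: rapid_integrable (lexx 0) mH rH.
- rewrite normrM (ger0_norm (H0 _)) (ger0_norm (expR_ge0 _)) ler_piMr//.
  by rewrite -[leRHS]expR0 ler_expR /gaussq mul1r oppr_le0 sumr_ge0// => j _; rewrite sqr_ge0.
Qed.

End laplace.

(** * The Fourier transform *)

Section fourier_transform.
Context {R : realType}.
Local Notation C := R[i].

Lemma cintegral_fubini_dom d1 d2 (T1 : measurableType d1) (T2 : measurableType d2)
    (m1 : {sigma_finite_measure set T1 -> \bar R})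
    (m2 : {sigma_finite_measure set T2 -> \bar R})
    (f : T1 * T2 -> C) (a : T1 -> R) (b : T2 -> R) : cmeasurable f ->
  m1.-integrable setT (EFin \o a) -> m2.-integrable setT (EFin \o b) ->
  (forall x y, normc (f (x, y)) <= a x * b y) ->
  cintegral m1 (fun x => cintegral m2 (fun y => f (x, y))) =
  cintegral m2 (fun y => cintegral m1 (fun x => f (x, y))).
Proof.
move=> mf ia ib fab; apply: cintegral_fubini => //.
have ma : measurable_fun setT a by apply/measurable_EFinP; exact: measurable_int ia.
have mb : measurable_fun setT b by apply/measurable_EFinP; exact: measurable_int ib.
have mfn := cmeasurable_norm mf.
have na : measurable_fun setT (fun x => `|a x|%:E).
  by apply/measurable_EFinP; exact: measurableT_comp.
have nb : measurable_fun setT (fun x => `|b x|%:E).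
  by apply/measurable_EFinP; exact: measurableT_comp.
have na' : measurable_fun setT (fun x => `|a x|) by exact: measurableT_comp.
have nb' : measurable_fun setT (fun x => `|b x|) by exact: measurableT_comp.
have bd := @iterated_integral_lty_dom _ _ _ _ _ m1 m2 (fun z => normc (f z))
  (fun z => `|a z.1| * `|b z.2|) mfn.
have -> : (\int[m1]_x \int[m2]_y (normc (f (x, y)))%:E =
    \int[m1]_x \int[m2]_y `|normc (f (x, y))|%:E)%E.
  by apply: eq_integral => x _; apply: eq_integral => y _; rewrite ger0_norm ?normc_ge0.
apply: bd.
- by apply: measurable_funM; [exact: measurableT_comp na' measurable_fst|
    exact: measurableT_comp nb' measurable_snd].
- by case=> x y /=; rewrite ger0_norm ?normc_ge0// -normrM (le_trans (fab x y))// ler_norm.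
have -> : (\int[m1]_x \int[m2]_y (`|a x| * `|b y|)%:E =
    \int[m1]_x (`|a x|%:E * \int[m2]_y `|b y|%:E))%E.
  apply: eq_integral => x _; rewrite -ge0_integralZl ?lee_fin//.
have ibn : (\int[m2]_y `|b y|%:E < +oo)%E by have /integrableP[] := ib.
rewrite ge0_integralZr//; last by apply: integral_ge0 => y _; rewrite lee_fin.
apply: lte_mul_pinfty => //; first by apply: integral_ge0 => y _; rewrite lee_fin.
  by rewrite ge0_fin_numE ?integral_ge0//; have /integrableP[] := ia.
Qed.

Section rn.
Context {n : nat}.
Local Notation E := 'rV[R]_n.
Local Notation vol := (volume n : {measure set E -> \bar R}).
Implicit Types (f : E -> R) (phi psi : E -> C) (x y xi : E).

Lemma ker_toC xi x : ker (rV_toC xi) x = expi (- (2 * pi * dotrV x xi)).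
Proof.
have e1 : lform (fun j => 2 * pi * Ima (rV_toC xi ord0 j)) x = 0.
  by rewrite /lform big1// => j _; rewrite mxE /= mulr0 mul0r.
have e2 : lform (fun j => - (2 * pi) * Rea (rV_toC xi ord0 j)) x = - (2 * pi * dotrV x xi).
  rewrite /lform /dotrV mulr_sumr -sumrN; apply: eq_bigr => j _.
  by rewrite mxE /=; ring.
by apply: complex_ext; rewrite ?Re_ker ?Im_ker e1 e2 expR0 mul1r.
Qed.

Lemma im_size_toC xi : im_size (rV_toC xi) = 0.
Proof. by rewrite /im_size big1 ?mulr0// => j _; rewrite mxE /= normr0. Qed.

Lemma Re_rV_toC xi : Re_rV (rV_toC xi) = xi.
Proof. by apply/rowP => j; rewrite !mxE. Qed.

Lemma fourier_real f xi : fourier (fun x => (f x)%:C) xi = Phi f (rV_toC xi).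
Proof. by apply: eq_cintegral => x; rewrite ker_toC mulrC. Qed.

Lemma cmeasurable_expi d (T : measurableType d) (k : T -> R) :
  measurable_fun setT k -> cmeasurable (fun t => expi (k t)).
Proof.
move=> mk; split => /=; apply: (measurableT_comp _ mk).
  by apply: continuous_measurable_fun => t; exact: continuous_cos.
by apply: continuous_measurable_fun => t; exact: continuous_sin.
Qed.

Lemma measurable_dotrV2 d (T : measurableType d) (u v : T -> E) :
  measurable_fun setT u -> measurable_fun setT v ->
  measurable_fun setT (fun t => dotrV (u t) (v t)).
Proof.
move=> mu mv; apply: measurable_sum => j; apply: measurable_funM.
  exact: (measurableT_comp (measurable_coord j) mu).
exact: (measurableT_comp (measurable_coord j) mv).
Qed.

Lemma cmeasurable_fourier_kernel d (T : measurableType d) (u v : T -> E) :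
  measurable_fun setT u -> measurable_fun setT v ->
  cmeasurable (fun t => expi (- (2 * pi * dotrV (u t) (v t)))).
Proof.
move=> mu mv; apply: cmeasurable_expi; apply: measurableT_comp => //.
by apply: measurable_funM => //; exact: measurable_dotrV2.
Qed.

Lemma cmeasurable_fourier phi : cmeasurable phi -> cmeasurable (fourier phi).
Proof.
move=> mphi.
apply: (@cmeasurable_cintegral_param _ _ _ _ _ (volume n)
  (fun z : E * E => expi (- (2 * pi * dotrV z.2 z.1)) * phi z.2)).
apply: cmeasurableM; last exact: (cmeasurable_comp measurable_snd mphi).
exact: (cmeasurable_fourier_kernel measurable_snd measurable_fst).
Qed.

Lemma cintegrable_fourier_integrand phi xi : cintegrable vol phi ->
  cintegrable vol (fun x => expi (- (2 * pi * dotrV x xi)) * phi x).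
Proof.
move=> iphi; have mphi := cintegrable_measurable iphi.
apply: (cintegrable_dom _ (cintegrable_norm iphi)) => [|x].
  apply: cmeasurableM => //.
  exact: (@cmeasurable_fourier_kernel _ _ id (fun=> xi)).
by rewrite Normc.normcM normc_expi mul1r.
Qed.

Lemma fourierD phi psi xi : cintegrable vol phi -> cintegrable vol psi ->
  fourier (fun x => phi x + psi x) xi = fourier phi xi + fourier psi xi.
Proof.
move=> ip iq; rewrite /fourier -cintegralD; try exact: cintegrable_fourier_integrand.
by apply: eq_cintegral => x; rewrite mulrDr.
Qed.

Lemma fourierZ c phi xi : cintegrable vol phi ->
  fourier (fun x => c * phi x) xi = c * fourier phi xi.
Proof.
move=> ip; rewrite /fourier -cintegralZ; last exact: cintegrable_fourier_integrand.
by apply: eq_cintegral => x; rewrite mulrCA.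
Qed.

Lemma normc_fourier_le phi xi : cintegrable vol phi ->
  normc (fourier phi xi) <= 2 * \int[volume n]_x normc (phi x).
Proof.
move=> ip; apply: normc_cintegral_le; first exact: cintegrable_fourier_integrand.
  exact: cintegrable_norm.
by move=> x; rewrite Normc.normcM normc_expi mul1r.
Qed.

Lemma fourier_mult phi psi : cintegrable vol phi -> cintegrable vol psi ->
  cintegral vol (fun x => phi x * fourier psi x) =
  cintegral vol (fun x => fourier phi x * psi x).
Proof.
move=> ip iq; have mp := cintegrable_measurable ip; have mq := cintegrable_measurable iq.
transitivity (cintegral vol (fun x => cintegral vol (fun y =>
    phi x * (expi (- (2 * pi * dotrV y x)) * psi y)))).
  by apply: eq_cintegral => x; rewrite cintegralZ//; exact: cintegrable_fourier_integrand.
rewrite (@cintegral_fubini_dom _ _ _ _ (volume n) (volume n)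
  (fun z : E * E => phi z.1 * (expi (- (2 * pi * dotrV z.2 z.1)) * psi z.2))
  (fun x => normc (phi x)) (fun x => normc (psi x))).
- apply: eq_cintegral => y; rewrite [RHS]mulrC -cintegralZ; last exact: cintegrable_fourier_integrand.
  by apply: eq_cintegral => x /=; rewrite dotrVC; ring.
- apply: cmeasurableM; first exact: (cmeasurable_comp measurable_fst mp).
  apply: cmeasurableM; last exact: (cmeasurable_comp measurable_snd mq).
  exact: (cmeasurable_fourier_kernel measurable_snd measurable_fst).
- exact: cintegrable_norm.
- exact: cintegrable_norm.
- by move=> x y; rewrite !Normc.normcM normc_expi mul1r.
Qed.

Definition crapid phi := forall N, exists B, forall x,
  (1 + `|x|) ^+ N * normc (phi x) <= B.

Lemma complex_ReIm (z : C) : z = (Rea z)%:C + 'i * (Ima z)%:C.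
Proof. by case: z => a b; apply: complex_ext => /=; ring. Qed.

Lemma schwartz_measurable phi : schwartz phi -> cmeasurable phi.
Proof.
by move=> /schwartzP[[sr _] [si _]]; split; exact: smooth_measurable.
Qed.

Lemma schwartz_cintegrable phi : schwartz phi -> cintegrable vol phi.
Proof.
move=> /schwartzP[[sr rr] [si ri]]; split.
  exact: (rapid_integrable (lexx 0) (smooth_measurable sr) (rr [::])).
exact: (rapid_integrable (lexx 0) (smooth_measurable si) (ri [::])).
Qed.

Lemma fourier_ReIm phi xi : cintegrable vol phi -> fourier phi xi =
  fourier (fun x => (Rea (phi x))%:C) xi + 'i * fourier (fun x => (Ima (phi x))%:C) xi.
Proof.
move=> [ir ii].
have ir' := cintegrable_real ir; have ii' := cintegrable_real ii.
rewrite -fourierZ// -fourierD//; last exact: cintegrableZ.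
by apply: eq_cintegral => x; rewrite {1}(complex_ReIm (phi x)).
Qed.

Lemma fourier_Phi phi xi : cintegrable vol phi -> fourier phi xi =
  Phi (fun x => Rea (phi x)) (rV_toC xi) + 'i * Phi (fun x => Ima (phi x)) (rV_toC xi).
Proof. by move=> ip; rewrite fourier_ReIm// !fourier_real. Qed.

Lemma normc_i : normc ('i : C) = 1.
Proof. by rewrite /= expr0n expr1n add0r sqrtr1. Qed.

Lemma crapid_fourier phi : schwartz phi -> crapid (fourier phi).
Proof.
move=> sphi N; have ip := schwartz_cintegrable sphi.
move/schwartzP: sphi => [sr si].
have [B1 _ h1] := Phi_decay N sr; have [B2 _ h2] := Phi_decay N si.
exists (B1 + B2) => xi; rewrite fourier_Phi//.
have w0 := weightX_ge0 xi N.
apply: (@le_trans _ _ ((1 + `|xi|) ^+ N * (normc (Phi (fun x => Rea (phi x)) (rV_toC xi)) +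
    normc (Phi (fun x => Ima (phi x)) (rV_toC xi))))).
  rewrite ler_wpM2l// (le_trans (normcD_le _ _))// lerD2l.
  by rewrite Normc.normcM normc_i mul1r.
have z0 : im_size (rV_toC xi) <= 0 by rewrite im_size_toC.
have := h1 _ z0; have := h2 _ z0; rewrite Re_rV_toC mulrDr => u v.
exact: lerD.
Qed.

End rn.
End fourier_transform.

(** * Gaussians *)

Section gaussian_kernels.
Context {R : realType} {n : nat}.
Local Notation E := 'rV[R]_n.
Local Notation C := R[i].
Local Notation leb := (@lebesgue_measure R).
Local Notation RT := (measurableTypeR R).
Implicit Types (x a w : E) (b k : R).

Lemma integral_gauss1 k : 0 < k ->
  (\int[leb]_t (k * expR (- (pi * k ^+ 2 * t ^+ 2)))%:E = 1%:E)%E.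
Proof.
(* The standard deviation whose normal density is k e^(- pi k^2 t^2), i.e. variance 1 / (2 pi
   k^2). *)
move=> k0; pose s : R := Num.sqrt ((pi * k ^+ 2 * 2)^-1).
have pk : 0 < pi * k ^+ 2 * 2 :> R by rewrite !mulr_gt0 ?pi_gt0 ?exprn_gt0.
have s2 : s ^+ 2 = (pi * k ^+ 2 * 2)^-1 by rewrite sqr_sqrtr// invr_ge0 ltW.
have s0 : s != 0 by rewrite gt_eqF// sqrtr_gt0 invr_gt0.
rewrite -(integral_normal_pdf 0 s); apply: eq_integral => t _; congr EFin.
rewrite normal_pdfE// /normal_peak /normal_fun s2.
have pi0 : pi != 0 :> R by rewrite gt_eqF// pi_gt0.
have kn0 : k != 0 by rewrite gt_eqF.
have -> : (pi * k ^+ 2 * 2)^-1 * pi *+ 2 = k^-1 ^+ 2.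
  by rewrite -mulr_natr; move: (pi : R) pi0 => p p0; field; apply/andP.
rewrite sqrtr_sqr ger0_norm ?invr_ge0 ?ltW// invrK; congr (_ * expR _).
by rewrite subr0 -mulr_natr; move: (pi : R) pi0 => p p0; field; apply/andP.
Qed.

(* Locked: the rewriting rules of products would unfold it. *)
Definition gaussk : R -> E -> R :=
  locked (fun k x => k ^+ n * expR (gaussq (pi * k ^+ 2) x)).

Lemma gaussk_def k x : gaussk k x = k ^+ n * expR (gaussq (pi * k ^+ 2) x).
Proof. by rewrite /gaussk -lock. Qed.

Lemma gaussk_defE k : gaussk k = fun x => k ^+ n * expR (gaussq (pi * k ^+ 2) x).
Proof. by apply/funext => x; rewrite gaussk_def. Qed.

Lemma gaussk_ge0 k x : 0 <= k -> 0 <= gaussk k x.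
Proof. by move=> k0; rewrite gaussk_def mulr_ge0 ?exprn_ge0 ?expR_ge0. Qed.

Lemma gausskE k x : gaussk k x = \prod_(j < n) (k * expR (- (pi * k ^+ 2 * x ord0 j ^+ 2))).
Proof.
rewrite gaussk_def big_split/= prodr_const card_ord -expR_sum; congr (_ * expR _).
by rewrite /gaussq mulr_sumr sumrN.
Qed.

Lemma sqnormN x : sqnorm (- x) = sqnorm x.
Proof. by apply: eq_bigr => j _; rewrite mxE sqrrN. Qed.

Lemma gausskN k x : gaussk k (- x) = gaussk k x.
Proof. by rewrite !gaussk_def /gaussq sqnormN. Qed.

Lemma measurable_gaussk k : measurable_fun setT (gaussk k).
Proof.
rewrite gaussk_defE; apply: measurable_funM => //; apply: measurableT_comp => //.
exact: smooth_measurable (slow_gaussq _).1.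
Qed.

Lemma integral_gaussk k a : 0 < k -> (\int[volume n]_x (gaussk k (x - a))%:E = 1)%E.
Proof.
move=> k0; have k0' := ltW k0.
rewrite (@ge0_integral_volume_shift _ _ (fun x => (gaussk k x)%:E) (- a)).
- under eq_integral do rewrite gausskE.
  rewrite (@ge0_integral_volume_prod _ _
    (fun _ t => k * expR (- (pi * k ^+ 2 * t ^+ 2))) (fun=> 1)).
  + by rewrite big1.
  + move=> _; apply: measurable_funM => //; apply: measurableT_comp => //.
    by apply: measurableT_comp => //; apply: measurable_funM => //; exact: measurable_funX.
  + by move=> j t; rewrite mulr_ge0 ?expR_ge0.
  + by move=> j; exact: integral_gauss1.
- by apply/measurable_EFinP; exact: measurable_gaussk.
- by move=> x; rewrite lee_fin gaussk_ge0.
Qed.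

Lemma measurable_gaussk_shift k a : measurable_fun setT (fun x : E => gaussk k (x - a)).
Proof. exact: (measurableT_comp (measurable_gaussk k) (measurable_addrV (- a))). Qed.

Lemma integrable_gaussk k a : 0 < k ->
  (volume n).-integrable setT (fun x : E => (gaussk k (x - a))%:E).
Proof.
move=> k0; apply: integrable_lty; first exact: measurable_gaussk_shift.
under eq_integral do rewrite ger0_norm ?gaussk_ge0 ?ltW//.
by rewrite integral_gaussk// ltry.
Qed.

Lemma Rintegral_gaussk k a : 0 < k -> \int[volume n]_x gaussk k (x - a) = 1.
Proof. by move=> k0; rewrite /Rintegral integral_gaussk. Qed.

Lemma is_derive_quadratic (v : R -> R) (t l B r : R) : 0 <= B -> 0 < r ->
  (forall s, `|s| <= r -> `|v (s + t) - v t - l * s| <= B * `|s| ^+ 2) ->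
  is_derive t (1 : R) v l.
Proof.
move=> B0 r0 hv; pose g s := v s - l * (s - t).
have [] := @differentiable_quadratic R R R g t \0 B r B0 r0.
- exact: cst_continuous.
- move=> s sr; rewrite subr0 /g addrK subrr mulr0 subr0.
  by rewrite (_ : _ - _ - _ = v (s + t) - v t - l * s) ?hv//; ring.
move=> dg gE.
have Dg : is_derive t (1 : R) g 0.
  by apply: DeriveDef; [exact/derivable1_diffP|rewrite deriveE// gE].
have -> : v = g \+ (fun s => l * (s - t)) by apply/funext => s; rewrite /g /= subrK.
apply: is_derive_eq.
rewrite add0r /GRing.scale/=; ring.
Qed.

Lemma rV_toCD x y : rV_toC (x + y) = rV_toC x + rV_toC y.
Proof. exact: map_mxD. Qed.

Lemma size1_toC x : size1 (rV_toC x) = \sum_j `|x ord0 j|.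
Proof. by apply: eq_bigr => j _; rewrite mxE normc_real. Qed.

Lemma kap2 : kap * kap = (- (4 * pi ^+ 2) : R)%:C.
Proof. by apply: complex_ext; rewrite ?ReM ?ImM /=; ring. Qed.

Lemma kap_kap (a b d : R) :
  kap * a%:C * (kap * b%:C / d%:C) = (- (4 * pi ^+ 2) * (a * b / d))%:C.
Proof.
rewrite [LHS](_ : _ = kap * kap * (a%:C * b%:C * d%:C^-1)); last by ring.
by rewrite kap2 -fmorphV -!rmorphM.
Qed.

Lemma Phi_real_mul (c : R) (f : E -> R) (w : 'rV[C]_n) Z : measurable_fun setT f -> rapid Z f ->
  im_size w <= Z -> Phi (fun x => c * f x) w = c%:C * Phi f w.
Proof.
move=> mf rf wZ; rewrite /Phi -cintegralZ; last exact: (cintegrable_fker mf rf wZ).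
by apply: eq_cintegral => x; rewrite rmorphM/= mulrA.
Qed.

Lemma derive_gauss c j x :
  'D_(delta_mx ord0 j : E) (expR \o gaussq c) x = - (2 * c) * (x ord0 j * expR (gaussq c x)).
Proof.
have := is_derive_line x (delta_mx ord0 j) 0
  (fun y => smooth_diff y (smooth_expR (slow_gaussq (n := n) c))).
rewrite scale0r addr0 => dl; rewrite -(derive_val (is_derive := dl)).
rewrite (_ : (fun s => _) = fun s : R =>
    expR (gaussq c x - 2 * c * x ord0 j * s - c * s ^+ 2)); last first.
  apply/funext => s /=; congr expR; rewrite /gaussq /sqnorm.
  rewrite (bigD1 j)//= [in RHS](bigD1 j)//= !mxE !eqxx.
  have -> : \sum_(i < n | i != j) (x + s *: delta_mx ord0 j) ord0 i ^+ 2 =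
      \sum_(i < n | i != j) x ord0 i ^+ 2.
    by apply: eq_bigr => i /negPf ij; rewrite !mxE ij andbF mulr0 addr0.
  by rewrite /= mulr1; ring.
have D : is_derive (0 : R) (1 : R) (fun s : R =>
    expR (gaussq c x - 2 * c * x ord0 j * s - c * s ^+ 2))
    (- (2 * c) * (x ord0 j * expR (gaussq c x))).
  have D1 : is_derive (0 : R) (1 : R)
      (fun s : R => gaussq c x - 2 * c * x ord0 j * s - c * s ^+ 2) (- (2 * c * x ord0 j)).
    apply: is_derive_eq; rewrite /GRing.scale/=; ring.
  have := @is_derive1_comp _ expR _ _ _ _ (is_derive_expR _) D1.
  by rewrite mulr0 expr0n/= mulr0 !subr0 (_ : expR _ * _ = - (2 * c) * (x ord0 j * expR (gaussq c x)))//; ring.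
exact: (derive_val (is_derive := D)).
Qed.

(** Integrating factor: e^(l t^2 / 2) v(t) is constant. *)
Lemma gauss_ode (v : R -> R) l : (forall t : R, is_derive t (1 : R) v (- (l * t) * v t)) ->
  v 1 = expR (- (l / 2)) * v 0.
Proof.
move=> dv; pose g t := expR (l / 2 * t ^+ 2) * v t.
have dg t : is_derive t (1 : R) g 0.
  have d1 : is_derive t (1 : R) (fun t : R => l / 2 * t ^+ 2) (l * t).
    by apply: is_derive_eq; rewrite /GRing.scale/=; field.
  have d2 := @is_derive1_comp _ expR _ _ _ _ (is_derive_expR _) d1.
  have := is_deriveM d2 (dv t).
  rewrite (_ : (_ + _) = 0)//= /GRing.scale/=; ring.
have := @is_derive_0_is_cst R g 1 0 dg.
rewrite /g expr1n expr0n/= mulr1 mulr0 expR0 mul1r => <-.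
by rewrite mulrA -expRD addNr expR0 mul1r.
Qed.

(** A derivative of the Gaussian is - 2 c x_j times it; reading [Phi_derive] backwards turns the
    factor x_j into a multiple of w_j, the origin of the differential equation below. *)
Lemma Phi_coord_gauss c (w : 'rV[C]_n) j : 0 < c ->
  Phi (fun x : E => x ord0 j * expR (gaussq c x)) w =
  (kap * w ord0 j / (2 * c)%:C) * Phi (expR \o gaussq c) w.
Proof.
move=> c0; have gs Z := rapid_gaussq (n := n) Z c0.
have := Phi_derive j (gs _) (lexx (im_size w)).
rewrite (_ : ('D__ _) = fun x => - (2 * c) * (x ord0 j * expR (gaussq c x))); last first.
  by apply/funext => x; exact: derive_gauss.
have gj := rapidS_coordM j (gs (im_size w)).
rewrite (@Phi_real_mul _ _ _ (im_size w)) ?rmorphN/=; last 3 first.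
- exact: smooth_measurable gj.1.
- exact: gj.2 [::].
- exact: lexx.
have c20 : (2 * c)%:C != 0 :> C by rewrite eq_complex/= eqxx andbT gt_eqF// mulr_gt0.
rewrite mulNr => /oppr_inj e; apply: (mulfI c20); rewrite e.
by rewrite mulrA mulrCA divff// mulr1.
Qed.

(** Along the ray t w the transform u satisfies u' = - l t u with l = 2 pi^2 |w|^2 / c (Euclidean
    length): the Taylor expansion of [Phi] supplies the derivative and [Phi_coord_gauss] evaluates
    it. The real and imaginary parts are solved separately by [gauss_ode]. *)
Lemma Phi_gauss_ray c w : 0 < c ->
  Phi (expR \o gaussq c) (rV_toC w) =
  (expR (- (pi ^+ 2 / c * sqnorm w)))%:C * Phi (expR \o gaussq c) (0 : 'rV[C]_n).
Proof.
move=> c0; have gs Z := rapid_gaussq (n := n) Z c0.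
pose f : E -> R := expR \o gaussq c.
pose u t := Phi f (rV_toC (t *: w)).
pose S := \sum_j `|w ord0 j|.
have S0 : 0 <= S by apply: sumr_ge0.
pose l := 2 * pi ^+ 2 / c * sqnorm w.
have [B B0 hB] := Phi_rem_bounded (gs (0 + 2 * pi)).
have c20 : (2 * c)%:C != 0 :> C by rewrite eq_complex/= eqxx andbT gt_eqF// mulr_gt0.
(* This radius ensures [size1] of the increment, |s| S, is at most 1, also when S = 0. *)
have rem t s : `|s| <= (1 + S)^-1 ->
    normc (u (s + t) - u t - (- (l * t * s))%:C * u t) <= (B * S ^+ 2) * `|s| ^+ 2.
  move=> sS.
  have sz : size1 (rV_toC (s *: w)) = `|s| * S.
    by rewrite size1_toC mulr_sumr; apply: eq_bigr => j _; rewrite mxE normrM.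
  have sz1 : size1 (rV_toC (s *: w)) <= 1.
    rewrite sz (le_trans (ler_wpM2r S0 sS))// ler_pdivrMl ?mulr1 ?ltr_pwDl// lerDr//.
  have := hB (rV_toC (t *: w)) (rV_toC (s *: w)) _ sz1.
  rewrite im_size_toC => /(_ (lexx 0)).
  rewrite sz (_ : B * _ = (B * S ^+ 2) * `|s| ^+ 2); last by ring.
  rewrite /Phi_rem /Phi_diff -rV_toCD -scalerDl (addrC t s) -/f -/(u (s + t)) -/(u t).
  rewrite (_ : \sum_k _ = (- (l * t * s))%:C * u t)//.
  under eq_bigr => k _ do rewrite Phi_coord_gauss// -/f -/(u t) mulrA.
  rewrite -mulr_suml; congr (_ * _).
  rewrite (_ : - (l * t * s) = \sum_(k < n) - (4 * pi ^+ 2) * ((s * w ord0 k) * (t * w ord0 k) / (2 * c))).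
    rewrite rmorph_sum; apply: eq_bigr => k _.
    by rewrite !mxE kap_kap.
  rewrite (_ : - (l * t * s) = - (2 * pi ^+ 2 / c * t * s) * sqnorm w).
    rewrite /sqnorm mulr_sumr.
    by apply: eq_bigr => k _; field; rewrite gt_eqF.
  by rewrite /l; ring.
have r0 : 0 < (1 + S)^-1 by rewrite invr_gt0 ltr_pwDl.
have BS0 : 0 <= B * S ^+ 2 by rewrite mulr_ge0 ?exprn_ge0.
have dR t : is_derive t (1 : R) (fun t => Rea (u t)) (- (l * t) * Rea (u t)).
  apply: (is_derive_quadratic BS0 r0) => s sr; apply: le_trans (rem t s sr).
  apply: le_trans (normr_Re_le _); rewrite !ReD !ReN Re_realM.
  by have -> : - (l * t) * Rea (u t) * s = - (l * t * s) * Rea (u t) by ring.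
have dI t : is_derive t (1 : R) (fun t => Ima (u t)) (- (l * t) * Ima (u t)).
  apply: (is_derive_quadratic BS0 r0) => s sr; apply: le_trans (rem t s sr).
  apply: le_trans (normr_Im_le _); rewrite !ImD !ImN Im_realM.
  by have -> : - (l * t) * Ima (u t) * s = - (l * t * s) * Ima (u t) by ring.
have u1 : u 1 = Phi f (rV_toC w) by rewrite /u scale1r.
have u0 : u 0 = Phi f 0 by rewrite /u scale0r /rV_toC map_mx0.
rewrite -/f -u1 -u0 (_ : pi ^+ 2 / c * sqnorm w = l / 2); last by rewrite /l; field; rewrite gt_eqF.
by apply: complex_ext; rewrite ?Re_realM ?Im_realM;
  [exact: (gauss_ode dR)|exact: (gauss_ode dI)].
Qed.

(** The ray formula leaves the value at frequency 0, which is the total mass b^-n of the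
    unnormalized Gaussian. *)
Lemma Phi_gauss b w : 0 < b ->
  Phi (expR \o gaussq (pi * b ^+ 2)) (rV_toC w) =
  (b ^- n * expR (gaussq (pi / b ^+ 2) w))%:C.
Proof.
move=> b0; have p0 : 0 < pi :> R := pi_gt0 R.
have c0 : 0 < pi * b ^+ 2 by rewrite mulr_gt0 ?exprn_gt0.
rewrite Phi_gauss_ray// mulrC rmorphM; congr (_ * _).
  have bn : b ^+ n != 0 by rewrite expf_neq0// gt_eqF.
  have := Rintegral_gaussk 0 b0; under eq_Rintegral do rewrite subr0.
  under eq_Rintegral do rewrite gaussk_def.
  rewrite RintegralZl//; last first.
    have := integrable_mulr (b ^- n) (integrable_gaussk 0 b0).
    by under eq_fun => x do rewrite subr0 gaussk_def mulKf//.
  move=> e; rewrite /Phi.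
  transitivity (cintegral (volume n) (fun x : E => (expR (gaussq (pi * b ^+ 2) x))%:C)).
    apply: eq_cintegral => x; rewrite (_ : ker _ _ = 1) ?mulr1//.
    rewrite (_ : 0 = rV_toC 0) ?ker_toC; last by rewrite /rV_toC map_mx0.
    rewrite dotrVC /dotrV big1 ?mulr0 ?oppr0; last by move=> j _; rewrite mxE mul0r.
    by rewrite /expi cos0 sin0.
  by rewrite cintegral_real; congr (_%:C); apply: (mulfI bn); rewrite e divff.
congr (expR _)%:C; rewrite /gaussq; congr (- (_ * _)).
by rewrite expr2 -mulf_div divff ?mul1r// gt_eqF.
Qed.

End gaussian_kernels.

(** * Gaussian averages *)

Section approximate_identity.
Context {R : realType} {n : nat}.
Local Notation E := 'rV[R]_n.
Implicit Types (x a : E) (h D phi : E -> R).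

(** Write k^2 = 1 + (k^2 - 1) in the exponent and use |x| >= d in the second part only. The tails of
    all narrow Gaussians are thus controlled by one wide Gaussian. *)
Lemma gaussk_le k x (d : R) : 1 <= k -> 0 <= d -> d <= `|x| ->
  gaussk k x <= (k ^+ n * expR (- (pi * (k ^+ 2 - 1) * d ^+ 2))) * gaussk 1 x.
Proof.
move=> k1 d0 dx; have k0 : 0 <= k := le_trans ler01 k1.
rewrite !gaussk_def expr1n mul1r -mulrA ler_wpM2l ?exprn_ge0// -expRD ler_expR /gaussq expr1n mulr1.
have ds : d ^+ 2 <= sqnorm x.
  by apply: le_trans (sqnorm_ge x); rewrite lerXn2r ?nnegrE.
have kk : 0 <= pi * (k ^+ 2 - 1).
  by rewrite mulr_ge0 ?pi_ge0// subr_ge0 exprn_ege1.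
have := ler_wpM2l kk ds; lra.
Qed.

Lemma gauss_tail_small (d e : R) : 0 < d -> 0 < e -> exists N : nat, forall k, (N <= k)%N ->
  k.+1%:R ^+ n * expR (- (pi * (k.+1%:R ^+ 2 - 1) * d ^+ 2)) <= e.
Proof.
move=> d0 e0; pose c : R := pi * d ^+ 2.
have c0 : 0 < c by rewrite mulr_gt0 ?pi_gt0 ?exprn_gt0.
have qc (x : R^o) : c - c * x ^+ 2 <= c - c * `|x| ^+ 2 by rewrite real_normK ?num_real.
(* The exponent at parameter k is c - c k^2; the weight exponent n + 1 leaves one power of k beyond
   k^n, which beats [e] once k >= B / e. *)
have [B hB] := rapid_gauss (q := fun x : R^o => c - c * x ^+ 2) c0 qc 0 n.+1.
have B0 : 0 <= B.
  by apply: le_trans (hB 0); rewrite !mulr_ge0 ?expR_ge0 ?exprn_ge0 ?addr_ge0.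
exists (Num.bound (B / e)) => k Nk.
have Be : B / e <= k.+1%:R.
  apply/ltW/(lt_trans (archi_boundP (divr_ge0 B0 (ltW e0)))).
  by rewrite ltr_nat ltnS.
have k0 : 0 < k.+1%:R :> R by rewrite ltr0n.
have := hB k.+1%:R; rewrite mul0r expR0 mul1r /= (ger0_norm (expR_ge0 _)) (ger0_norm (ltW k0)) => hk.
rewrite (_ : - _ = c - c * k.+1%:R ^+ 2); last by rewrite /c; ring.
move: hk; set X := expR _ => hk.
have X0 : 0 <= X := expR_ge0 _.
rewrite -(ler_pM2r k0) (le_trans (_ : _ <= B))//; last first.
  by rewrite mulrC -ler_pdivrMr.
apply: le_trans hk; rewrite mulrAC ler_wpM2r// -exprSr lerXn2r ?nnegrE ?addr_ge0 ?ltW//.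
by rewrite ltrDr.
Qed.

Lemma gaussk_le1 k x : 1 <= k -> gaussk k x <= k ^+ n * gaussk 1 x.
Proof.
move=> k1; apply: le_trans (gaussk_le k1 (lexx 0) (normr_ge0 x)) _.
by rewrite expr0n/= mulr0 oppr0 expR0 mulr1.
Qed.

Lemma gaussk_leX k x : 0 < k -> gaussk k x <= k ^+ n.
Proof.
move=> k0; rewrite gaussk_def ler_piMr ?exprn_ge0 ?(ltW k0)//.
have sq0 : 0 <= sqnorm x by apply: le_trans (sqnorm_ge _); rewrite exprn_ge0.
by rewrite -[leRHS]expR0 ler_expR oppr_le0 mulr_ge0// mulr_ge0 ?pi_ge0 ?exprn_ge0 ?(ltW k0).
Qed.

Lemma integrable_mul_gaussk h a k : measurable_fun setT h -> 1 <= k ->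
  (volume n).-integrable setT (fun x : E => (h x * gaussk 1 (x - a))%:E) ->
  (volume n).-integrable setT (fun x : E => (h x * gaussk k (x - a))%:E).
Proof.
move=> mh k1 i1; have k0 : 0 <= k := le_trans ler01 k1.
apply: (integrable_dom _ (integrable_mulr (k ^+ n) (integrable_norm i1))) => [|x].
  by apply: measurable_funM => //; exact: measurable_gaussk_shift.
rewrite /= !normrM [leRHS]mulrCA (ger0_norm (gaussk_ge0 _ k0)) (ger0_norm (gaussk_ge0 _ ler01)) ler_wpM2l//.
exact: gaussk_le1.
Qed.

(** [h] may be unbounded. Continuity handles the ball of radius d; outside it [gaussk_le] replaces
    the narrow Gaussian by a small multiple [eta] of the wide one, against which [h] is integrable
    by hypothesis. *)
Lemma gauss_approx h a : measurable_fun setT h -> {for a, continuous h} ->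
  (volume n).-integrable setT (fun x : E => (h x * gaussk 1 (x - a))%:E) ->
  (fun k : nat => \int[volume n]_x (h x * gaussk k.+1%:R (x - a))) @ \oo --> h a.
Proof.
move=> mh ch i1; apply/cvgrPdist_le => e e0.
have e20 : 0 < e / 2 by rewrite divr_gt0.
have [d d0 hd] : exists2 d : R, 0 < d & forall x, `|x - a| < d -> `|h x - h a| <= e / 2.
  move/cvgrPdist_le: ch => /(_ _ e20) /nbhs_normP[d d0 hd]; exists d => // x xd.
  by rewrite distrC; apply: hd; rewrite /= distrC.
pose I := \int[volume n]_x (`|h x| * gaussk 1 (x - a)).
have i1' : (volume n).-integrable setT (fun x : E => (`|h x| * gaussk 1 (x - a))%:E).
  apply: (integrable_dom _ (integrable_norm i1)) => [|x].
    by apply: measurable_funM; [exact: measurableT_comp|exact: measurable_gaussk_shift].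
  by rewrite /= !normrM normr_id.
have I0 : 0 <= I by apply: Rintegral_ge0 => x _; rewrite mulr_ge0 ?gaussk_ge0.
(* The part of the error from outside the ball is at most eta (I + |h a|); the 1 makes the divisor
   positive. *)
pose J := I + `|h a| + 1.
have J0 : 0 < J by rewrite ltr_wpDl ?addr_ge0.
have [N hN] := gauss_tail_small d0 (divr_gt0 e20 J0).
exists N => // k /= /hN; set eta := _ * expR _ => etaJ.
have k1 : 1 <= k.+1%:R :> R by rewrite ler1n.
have k0 : 0 < k.+1%:R :> R by rewrite ltr0n.
have eta0 : 0 <= eta by rewrite mulr_ge0 ?exprn_ge0 ?expR_ge0.
have ik := integrable_mul_gaussk mh k1 i1.
have ig := integrable_gaussk a k0; have ig1 := integrable_gaussk a (@ltr01 R).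
pose b x := e / 2 * gaussk k.+1%:R (x - a) + eta * (`|h x| * gaussk 1 (x - a) + `|h a| * gaussk 1 (x - a)).
have ib : (volume n).-integrable setT (fun x : E => (b x)%:E).
  apply: integrable_addr; first exact: integrable_mulr.
  by apply: integrable_mulr; apply: integrable_addr => //; exact: integrable_mulr.
have bnd x : `|h a * gaussk k.+1%:R (x - a) - h x * gaussk k.+1%:R (x - a)| <= b x.
  rewrite -mulrBl normrM (ger0_norm (gaussk_ge0 _ (ltW k0))) distrC /b -mulrDl.
  have g0 := gaussk_ge0 (x - a) (ltW k0); have g1 := gaussk_ge0 (x - a) (@ler01 R).
  have [xd|xd] := ltP `|x - a| d.
    apply: (@le_trans _ _ (e / 2 * gaussk k.+1%:R (x - a))); first by rewrite ler_wpM2r// hd.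
    by rewrite lerDl !mulr_ge0 ?addr_ge0.
  apply: (@le_trans _ _ (eta * ((`|h x| + `|h a|) * gaussk 1 (x - a)))).
    have hh : `|h x - h a| <= `|h x| + `|h a| by exact: ler_normB.
    rewrite [leRHS]mulrCA; apply: (ler_pM (normr_ge0 _) g0 hh).
    exact: (gaussk_le k1 (ltW d0) xd).
  by rewrite lerDr mulr_ge0 // ltW.
have iha : (volume n).-integrable setT (fun x : E => (h a * gaussk k.+1%:R (x - a))%:E).
  exact: integrable_mulr.
have -> : h a - \int[volume n]_x (h x * gaussk k.+1%:R (x - a)) =
    \int[volume n]_x (h a * gaussk k.+1%:R (x - a) - h x * gaussk k.+1%:R (x - a)).
  by rewrite RintegralB// RintegralZl// Rintegral_gaussk// mulr1.
apply: le_trans (le_normr_Rintegral _ _) _ => //; first exact: integrable_subr.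
apply: (@le_trans _ _ (\int[volume n]_x b x)).
  by apply: le_Rintegral => //; apply: integrable_norm; exact: integrable_subr.
have iha1 : (volume n).-integrable setT (fun x : E => (`|h a| * gaussk 1 (x - a))%:E).
  exact: integrable_mulr.
rewrite /b RintegralD//; last 2 first.
- exact: integrable_mulr.
- by apply: integrable_mulr; exact: integrable_addr.
rewrite !RintegralZl//; last exact: integrable_addr.
rewrite RintegralD// RintegralZl// !Rintegral_gaussk// !mulr1 -/I.
rewrite [leRHS](splitr e) lerD2l.
apply: (@le_trans _ _ (eta * J)); first by rewrite ler_wpM2l// lerDl.
by rewrite -ler_pdivlMr.
Qed.

Lemma measurable_subrV2 : measurable_fun setT (fun z : E * E => z.2 - z.1).
Proof.
apply: measurable_fun_rV => i.
rewrite (_ : (fun _ => _) = fun z : E * E => z.2 ord0 i - z.1 ord0 i); last first.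
  by apply/funext => z; rewrite !mxE.
by apply: measurable_funB; apply: (measurableT_comp (measurable_coord i));
  [exact: measurable_snd|exact: measurable_fst].
Qed.

(** Tonelli, with the mass-one Gaussian integrated over its centre. Both sides may be infinite, so
    the mass of a function can be compared before its integrability is known. *)
Lemma gauss_mass h : measurable_fun setT h -> (forall x, 0 <= h x) ->
  (\int[volume n]_a \int[volume n]_x (h x * gaussk 1 (x - a))%:E = \int[volume n]_x (h x)%:E)%E.
Proof.
move=> mh h0.
rewrite (@fubini_tonelli _ _ _ _ _ (volume n) (volume n)
  (fun z : E * E => (h z.2 * gaussk 1 (z.2 - z.1))%:E)).
- apply: eq_integral => x _ /=.
  under eq_integral do rewrite -gausskN opprB EFinM.
  have mg : measurable_fun setT (fun a : E => (gaussk 1 (a - x))%:E).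
    by apply/measurable_EFinP; exact: measurable_gaussk_shift.
  rewrite (ge0_integralZl _ measurableT mg) ?lee_fin//.
    by rewrite integral_gaussk// mule1.
  by move=> y _; rewrite lee_fin gaussk_ge0.
- apply/measurable_EFinP; apply: measurable_funM.
    exact: (measurableT_comp mh measurable_snd).
  apply: (measurableT_comp (measurable_gaussk 1)).
  exact: measurable_subrV2.
- by case=> x a; rewrite lee_fin mulr_ge0 ?gaussk_ge0.
Qed.

(** [P k], the Gaussian averages of [phi], converge to [phi] pointwise and are bounded by [B]. By
    Fubini and the symmetry of the Gaussian, D integrates to 0 against each of them; dominated
    convergence gives the limit. *)
Lemma integral_gauss_null D phi B : (volume n).-integrable setT (EFin \o D) ->
  continuous phi -> (forall x, `|phi x| <= B) ->
  (forall k a, 0 < k -> \int[volume n]_x (D x * gaussk k (x - a)) = 0) ->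
  \int[volume n]_x (D x * phi x) = 0.
Proof.
move=> iD cphi phiB D0.
have B0 : 0 <= B := le_trans (normr_ge0 _) (phiB 0).
have mD : measurable_fun setT D by apply/measurable_EFinP; exact: measurable_int iD.
have mphi := continuous_measurable_rV cphi.
have igk k (x : E) : 0 < k ->
    (volume n).-integrable setT (fun a : E => (phi a * gaussk k (a - x))%:E).
  move=> k0; apply: (integrable_dom _ (integrable_mulr B (integrable_gaussk x k0))) => [|a].
    by apply: measurable_funM => //; exact: measurable_gaussk_shift.
  by rewrite normrM (ger0_norm (gaussk_ge0 _ (ltW k0))) ler_wpM2r// gaussk_ge0// ltW.
pose P (k : nat) (x : E) := \int[volume n]_a (phi a * gaussk k.+1%:R (a - x)).
have k0 (k : nat) : 0 < k.+1%:R :> R by rewrite ltr0n.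
have PB k x : `|P k x| <= B.
  apply: le_trans (le_normr_Rintegral _ (igk _ x (k0 k))) _ => //.
  apply: (@le_trans _ _ (\int[volume n]_a (B * gaussk k.+1%:R (a - x)))); last first.
    by rewrite RintegralZl ?Rintegral_gaussk ?mulr1//; exact: integrable_gaussk.
  apply: le_Rintegral => //.
  - by apply: integrable_norm; exact: (igk _ x (k0 k)).
  - by apply: integrable_mulr; exact: integrable_gaussk.
  by move=> a _; rewrite /= normrM (ger0_norm (gaussk_ge0 _ (ltW (k0 k)))) ler_wpM2r// gaussk_ge0// ltW.
have mker (k : R) : measurable_fun setT (fun z : E * E => phi z.2 * gaussk k (z.2 - z.1)).
  apply: measurable_funM; first exact: (measurableT_comp mphi measurable_snd).
  by apply: (measurableT_comp (measurable_gaussk k)); exact: measurable_subrV2.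
have mP k : measurable_fun setT (P k).
  exact: (@measurable_Rintegral_param _ _ _ _ _ (volume n) _ (mker k.+1%:R)).
have iDg k a : 0 < k -> (volume n).-integrable setT (fun x : E => (D x * gaussk k (x - a))%:E).
  move=> kk; apply: (integrable_dom _ (integrable_mulr (k ^+ n) (integrable_norm iD))) => [|x].
    by apply: measurable_funM => //; exact: measurable_gaussk_shift.
  by rewrite /= normrM mulrC (ger0_norm (gaussk_ge0 _ (ltW kk))) ler_wpM2r// gaussk_leX.
have DP0 k : \int[volume n]_x (D x * P k x) = 0.
  transitivity (\int[volume n]_x \int[volume n]_a (D x * (phi a * gaussk k.+1%:R (a - x)))).
    by apply: eq_Rintegral => x _; rewrite RintegralZl//; exact: igk.
  rewrite (@Rintegral_fubini _ _ _ _ _ (volume n) (volume n)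
    (fun z : E * E => D z.1 * (phi z.2 * gaussk k.+1%:R (z.2 - z.1)))).
  - under eq_Rintegral => a _.
      rewrite (_ : (fun x => _) = fun x : E => phi a * (D x * gaussk k.+1%:R (x - a))); last first.
        by apply/funext => x /=; rewrite -(gausskN _ (a - x)) opprB; ring.
      rewrite RintegralZl//; last exact: iDg.
      rewrite D0// mulr0; over.
    by rewrite Rintegral_cst// mul0r.
  - by apply: measurable_funM => //; exact: (measurableT_comp mD measurable_fst).
  apply: (@iterated_integral_lty_dom _ _ _ _ _ (volume n) (volume n)
    (fun z : E * E => D z.1 * (phi z.2 * gaussk k.+1%:R (z.2 - z.1)))
    (fun z : E * E => `|D z.1| * (B * gaussk k.+1%:R (z.2 - z.1)))).
  - by apply: measurable_funM => //; exact: (measurableT_comp mD measurable_fst).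
  - apply: measurable_funM.
      by apply: measurableT_comp => //; exact: (measurableT_comp mD measurable_fst).
    by apply: measurable_funM => //; apply: (measurableT_comp (measurable_gaussk _)); exact: measurable_subrV2.
  - case=> x a; rewrite !normrM (ger0_norm (gaussk_ge0 _ (ltW (k0 k)))) ler_wpM2l//.
    by rewrite ler_wpM2r// gaussk_ge0// ltW.
  rewrite (_ : (\int[_]_x _)%E = (\int[volume n]_x (B * `|D x|)%:E)%E).
    apply: (lebesgue_integrable.integrable_lty measurableT).
    by apply: integrable_mulr; exact: (integrable_norm iD).
  apply: eq_integral => x _.
  have mg : measurable_fun setT (fun a : E => (gaussk k.+1%:R (a - x))%:E).
    by apply/measurable_EFinP; exact: measurable_gaussk_shift.
  transitivity (\int[volume n]_a ((`|D x| * B)%:E * (gaussk k.+1%:R (a - x))%:E))%E.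
    by apply: eq_integral => a _; rewrite -EFinM mulrA.
  rewrite (ge0_integralZl _ measurableT mg) ?lee_fin ?mulr_ge0//.
    by rewrite integral_gaussk// mule1 mulrC.
  by move=> y _; rewrite lee_fin gaussk_ge0// ltW.
have := @dominated_cvg_Rintegral _ _ _ (volume n) (fun k x => D x * P k x)
  (fun x => D x * phi x) (fun x => B * `|D x|).
rewrite (_ : (fun k : nat => \int[volume n]_x _) = cst 0); last exact/funext/DP0.
move=> dc; suff H : (cst 0 : nat -> R) @ \oo --> \int[volume n]_x (D x * phi x).
  by rewrite -(cvg_lim (@norm_hausdorff _ _) H); exact: (cvg_lim (@norm_hausdorff _ _) (cvg_cst _)).
apply: dc.
- by move=> k; exact: measurable_funM.
- exact: measurable_funM.
- move=> x; apply: cvgMr; apply: gauss_approx => //.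
  + exact: cphi.
  + exact: igk.
- by apply: integrable_mulr; exact: integrable_norm.
- by move=> k x; rewrite normrM mulrC ler_wpM2r.
Qed.

End approximate_identity.

(** * The extremal function *)

Section holomorphic_extension.
Context {R : realType} {n : nat}.
Local Notation E := 'rV[R]_n.
Local Notation C := R[i].
Local Notation vol := (volume n : {measure set E -> \bar R}).
Implicit Types (T f chi : E -> R) (x y : E) (z v w h : 'rV[C]_n).

(** The form of temperedness used for domination: absolute integrability against nonnegative
    Schwartz weights, satisfied both by [calG] and by integrable functions. *)
Definition tempered_int T := measurable_fun setT T /\
  forall Psi : E -> R, pderivs_in (rapid 0) Psi -> (forall x, 0 <= Psi x) ->
    vol.-integrable setT (fun x => (T x * Psi x)%:E).

Lemma tempered_majorant T (B : nat -> R) : tempered_int T ->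
  exists Psi : E -> R, [/\ forall x, 0 <= Psi x,
    vol.-integrable setT (fun x => (`|T x| * Psi x)%:E) &
    forall x (a : R), (forall N, (1 + `|x|) ^+ N * a <= B N) -> a <= Psi x].
Proof.
move=> [mT iT]; have [Psi [sP P0 hP]] := schwartz_majorant (n := n) B.
exists Psi; split=> //; apply: (integrable_dom _ (integrable_norm (iT _ sP P0))) => [|x].
  apply: measurable_funM; first exact: measurableT_comp.
  exact: smooth_measurable sP.1.
by rewrite /= !normrM normr_id.
Qed.

Lemma cintegrable_tempered T (f : E -> C) : tempered_int T -> cmeasurable f -> crapid f ->
  cintegrable vol (fun x => (T x)%:C * f x).
Proof.
move=> tT mf /choice[B hB]; have [Psi [P0 iP hP]] := tempered_majorant B tT.
apply: (cintegrable_dom _ iP) => [|x].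
  by apply: cmeasurableM => //; apply: cmeasurable_real; exact: tT.1.
by rewrite Normc.normcM normc_real ler_wpM2l// hP.
Qed.

Lemma cmeasurable_Phi_shift f v : measurable_fun setT f ->
  cmeasurable (fun y : E => Phi f (rV_toC y + v)).
Proof.
move=> mf; apply: (@cmeasurable_cintegral_param _ _ _ _ _ (volume n)
  (fun p : E * E => (f p.2)%:C * ker (rV_toC p.1 + v) p.2)).
apply: cmeasurableM.
  by apply: cmeasurable_real; exact: (measurableT_comp mf measurable_snd).
rewrite (_ : (fun _ => _) = fun p : E * E =>
    expi (- (2 * pi * dotrV p.2 p.1)) * ker v p.2); last first.
  by apply/funext => p; rewrite kerD ker_toC.
apply: cmeasurableM; first exact: (cmeasurable_fourier_kernel measurable_snd measurable_fst).
exact: (cmeasurable_comp measurable_snd (cmeasurable_ker v)).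
Qed.

Lemma Re_rV_shift y v : Re_rV (rV_toC y + v) = y + Re_rV v.
Proof. by apply/rowP => j; rewrite !mxE ReD. Qed.

Lemma im_size_shift y v : im_size (rV_toC y + v) = im_size v.
Proof.
by rewrite /im_size; congr (_ * _); apply: eq_bigr => j _; rewrite !mxE ImD add0r.
Qed.

Lemma weight_shift y (u : E) N (a b : R) : 0 <= a -> (1 + `|y + u|) ^+ N * a <= b ->
  (1 + `|y|) ^+ N * a <= (1 + `|u|) ^+ N * b.
Proof.
move=> a0 ab; apply: (@le_trans _ _ (((1 + `|u|) * (1 + `|y + u|)) ^+ N * a)).
  rewrite ler_wpM2r// lerXn2r ?nnegrE ?mulr_ge0 ?addr_ge0//.
  by have := weight_le_sub y (- u); rewrite opprK normrN.
by rewrite exprMn -mulrA ler_wpM2l// weightX_ge0.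
Qed.

Lemma crapid_Phi_shift f v : (forall Z, pderivs_in (rapid Z) f) ->
  crapid (fun y : E => Phi f (rV_toC y + v)).
Proof.
move=> rf N; have [B B0 hB] := Phi_decay N (rf (im_size v)).
exists ((1 + `|Re_rV v|) ^+ N * B) => y; apply: weight_shift; first exact: normc_ge0.
have := hB (rV_toC y + v); rewrite im_size_shift Re_rV_shift; exact.
Qed.

Lemma cintegrableB (f g : E -> C) : cintegrable vol f -> cintegrable vol g ->
  cintegrable vol (fun x => f x - g x).
Proof.
move=> fi gi; rewrite (_ : (fun _ => _) = fun x => f x + (-1) * g x); last first.
  by apply/funext => x; rewrite mulN1r.
by apply: cintegrableD => //; exact: cintegrableZ.
Qed.

Lemma cintegral_sum_lin (I : Type) (s : seq I) (c : I -> C) (F : I -> E -> C) :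
  (forall i, cintegrable vol (F i)) ->
  cintegrable vol (fun t => \sum_(i <- s) c i * F i t) /\
  cintegral vol (fun t => \sum_(i <- s) c i * F i t) = \sum_(i <- s) c i * cintegral vol (F i).
Proof.
move=> Fi; elim: s => [|i s [si sE]].
  have -> : (fun t => \sum_(i <- [::]) c i * F i t) = fun=> 0%:C.
    by apply/funext => t; rewrite big_nil.
  rewrite big_nil cintegral_real Rintegral_cst// mul0r; split=> //.
  by apply: cintegrable_real; exact: integrable0.
have -> : (fun t => \sum_(i0 <- i :: s) c i0 * F i0 t) =
    fun t => c i * F i t + \sum_(i0 <- s) c i0 * F i0 t.
  by apply/funext => t; rewrite big_cons.
have ci := cintegrableZ (c i) (Fi i).
by rewrite cintegralD// cintegralZ// sE big_cons; split=> //; exact: cintegrableD.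
Qed.

Lemma size1_le h : (size1 h)%:C <= n%:R * `|h|.
Proof.
rewrite /size1 rmorph_sum/= -[X in X%:R]card_ord mulr_natl -sumr_const.
by apply: ler_sum => j _; rewrite -normc_norm norm_coord_le.
Qed.

Definition hol_ext T chi z : C :=
  cintegral vol (fun y => (T y)%:C * Phi chi (rV_toC y - z)).

Lemma hol_ext_integrable T chi z : tempered_int T -> (forall Z, pderivs_in (rapid Z) chi) ->
  cintegrable vol (fun y => (T y)%:C * Phi chi (rV_toC y - z)).
Proof.
move=> tT rchi; apply: cintegrable_tempered => //.
  exact: cmeasurable_Phi_shift (smooth_measurable (rchi 0).1).
exact: crapid_Phi_shift.
Qed.

(** [ck] is the result of differentiating [Phi chi (y - z)] in z under the integral. The remainder
    is at most [size1 h ^+ 2] times a T-integrable function, and [size1 h <= n |h|] turns this into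
    a quadratic bound with the factor n^2. *)
Lemma entire_hol_ext T chi : tempered_int T -> (forall Z, pderivs_in (rapid Z) chi) ->
  entire (hol_ext T chi).
Proof.
move=> tT rchi z.
have rck k Z : pderivs_in (rapid Z) (fun x => x ord0 k * chi x) by exact: rapidS_coordM.
pose ck k := - kap * hol_ext T (fun x => x ord0 k * chi x) z.
pose Z := im_size (- z).
have /choice[B0 hB0] N : exists B, 0 <= B /\ forall w h, im_size w <= Z -> size1 h <= 1 ->
    (1 + `|Re_rV w|) ^+ N * normc (Phi_rem chi w h) <= B * size1 h ^+ 2.
  by have [B b0 hB] := Phi_rem_decay N (rchi (Z + 2 * pi)); exists B.
pose r := Re_rV (- z).
(* The decay estimates carry weights at the real part of y - z; the powers of 1 + |r| move them to
   y. *)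
have [Psi [P0 iP hP]] := tempered_majorant (fun N => (1 + `|r|) ^+ N * B0 N) tT.
pose I := \int[volume n]_y (`|T y| * Psi y).
have I0 : 0 <= I by apply: Rintegral_ge0 => y _; rewrite mulr_ge0.
pose w y := rV_toC y - z.
have rem y h : size1 h <= 1 -> normc (Phi_rem chi (w y) h) <= size1 h ^+ 2 * Psi y.
  move=> h1; have wZ : im_size (w y) <= Z by rewrite im_size_shift.
  (* [Psi] is to dominate the remainder divided by [size1 h ^+ 2]; if the divisor is 0, the estimate
     for N = 0 already makes the remainder vanish. *)
  have [s0|s0] := eqVneq (size1 h) 0.
    have := (hB0 0%N).2 _ _ wZ h1; rewrite s0 expr0n/= mulr0 expr0 mul1r => /le_trans.
    by apply; rewrite mul0r.
  have s2 : 0 < size1 h ^+ 2 by rewrite exprn_even_gt0.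
  rewrite -ler_pdivrMl//; apply: hP => N; apply: weight_shift.
    by rewrite mulr_ge0 ?invr_ge0 ?(ltW s2)// normc_ge0.
  rewrite mulrCA ler_pdivrMl// mulrC [leRHS]mulrC.
  have := (hB0 N).2 _ _ wZ h1; rewrite Re_rV_shift -/r mulrC; exact.
apply: (@differentiable_quadratic _ _ _ (hol_ext T chi : 'rV[C]_n -> C^o) z (lform ck)
  (2 * I * n%:R ^+ 2)%:C (n.+1%:R^-1) _ _ _ _).1.
- by rewrite lecR !mulr_ge0 ?exprn_ge0.
- by rewrite invr_gt0 ltr0n.
- exact: continuous_lform.
move=> h hr.
(* The radius 1/(n+1) gives size1 h <= n/(n+1), and it is defined even for n = 0. *)
have s1 : size1 h <= 1.
  rewrite -lecR (le_trans (size1_le h))// (le_trans (ler_wpM2l _ hr)) ?ler0n//.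
  by rewrite ler_pdivrMr ?ltr0n// mul1r ler_nat.
have hn : size1 (- h) = size1 h by apply: eq_bigr => j _; rewrite mxE normcN.
have iw f : (forall Z, pderivs_in (rapid Z) f) ->
    cintegrable vol (fun y => (T y)%:C * Phi f (w y)) by exact: hol_ext_integrable.
have [si sE] := cintegral_sum_lin (index_enum 'I_n) (fun k => - (kap * h ord0 k))
  (fun k => iw _ (rck k)).
have iwh : cintegrable vol (fun y => (T y)%:C * Phi chi (rV_toC y - (h + z))).
  exact: hol_ext_integrable.
have iz := iw chi rchi.
pose S y := \sum_k - (kap * h ord0 k) * ((T y)%:C * Phi (fun x => x ord0 k * chi x) (w y)).
have pt y : (T y)%:C * Phi_rem chi (w y) (- h) =
    (T y)%:C * Phi chi (rV_toC y - (h + z)) - (T y)%:C * Phi chi (w y) - S y.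
  have -> : rV_toC y - (h + z) = w y + - h by rewrite /w opprD addrA addrAC.
  have -> : S y = (T y)%:C * \sum_k kap * (- h) ord0 k * Phi (fun x => x ord0 k * chi x) (w y).
    by rewrite mulr_sumr; apply: eq_bigr => k _; rewrite mxE; ring.
  rewrite /Phi_rem /Phi_diff; move: (\sum_k _) (Phi chi _) (Phi chi _) => s1' p1 p2.
  by rewrite mulrBr mulrBr.
have ir : cintegrable vol (fun y => (T y)%:C * Phi_rem chi (w y) (- h)).
  by rewrite (funext pt); apply: cintegrableB si; exact: cintegrableB iwh iz.
have E1 : hol_ext T chi (h + z) - hol_ext T chi z - lform ck h =
    cintegral vol (fun y => (T y)%:C * Phi_rem chi (w y) (- h)).
  rewrite (eq_cintegral vol pt) (cintegralB (cintegrableB iwh iz) si) (cintegralB iwh iz) sE.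
  congr (_ - _); apply: eq_bigr => k _.
  by rewrite /ck /hol_ext -/w; ring.
have nb : normc (hol_ext T chi (h + z) - hol_ext T chi z - lform ck h) <=
    2 * (size1 h ^+ 2 * I).
  rewrite E1; apply: le_trans (normc_cintegral_le ir (integrable_mulr (size1 h ^+ 2) iP) _) _.
    by move=> y; rewrite Normc.normcM normc_real mulrCA ler_wpM2l// -hn; apply: rem; rewrite hn.
  by rewrite RintegralZl.
have -> : `|hol_ext T chi (h + z) - hol_ext T chi z - lform ck h : C^o| =
    (normc (hol_ext T chi (h + z) - hol_ext T chi z - lform ck h))%:C :> C.
  exact: normc_norm.
apply: (@le_trans _ _ (2 * (size1 h ^+ 2 * I))%:C); first by rewrite lecR.
rewrite (_ : (2 * (size1 h ^+ 2 * I))%:C = (2 * I)%:C * (size1 h)%:C ^+ 2); last first.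
  by rewrite -rmorphXn/= -rmorphM/=; congr (_%:C); ring.
rewrite (_ : (2 * I * n%:R ^+ 2)%:C * `|h| ^+ 2 = (2 * I)%:C * (n%:R * `|h|) ^+ 2); last first.
  rewrite exprMn [RHS]mulrA; congr (_ * _).
  rewrite (_ : n%:R = (n%:R : R)%:C :> C); last by rewrite (rmorph_nat (real_complex R)).
  by rewrite !expr2; apply: complex_ext; rewrite ?ReM ?ImM /=; ring.
rewrite ler_wpM2l ?lecR ?mulr_ge0//.
by rewrite lerXn2r ?nnegrE ?size1_le// ?mulr_ge0 ?lecR ?size1_ge0 ?ler0n.
Qed.

End holomorphic_extension.

(** * Pairing the entire extension with Gaussians *)

Section gaussian_test.
Context {R : realType} {n : nat}.
Local Notation E := 'rV[R]_n.
Local Notation C := R[i].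
Local Notation vol := (volume n : {measure set E -> \bar R}).
Implicit Types (T f chi : E -> R) (x y a xi : E) (k : R).

Lemma expiD (s t : R) : expi (s + t) = expi s * expi t.
Proof.
by apply: complex_ext; rewrite ?ReM ?ImM /= ?cosD ?sinD// addrC [X in X + _]mulrC [X in _ + X]mulrC.
Qed.

(** The inverse transform of the Gaussian [gaussk k] centred at [a]: the centre becomes a modulation
    and the width is inverted. *)
Definition modulated_gauss k a xi : C :=
  expi (2 * pi * dotrV a xi) * (expR (gaussq (pi / k ^+ 2) xi))%:C.

Lemma dotrVBr x y z : dotrV x (y - z) = dotrV x y - dotrV x z :> R.
Proof. by rewrite /dotrV -sumrB; apply: eq_bigr => j _; rewrite !mxE mulrBr. Qed.

Lemma dotrVNr x y : dotrV x (- y) = - dotrV x y :> R.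
Proof. by rewrite /dotrV -sumrN; apply: eq_bigr => j _; rewrite !mxE mulrN. Qed.

Lemma fourier_modulated_gauss k a x : 0 < k ->
  fourier (modulated_gauss k a) x = (gaussk k (x - a))%:C.
Proof.
move=> k0; have kV : 0 < k^-1 by rewrite invr_gt0.
transitivity (fourier (fun xi => (expR (gaussq (pi / k ^+ 2) xi))%:C) (x - a)).
  apply: eq_cintegral => xi; rewrite /modulated_gauss mulrA -expiD; congr (expi _ * _).
  by rewrite dotrVBr (dotrVC a); ring.
by rewrite fourier_real -exprVn (Phi_gauss _ kV) gaussk_def -!exprVn invrK.
Qed.

Lemma cintegral_shift (f : E -> C) a : cmeasurable f ->
  cintegral vol (fun x => f (x + a)) = cintegral vol f.
Proof.
move=> [mr mi]; congr Complex.
  exact: (@integral_volume_shift _ _ (fun x => Rea (f x))).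
exact: (@integral_volume_shift _ _ (fun x => Ima (f x))).
Qed.

Lemma cintegral_gaussk_expi k a xi : 0 < k ->
  cintegral vol (fun x => (gaussk k (x - a))%:C * expi (2 * pi * dotrV x xi)) =
  modulated_gauss k a xi.
Proof.
move=> k0; have kk : 0 < pi * k ^+ 2 by rewrite mulr_gt0 ?pi_gt0 ?exprn_gt0.
have mf : cmeasurable (fun x : E => (gaussk k (x - a))%:C * expi (2 * pi * dotrV x xi)).
  apply: cmeasurableM; first by apply: cmeasurable_real; exact: measurable_gaussk_shift.
  apply: cmeasurable_expi; apply: measurable_funM => //.
  by apply: (@measurable_dotrV2 _ _ _ _ id (fun=> xi)).
have rg := rapid_gaussq (n := n) 0 kk.
rewrite -(cintegral_shift a mf).
transitivity (cintegral vol (fun x => expi (2 * pi * dotrV a xi) *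
    ((gaussk k x)%:C * ker (rV_toC (- xi)) x))).
  apply: eq_cintegral => x; rewrite addrK ker_toC mulrCA -expiD; congr (_ * expi _).
  by rewrite dotrVDl dotrVNr; ring.
have ig : cintegrable vol (fun x => (gaussk k x)%:C * ker (rV_toC (- xi)) x).
  have := cintegrable_fker (smooth_measurable rg.1) (rg.2 [::]) (_ : im_size (rV_toC (- xi)) <= 0).
  rewrite im_size_toC => /(_ (lexx 0)) /(cintegrableZ ((k ^+ n)%:C)).
  by under eq_fun do rewrite mulrA -rmorphM -gaussk_def.
rewrite cintegralZ// /modulated_gauss; congr (_ * _).
rewrite -/(Phi (gaussk k) _) gaussk_defE (@Phi_real_mul _ _ _ _ _ 0); last 3 first.
- exact: smooth_measurable rg.1.
- exact: rg.2 [::].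
- by rewrite im_size_toC.
rewrite -[fun x => expR _]/(expR \o gaussq _) Phi_gauss// -rmorphM mulrA divff ?mul1r.
  by rewrite /gaussq sqnormN.
by rewrite expf_neq0// gt_eqF.
Qed.

Lemma rapid_gaussk_shift k a : 0 < k -> rapid 0 (fun x : E => gaussk k (x - a)).
Proof.
move=> k0 N; have kk : 0 < pi * k ^+ 2 by rewrite mulr_gt0 ?pi_gt0 ?exprn_gt0.
have [B hB] := (rapid_gaussq (n := n) 0 kk).2 [::] N.
exists ((1 + `|a|) ^+ N * (k ^+ n * B)) => x; rewrite mul0r expR0 mul1r.
rewrite (ger0_norm (gaussk_ge0 _ (ltW k0))); rewrite -(normrN a); apply: weight_shift.
  exact: gaussk_ge0 (ltW k0).
rewrite gaussk_def mulrCA ler_wpM2l ?exprn_ge0 ?(ltW k0)//.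
by have := hB (x - a); rewrite mul0r expR0 mul1r /= ger0_norm// expR_ge0.
Qed.

Lemma schwartz_modulated_gauss k a (p : E -> R) : 0 < k -> slow p ->
  schwartz (fun xi => (p xi)%:C * modulated_gauss k a xi).
Proof.
move=> k0 sp; have kk : 0 < pi / k ^+ 2 by rewrite divr_gt0 ?pi_gt0 ?exprn_gt0.
have dE xi : 2 * pi * dotrV a xi = lform (fun j => 2 * pi * a ord0 j) xi.
  by rewrite /dotrV mulr_sumr; apply: eq_bigr => j _; rewrite mulrA.
apply/schwartzP; split.
  rewrite (_ : (fun _ => _) = (p \* (fun xi => cos (lform (fun j => 2 * pi * a ord0 j) xi))) \*
      (expR \o gaussq (pi / k ^+ 2))).
    by apply: slow_rapid; [apply: slowM => //; exact: slow_cos|exact: rapid_gaussq].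
  by apply/funext => xi; rewrite /modulated_gauss dE Re_realM ReM /=; ring.
rewrite (_ : (fun _ => _) = (p \* (fun xi => sin (lform (fun j => 2 * pi * a ord0 j) xi))) \*
    (expR \o gaussq (pi / k ^+ 2))).
  by apply: slow_rapid; [apply: slowM => //; exact: slow_sin|exact: rapid_gaussq].
by apply/funext => xi; rewrite /modulated_gauss dE Im_realM ImM /=; ring.
Qed.

(** Averaging the transform of chi over a Gaussian multiplies chi by the inverse transform of that
    Gaussian; Fubini applies since both the Gaussian and chi are integrable. *)
Lemma cintegral_gaussk_Phi k a chi y : 0 < k -> pderivs_in (rapid 0) chi ->
  cintegral vol (fun x => (gaussk k (x - a))%:C * Phi chi (rV_toC y - rV_toC x)) =
  fourier (fun xi => (chi xi)%:C * modulated_gauss k a xi) y.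
Proof.
move=> k0 rchi; have mchi := smooth_measurable rchi.1.
have ichi := rapid_integrable (lexx 0) mchi (rchi.2 [::]).
have igk := integrable_gaussk a k0.
have kE x xi : ker (rV_toC y - rV_toC x) xi =
    expi (- (2 * pi * dotrV xi y)) * expi (2 * pi * dotrV x xi).
  rewrite (_ : rV_toC y - rV_toC x = rV_toC (y - x)); last by rewrite /rV_toC map_mxB.
  by rewrite ker_toC dotrVBr -expiD (dotrVC x); congr expi; ring.
have mex xi : cmeasurable (fun x : E => expi (2 * pi * dotrV x xi)).
  apply: cmeasurable_expi; apply: measurable_funM => //.
  exact: (@measurable_dotrV2 _ _ _ _ id (fun=> xi)).
transitivity (cintegral vol (fun x => cintegral vol (fun xi =>
    (gaussk k (x - a))%:C * ((chi xi)%:C * ker (rV_toC y - rV_toC x) xi)))).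
  apply: eq_cintegral => x; rewrite cintegralZ//.
  by apply: (cintegrable_fker mchi (rchi.2 [::])); rewrite -map_mxB im_size_toC.
rewrite (@cintegral_fubini_dom _ _ _ _ _ (volume n) (volume n)
  (fun z : E * E => (gaussk k (z.1 - a))%:C * ((chi z.2)%:C * ker (rV_toC y - rV_toC z.1) z.2))
  (fun x => gaussk k (x - a)) (fun xi => `|chi xi|)).
- apply: eq_cintegral => xi.
  transitivity (cintegral vol (fun x => ((chi xi)%:C * expi (- (2 * pi * dotrV xi y))) *
      ((gaussk k (x - a))%:C * expi (2 * pi * dotrV x xi)))).
    by apply: eq_cintegral => x; rewrite kE; ring.
  rewrite cintegralZ ?cintegral_gaussk_expi//; first by ring.
  apply: (cintegrable_dom _ igk) => [|x].
    by apply: cmeasurableM => //; apply: cmeasurable_real; exact: measurable_gaussk_shift.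
  by rewrite Normc.normcM normc_expi mulr1 normc_real ger0_norm// gaussk_ge0// ltW.
- apply: cmeasurableM.
    by apply: cmeasurable_real; exact: (measurableT_comp (measurable_gaussk_shift k a) measurable_fst).
  apply: cmeasurableM.
    by apply: cmeasurable_real; exact: (measurableT_comp mchi measurable_snd).
  rewrite (_ : (fun _ => _) = fun z : E * E => expi (- (2 * pi * dotrV z.2 y)) *
      expi (2 * pi * dotrV z.1 z.2)); last exact/funext.
  apply: cmeasurableM; first exact: (cmeasurable_fourier_kernel measurable_snd (measurable_cst y)).
  apply: cmeasurable_expi; apply: measurable_funM => //.
  exact: (measurable_dotrV2 measurable_fst measurable_snd).
- exact: igk.
- exact: integrable_norm.
- move=> x xi; rewrite !Normc.normcM !normc_real kE Normc.normcM !normc_expi !mulr1.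
  by rewrite (ger0_norm (gaussk_ge0 _ (ltW k0))).
Qed.

End gaussian_test.

Section gaussian_test_ext.
Context {R : realType} {n : nat}.
Local Notation E := 'rV[R]_n.
Local Notation C := R[i].
Local Notation vol := (volume n : {measure set E -> \bar R}).
Implicit Types (T f chi : E -> R) (x y a xi : E) (k : R).

(** A majorant in product form, as Fubini wants it. The Gaussian decays fast enough in x to pay for
    moving the weight from y - x to y, and still leaves the 2n powers needed for integrability in
    x. *)
Lemma hol_ext_gaussk_bound T chi k a : tempered_int T -> (forall Z, pderivs_in (rapid Z) chi) ->
  0 < k -> exists Psi : E -> R, [/\ forall x, 0 <= Psi x,
    vol.-integrable setT (fun x => (`|T x| * Psi x)%:E) &
    forall x y, normc (Phi chi (rV_toC y - rV_toC x)) * gaussk k (x - a) <=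
      Psi y * ((1 + `|x|) ^+ (2 * n))^-1].
Proof.
move=> tT rchi k0.
have /choice[B hB] N : exists B, 0 <= B /\ forall w, im_size w <= 0 ->
    (1 + `|Re_rV w|) ^+ N * normc (Phi chi w) <= B.
  by have [B b0 hB] := Phi_decay N (rchi 0); exists B.
have /choice[G hG] := @rapid_gaussk_shift _ n k a k0.
have [Psi [P0 iP hP]] := tempered_majorant (fun N => B N * G (N + 2 * n)%N) tT.
exists Psi; split=> // x y; have g0 := gaussk_ge0 (x - a) (ltW k0).
rewrite ler_pdivlMr ?weightX_gt0//; apply: hP => N.
have := weight_shift (y := y) (u := - x) (normc_ge0 (Phi chi (rV_toC y - rV_toC x))).
move=> /(_ N (B N)); rewrite normrN => h1.
have {}h1 : (1 + `|y|) ^+ N * normc (Phi chi (rV_toC y - rV_toC x)) <= (1 + `|x|) ^+ N * B N.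
  apply: h1; have := (hB N).2 (rV_toC y - rV_toC x).
  by rewrite -map_mxB Re_rV_toC im_size_toC; exact.
move: h1; set p := normc _; move: (gaussk k (x - a)) g0 (hG (N + 2 * n)%N x) => g g0 hg h1.
have -> : (1 + `|y|) ^+ N * (p * g * (1 + `|x|) ^+ (2 * n)) =
    ((1 + `|y|) ^+ N * p) * (g * (1 + `|x|) ^+ (2 * n)) by ring.
apply: (@le_trans _ _ (((1 + `|x|) ^+ N * B N) *
    (g * (1 + `|x|) ^+ (2 * n)))).
  by rewrite ler_wpM2r// mulr_ge0 ?weightX_ge0.
move: hg; rewrite mul0r expR0 mul1r (ger0_norm g0) exprD => hg.
have -> : (1 + `|x|) ^+ N * B N * (g * (1 + `|x|) ^+ (2 * n)) =
    B N * ((1 + `|x|) ^+ N * (1 + `|x|) ^+ (2 * n) * g) by ring.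
by rewrite ler_wpM2l ?(hB N).1.
Qed.

Lemma hol_ext_gaussk T chi k a : tempered_int T -> (forall Z, pderivs_in (rapid Z) chi) -> 0 < k ->
  cintegrable vol (fun x => hol_ext T chi (rV_toC x) * (gaussk k (x - a))%:C) /\
  cintegral vol (fun x => hol_ext T chi (rV_toC x) * (gaussk k (x - a))%:C) =
  cintegral vol (fun y => (T y)%:C * fourier (fun xi => (chi xi)%:C * modulated_gauss k a xi) y).
Proof.
move=> tT rchi k0; have [Psi [P0 iP hP]] := hol_ext_gaussk_bound a tT rchi k0.
have mchi := smooth_measurable (rchi 0).1.
pose F (z : E * E) := (T z.2)%:C * ((gaussk k (z.1 - a))%:C * Phi chi (rV_toC z.2 - rV_toC z.1)).
have mF : cmeasurable F.
  apply: cmeasurableM.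
    by apply: cmeasurable_real; exact: (measurableT_comp tT.1 measurable_snd).
  apply: cmeasurableM.
    by apply: cmeasurable_real; exact: (measurableT_comp (measurable_gaussk_shift k a) measurable_fst).
  rewrite (_ : (fun _ => _) = fun z : E * E => Phi chi (rV_toC (z.2 - z.1) + 0)).
    exact: (cmeasurable_comp (@measurable_subrV2 R n) (cmeasurable_Phi_shift 0 mchi)).
  by apply/funext => z; rewrite addr0 -map_mxB.
have FE x : cintegral vol (fun y => F (x, y)) = hol_ext T chi (rV_toC x) * (gaussk k (x - a))%:C.
  rewrite mulrC -cintegralZ; last exact: hol_ext_integrable.
  by apply: eq_cintegral => y; rewrite /F /=; ring.
have iw := @integrable_weight R n.
have Fb x y : normc (F (x, y)) <= ((1 + `|x|) ^+ (2 * n))^-1 * (`|T y| * Psi y).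
  have -> : F (x, y) = (T y)%:C * ((gaussk k (x - a))%:C * Phi chi (rV_toC y - rV_toC x)) by [].
  rewrite !Normc.normcM !normc_real [leRHS]mulrCA ler_wpM2l// [leLHS]mulrC [leRHS]mulrC.
  by rewrite (ger0_norm (gaussk_ge0 _ (ltW k0))).
split.
  rewrite -(funext FE).
  apply: (cintegrable_dom _ (integrable_mulr (2 * \int[volume n]_y (`|T y| * Psi y)) iw)) => [|x].
    exact: (cmeasurable_cintegral_param (volume n) mF).
  have iFx : vol.-integrable setT (fun y => (((1 + `|x|) ^+ (2 * n))^-1 * (`|T y| * Psi y))%:E).
    exact: integrable_mulr.
  apply: (le_trans (normc_cintegral_le _ iFx (Fb x))).
    apply: (cintegrable_dom _ iFx (Fb x)).
    exact: (cmeasurable_comp (pair1_measurable x) mF).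
  by rewrite RintegralZl// mulrCA mulrC.
rewrite -(eq_cintegral _ FE).
rewrite (@cintegral_fubini_dom _ _ _ _ _ (volume n) (volume n) F _ _ mF iw iP Fb).
apply: eq_cintegral => y; rewrite -(cintegral_gaussk_Phi a y k0 (rchi 0)) -cintegralZ//.
have igk := integrable_gaussk a k0.
have [B B0 hB] := Phi_bounded mchi ((rchi 0).2 [::]).
apply: (cintegrable_dom _ (integrable_mulr B igk)) => [|x].
  apply: cmeasurableM; first by apply: cmeasurable_real; exact: measurable_gaussk_shift.
  rewrite (_ : (fun _ => _) = fun x : E => Phi chi (rV_toC (y - x) + 0)).
    exact: (cmeasurable_comp (measurable_subrV y) (cmeasurable_Phi_shift 0 mchi)).
  by apply/funext => x; rewrite addr0 -map_mxB.
rewrite Normc.normcM normc_real (ger0_norm (gaussk_ge0 _ (ltW k0))) mulrC ler_wpM2r ?gaussk_ge0 ?(ltW k0)//.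
by apply: hB; rewrite -map_mxB im_size_toC.
Qed.

Lemma entire_continuous_real (F : 'rV[C]_n -> C) (p : C -> R) : entire F ->
  (forall u v : C, `|p u - p v| <= normc (u - v)) ->
  continuous (fun x : E => p (F (rV_toC x))).
Proof.
move=> eF hp a; apply/(@cvgrPdist_lt _ _ _ (nbhs a)) => e e0.
have := differentiable_continuous (eF (rV_toC a)).
move=> /cvgrPdist_lt /(_ e%:C); rewrite ltcR => /(_ e0) /nbhs_normP[d /= d0 hd].
(* Radii in ['rV[C]_n] are elements of C; a positive one has zero imaginary part. *)
have dE : d = (Rea d)%:C by move: d0; case: (d) => u v; rewrite ltcE/= => /andP[/eqP -> _].
have rd0 : 0 < Rea d by rewrite -ltcR -dE.
apply/(@nbhs_normP R E); exists (Rea d) => // x /= xd.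
have := hd (rV_toC x); rewrite /ball_ /= => h.
have {}h : `|F (rV_toC a) - F (rV_toC x)| < e%:C.
  apply: h; rewrite -map_mxB dE; apply: (@le_lt_trans _ _ (`|a - x|)%:C); last by rewrite ltcR.
  apply: norm_rV_le => [|j]; first by rewrite lecR.
  by rewrite mxE normc_norm normc_real lecR norm_coord_le.
by apply: le_lt_trans (hp _ _) _; rewrite -ltcR -normc_norm.
Qed.

Lemma Re_lipschitz (u v : C) : `|Rea u - Rea v| <= normc (u - v).
Proof. by rewrite -ReN -ReD normr_Re_le. Qed.

Lemma Im_lipschitz (u v : C) : `|Ima u - Ima v| <= normc (u - v).
Proof. by rewrite -ImN -ImD normr_Im_le. Qed.

End gaussian_test_ext.

(** * The extremal function for a given integrable density *)

Section majorant.
Context {R : realType} {n : nat}.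
Local Notation E := 'rV[R]_n.
Local Notation C := R[i].
Local Notation vol := (volume n : {measure set E -> \bar R}).
Implicit Types (T U calG chi : E -> R) (x y a : E) (K : set E).

Lemma tempered_int_continuous calG : continuous calG ->
  (forall phi, schwartz phi -> cL1 (fun x => (calG x)%:C * phi x)) -> tempered_int calG.
Proof.
move=> cG tG; split; first exact: continuous_measurable_rV.
move=> Psi sP _; have [[_ iG] _] := tG _ (schwartz_real sP).
apply: integrable_lty.
  apply: measurable_funM; first exact: continuous_measurable_rV.
  exact: smooth_measurable sP.1.
apply: le_lt_trans iG; rewrite le_eqVlt; apply/orP; left; apply/eqP/eq_integral => x _.
by rewrite Re_realM.
Qed.

Lemma rapid_bounded (f : E -> R) : rapid 0 f -> exists2 B, 0 <= B & forall x, `|f x| <= B.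
Proof.
move=> /(_ 0%N)[B hB]; have {}hB x : `|f x| <= B.
  by have := hB x; rewrite mul0r expR0 mul1r expr0 mul1r.
by exists B => //; exact: le_trans (hB 0).
Qed.

Lemma integrable_mul_bounded U (p : E -> R) B : vol.-integrable setT (EFin \o U) ->
  measurable_fun setT p -> (forall x, `|p x| <= B) ->
  vol.-integrable setT (fun x => (U x * p x)%:E).
Proof.
move=> iU mp pB; apply: (integrable_dom _ (integrable_mulr B (integrable_norm iU))) => [|x].
  by apply: measurable_funM => //; apply/measurable_EFinP; exact: measurable_int iU.
by rewrite /= normrM mulrC ler_wpM2r.
Qed.

Lemma tempered_int_integrable U : vol.-integrable setT (EFin \o U) -> tempered_int U.
Proof.
move=> iU; split; first by apply/measurable_EFinP; exact: measurable_int iU.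
move=> Psi sP _; have [B _ hB] := rapid_bounded (sP.2 [::]).
exact: integrable_mul_bounded (smooth_measurable sP.1) hB.
Qed.

Lemma tempered_intD T U : tempered_int T -> tempered_int U ->
  tempered_int (fun x => T x + U x).
Proof.
move=> [mT iT] [mU iU]; split; first exact: measurable_funD.
move=> Psi sP P0; under eq_fun do rewrite mulrDl.
by apply: integrable_addr; [exact: iT|exact: iU].
Qed.

(** The strict inequality on K leaves around each of its points an open set where phi vanishes, so
    that even the closure of the support avoids K. *)
Lemma schwartz_off_cutoff K (A : R) (phi : E -> C) : schwartz phi ->
  (forall x, K x -> `|x| < A) -> (forall x, `|x| <= A -> phi x = 0) -> schwartz_off K phi.
Proof.
move=> sphi KA phi0; split=> // x clx Kx.
have xA := KA _ Kx.
have /clx[y [/= + yA]] : nbhs x (fun y : E => `|y| < A).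
  have := @norm_continuous R E x => /cvgr_lt; exact.
by rewrite phi0 ?eqxx// ltW.
Qed.

Lemma cintegrable_tempered_fourier T phi : tempered_int T -> schwartz phi ->
  cintegrable vol (fun x => (T x)%:C * fourier phi x).
Proof.
move=> tT sphi; apply: cintegrable_tempered => //; last exact: crapid_fourier.
by apply: cmeasurable_fourier; exact: schwartz_measurable.
Qed.

Lemma integral_hol_ext_gaussk K T chi (A : R) k a : tempered_int T ->
  (forall Z, pderivs_in (rapid Z) chi) -> slow (fun x => 1 - chi x) ->
  (forall x, `|x| <= A -> chi x = 1) -> (forall x, K x -> `|x| < A) ->
  (forall phi, schwartz_off K phi -> cintegral vol (fun x => (T x)%:C * fourier phi x) = 0) ->
  0 < k ->
  cintegral vol (fun x => hol_ext T chi (rV_toC x) * (gaussk k (x - a))%:C) =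
  (\int[volume n]_x (T x * gaussk k (x - a)))%:C.
Proof.
move=> tT rchi schi chi1 KA star k0; rewrite (hol_ext_gaussk a tT rchi k0).2.
pose psi := modulated_gauss k a.
have slow_chi : slow chi.
  by apply: pderivs_inS (rchi 0) => f; exact: rapid_poly_growth.
have s1 : schwartz (fun xi => (chi xi)%:C * psi xi) by exact: schwartz_modulated_gauss.
have s2 : schwartz (fun xi => (1 - chi xi)%:C * psi xi) by exact: schwartz_modulated_gauss.
have off : schwartz_off K (fun xi => (1 - chi xi)%:C * psi xi).
  by apply: (schwartz_off_cutoff s2 KA) => x /chi1 ->; rewrite subrr mul0r.
have fE y : (gaussk k (y - a))%:C = fourier (fun xi => (chi xi)%:C * psi xi) y +
    fourier (fun xi => (1 - chi xi)%:C * psi xi) y.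
  rewrite -fourierD; try exact: schwartz_cintegrable.
  rewrite -(fourier_modulated_gauss a y k0); congr (fourier _ y); apply/funext => xi.
  by rewrite -mulrDl -rmorphD/= addrC subrK mul1r.
rewrite -cintegral_real.
transitivity (cintegral vol (fun y => (T y)%:C * fourier (fun xi => (chi xi)%:C * psi xi) y +
    (T y)%:C * fourier (fun xi => (1 - chi xi)%:C * psi xi) y)).
  rewrite (cintegralD (cintegrable_tempered_fourier tT s1) (cintegrable_tempered_fourier tT s2)).
  by rewrite (star _ off) addr0.
by apply: eq_cintegral => y; rewrite -mulrDr -fE rmorphM.
Qed.

(** Dominated convergence is available for sequences only; this converts it into continuity. *)
Lemma seq_continuous (p : E -> R) a :
  (forall u : nat -> E, u @ \oo --> a -> (fun k => p (u k)) @ \oo --> p a) ->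
  {for a, continuous p}.
Proof.
move=> hp; apply/(@cvgrPdist_lt _ _ _ (nbhs a)) => e e0; apply/not_notP => ne.
have /choice[u hu] (k : nat) : exists x, `|a - x| < k.+1%:R^-1 /\ e <= `|p a - p x|.
  apply/not_existsP => hx; apply: ne; apply/(@nbhs_normP R E).
  exists k.+1%:R^-1; first by rewrite /= invr_gt0 ltr0n.
  move=> x /= xk; rewrite ltNge; apply/negP => ex; exact: (hx x).
have ua : u @ \oo --> a.
  apply/cvgrPdist_lt => d d0.
  have [N _ hN] := near_infty_natSinv_lt (PosNum d0).
  exists N => //; move=> k /hN /= kd; exact: lt_trans (hu k).1 kd.
have /cvgrPdist_lt /(_ _ e0) [N _ hN] := hp u ua.
by have := hN N (leqnn N); rewrite /= ltNge (hu N).2.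
Qed.

Lemma continuous_fourier phi : cintegrable vol phi ->
  continuous (fun x => Rea (fourier phi x)) /\ continuous (fun x => Ima (fourier phi x)).
Proof.
move=> ip; have ipn := cintegrable_norm ip; have mp := cintegrable_measurable ip.
have mk xi : cmeasurable (fun x : E => expi (- (2 * pi * dotrV x xi)) * phi x).
  exact: cintegrable_measurable (cintegrable_fourier_integrand xi ip).
have ce (u : nat -> E) a x : u @ \oo --> a ->
    (fun k => - (2 * pi * dotrV x (u k))) @ \oo --> - (2 * pi * dotrV x a).
  move=> ua; apply: cvgN; apply: cvgMr; rewrite dotrVC dotrVE.
  rewrite (_ : (fun k => _) = lform (fun j => x ord0 j) \o u); last first.
    by apply/funext => k; rewrite /= -dotrVE dotrVC.
  by apply: continuous_cvg; [exact: continuous_lform|exact: ua].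
have cosu (u : nat -> E) a x : u @ \oo --> a ->
    (fun k => cos (- (2 * pi * dotrV x (u k)))) @ \oo --> cos (- (2 * pi * dotrV x a)).
  by move=> ua; apply: continuous_cvg; [exact: continuous_cos|exact: ce].
have sinu (u : nat -> E) a x : u @ \oo --> a ->
    (fun k => sin (- (2 * pi * dotrV x (u k)))) @ \oo --> sin (- (2 * pi * dotrV x a)).
  by move=> ua; apply: continuous_cvg; [exact: continuous_sin|exact: ce].
have bd xi x : normc (expi (- (2 * pi * dotrV x xi)) * phi x) <= normc (phi x).
  by rewrite Normc.normcM normc_expi mul1r.
split=> a; apply: seq_continuous => u ua.
- apply: (dominated_cvg_Rintegral _ _ _ ipn) => [k||x|k x].
  + exact: (mk (u k)).1.
  + exact: (mk a).1.
  + under eq_fun do rewrite ReM; rewrite ReM; apply: cvgB; apply: cvgMl.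
      exact: cosu.
    exact: sinu.
  + by apply: le_trans (bd (u k) x); exact: normr_Re_le.
- apply: (dominated_cvg_Rintegral _ _ _ ipn) => [k||x|k x].
  + exact: (mk (u k)).2.
  + exact: (mk a).2.
  + under eq_fun do rewrite ImM; rewrite ImM; apply: cvgD; apply: cvgMl.
      exact: cosu.
    exact: sinu.
  + by apply: le_trans (bd (u k) x); exact: normr_Im_le.
Qed.

Lemma crapid_bounded (f : E -> C) : crapid f -> exists2 B, 0 <= B & forall x, normc (f x) <= B.
Proof.
move=> /(_ 0%N)[B hB]; exists B; first by apply: le_trans (hB 0); rewrite expr0 mul1r normc_ge0.
by move=> x; have := hB x; rewrite expr0 mul1r.
Qed.

(** The sign [sg], equal to 1 or -1, treats majorants and minorants together. The order of the steps
    matters: the sign of [c] yields its mass, the mass its integrability, and integrability both the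
    temperedness and the spectrum of M. *)
Lemma extremal_function K calG U (A sg : R) :
  continuous calG -> tempered_fun (fun x => (calG x)%:C) ->
  vol.-integrable setT (EFin \o U) -> (forall x, K x -> `|x| < A) ->
  (forall phi, schwartz_off K phi ->
     cintegral vol (fun x => (calG x)%:C * fourier phi x) +
     cintegral vol (fun x => (U x)%:C * fourier phi x) = 0) ->
  sg ^+ 2 = 1 -> (forall x, 0 <= sg * U x) ->
  exists M : 'rV[C]_n -> C, [/\ real_entire M, exp_type K M,
    forall x, 0 <= sg * (Rea (M (rV_toC x)) - calG x) &
    (\int[volume n]_x (sg * (Rea (M (rV_toC x)) - calG x))%:E =
     \int[volume n]_x (sg * U x)%:E)%E].
Proof.
move=> cG tG iU KA star sg2 sU.
have mG := continuous_measurable_rV cG.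
have tiG := tempered_int_continuous cG tG.1; have tiU := tempered_int_integrable iU.
(* The absolute value, since [A] may be negative when K is empty. *)
have [chi [rchi schi chi1]] := plateau_exists (n := n) (normr_ge0 A).
have KA' x : K x -> `|x| < `|A| by move=> /KA /lt_le_trans; apply; exact: ler_norm.
pose T x := calG x + U x; have tT : tempered_int T := tempered_intD tiG tiU.
have starT phi : schwartz_off K phi -> cintegral vol (fun x => (T x)%:C * fourier phi x) = 0.
  move=> off; rewrite -[RHS](star _ off) -cintegralD; try exact: cintegrable_tempered_fourier _ off.1.
  by apply: eq_cintegral => x; rewrite -mulrDl -rmorphD.
pose M := hol_ext T chi; have eM : entire M := entire_hol_ext tT rchi.
pose f x := M (rV_toC x).
have cRe : continuous (fun x => Rea (f x)) := entire_continuous_real eM Re_lipschitz.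
have cIm : continuous (fun x => Ima (f x)) := entire_continuous_real eM Im_lipschitz.
have Mg k a : 0 < k -> cintegrable vol (fun x => f x * (gaussk k (x - a))%:C).
  by move=> k0; have [] := hol_ext_gaussk a tT rchi k0.
have iMg k a : 0 < k -> cintegral vol (fun x => f x * (gaussk k (x - a))%:C) =
    (\int[volume n]_x (T x * gaussk k (x - a)))%:C.
  by move=> k0; exact: (integral_hol_ext_gaussk a tT rchi schi chi1 KA' starT k0).
have ReMg x (r : R) : Rea (f x * r%:C) = Rea (f x) * r by rewrite mulrC Re_realM mulrC.
have ImMg x (r : R) : Ima (f x * r%:C) = Ima (f x) * r by rewrite mulrC Im_realM mulrC.
have iRe k a : 0 < k -> vol.-integrable setT (fun x => (Rea (f x) * gaussk k (x - a))%:E).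
  by move=> /Mg-/(_ a)[+ _]; under eq_fun do rewrite ReMg.
have iIm k a : 0 < k -> vol.-integrable setT (fun x => (Ima (f x) * gaussk k (x - a))%:E).
  by move=> /Mg-/(_ a)[_]; under eq_fun do rewrite ImMg.
(* T is real, so every Gaussian average of the imaginary part vanishes, and by continuity so do its
   values. *)
have Im0 a : Ima (f a) = 0.
  have := gauss_approx (continuous_measurable_rV cIm) (cIm a) (iIm 1 a ltr01).
  rewrite (_ : (fun k : nat => _) = cst 0).
    by move=> /(cvg_lim (@norm_hausdorff _ _)) <-; rewrite (cvg_lim _ (cvg_cst _)).
  apply/funext => k; have k0 : 0 < k.+1%:R :> R by rewrite ltr0n.
  transitivity (Ima (cintegral vol (fun x => f x * (gaussk k.+1%:R (x - a))%:C))).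
    by apply: eq_Rintegral => x _; rewrite ImMg.
  by rewrite iMg.
pose c x := Rea (f x) - calG x.
have cc : continuous c by move=> x; exact: (cvgB (cRe x) (cG x)).
have mc := continuous_measurable_rV cc.
have igk T' k a : tempered_int T' -> 0 < k -> vol.-integrable setT (fun x => (T' x * gaussk k (x - a))%:E).
  move=> tT' k0; have [] : cintegrable vol (fun x => (T' x)%:C * (gaussk k (x - a))%:C).
    apply: cintegrable_tempered => //; first by apply: cmeasurable_real; exact: measurable_gaussk_shift.
    move=> N; have [B hB] := rapid_gaussk_shift a k0 N; exists B => x.
    by rewrite normc_real; have := hB x; rewrite mul0r expR0 mul1r.
  by under eq_fun do rewrite Re_realM.
have ic k a : 0 < k -> vol.-integrable setT (fun x => (c x * gaussk k (x - a))%:E).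
  move=> k0; under eq_fun do rewrite /c mulrBl.
  by apply: integrable_subr; [exact: iRe|exact: igk].
have cU k a : 0 < k -> \int[volume n]_x (c x * gaussk k (x - a)) =
    \int[volume n]_x (U x * gaussk k (x - a)).
  move=> k0; under eq_Rintegral do rewrite /c mulrBl.
  rewrite RintegralB//; [|exact: iRe|exact: igk].
  have -> : \int[volume n]_x (Rea (f x) * gaussk k (x - a)) = \int[volume n]_x (T x * gaussk k (x - a)).
    transitivity (Rea (cintegral vol (fun x => f x * (gaussk k (x - a))%:C))).
      by apply: eq_Rintegral => x _; rewrite ReMg.
    by rewrite iMg.
  under eq_Rintegral do rewrite /T mulrDl.
  by rewrite RintegralD//; [rewrite addrC addrA addNr add0r|exact: igk|exact: igk].
have sgU k a : 0 < k -> 0 <= sg * \int[volume n]_x (c x * gaussk k (x - a)).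
  move=> k0; rewrite cU// -RintegralZl//; last exact: igk.
  by apply: Rintegral_ge0 => x _; rewrite mulrA mulr_ge0 ?gaussk_ge0 ?(ltW k0).
have sc a : 0 <= sg * c a.
  have H : (fun k : nat => sg * \int[volume n]_x (c x * gaussk k.+1%:R (x - a))) @ \oo --> sg * c a.
    by apply: cvgMr; exact: gauss_approx mc (cc a) (ic 1 a ltr01).
  rewrite -(cvg_lim (@norm_hausdorff _ _) H); apply: limr_ge; first by apply: cvgP H.
  by apply: nearW => k; apply: sgU; rewrite ltr0n.
(* [c] and [U] have equal averages at every centre; integrating over the centres recovers both
   masses, as both signed functions are nonnegative. *)
have mass : (\int[volume n]_x (sg * c x)%:E = \int[volume n]_x (sg * U x)%:E)%E.
  have mU : measurable_fun setT U by apply/measurable_EFinP; exact: measurable_int iU.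
  have msc : measurable_fun setT (fun x => sg * c x) by exact: measurable_funM.
  have msU : measurable_fun setT (fun x => sg * U x) by exact: measurable_funM.
  rewrite -(gauss_mass msc sc) -(gauss_mass msU sU).
  have fin T' a : vol.-integrable setT (fun x => (T' x * gaussk 1 (x - a))%:E) ->
      (\int[volume n]_x (sg * T' x * gaussk 1 (x - a))%:E =
       (sg * \int[volume n]_x (T' x * gaussk 1 (x - a)))%:E)%E.
    move=> iT'; rewrite -RintegralZl// /Rintegral fineK.
      by apply: eq_integral => x _; rewrite mulrA.
    by apply: integrable_fin_num => //; exact: integrable_mulr.
  apply: eq_integral => a _; rewrite (fin c) ?(fin U) ?cU//.
    exact: igk.
  exact: ic.
have abs_sg (r : R) : 0 <= sg * r -> `|r| = sg * r.
  have sg1 : `|sg| = 1.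
    by apply/eqP; rewrite -(@eqrXn2 _ 2%N) ?expr1n// real_normK ?num_real// sg2.
  by move=> r0; rewrite -[LHS]mul1r -sg1 -normrM ger0_norm.
have icc : vol.-integrable setT (EFin \o c).
  apply: integrable_lty => //.
  rewrite (eq_integral _ _ (fun x _ => congr1 EFin (abs_sg _ (sc x)))) mass.
  rewrite -(eq_integral _ _ (fun x _ => congr1 EFin (abs_sg _ (sU x)))).
  by have /integrableP[] := iU.
(* Now that c - U is integrable, its vanishing against Gaussians extends to bounded continuous
   functions, in particular to transforms of Schwartz functions. *)
have cphi (phi : E -> R) B : continuous phi -> (forall x, `|phi x| <= B) ->
    \int[volume n]_x (c x * phi x) = \int[volume n]_x (U x * phi x).
  move=> cphi phiB; have mphi := continuous_measurable_rV cphi.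
  have iD : vol.-integrable setT (EFin \o (fun x => c x - U x)) by exact: integrable_subr.
  have := integral_gauss_null iD cphi phiB.
  under eq_Rintegral do rewrite mulrBl.
  rewrite RintegralB//; try exact: (integrable_mul_bounded _ mphi phiB).
  move=> H; apply/eqP; rewrite -subr_eq0; apply/eqP; apply: H => k a k0.
  under eq_Rintegral do rewrite mulrBl.
  by rewrite RintegralB ?cU ?subrr//; [exact: ic|exact: igk].
have fE x : f x = (calG x)%:C + (c x)%:C.
  by apply: complex_ext; rewrite ?ReD ?ImD ?Im0 /= ?addr0// /c addrC subrK.
have cmf : cmeasurable f by split; exact: continuous_measurable_rV.
have icphi (phi : E -> C) B : cmeasurable phi -> (forall x, normc (phi x) <= B) ->
    cintegrable vol (fun x => (c x)%:C * phi x).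
  move=> mphi phiB; apply: (cintegrable_dom _ (integrable_mulr B (integrable_norm icc))) => [|x].
    by apply: cmeasurableM => //; exact: cmeasurable_real.
  by rewrite Normc.normcM normc_real mulrC ler_wpM2r.
have bphi (phi : E -> C) : schwartz phi -> exists B, forall x, normc (phi x) <= B.
  move=> /schwartzP[[_ /(_ [::]) /rapid_bounded[B1 _ h1]] [_ /(_ [::]) /rapid_bounded[B2 _ h2]]].
  by exists (B1 + B2) => x; apply: le_trans (normc_le _) _; exact: (lerD (h1 x) (h2 x)).
have iGphi (phi : E -> C) : schwartz phi -> cintegrable vol (fun x => (calG x)%:C * phi x).
  move=> sphi; have [[_ iR] [_ iI]] := tG.1 _ sphi.
  have [mR mI] : cmeasurable (fun x => (calG x)%:C * phi x).
    by apply: cmeasurableM; [exact: cmeasurable_real|exact: schwartz_measurable].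
  by split; exact: integrable_lty.
have icS (phi : E -> C) : schwartz phi -> cintegrable vol (fun x => (c x)%:C * phi x).
  by move=> sphi; have [B hB] := bphi _ sphi; apply: icphi hB; exact: schwartz_measurable.
have fphiE (phi : E -> C) : (fun x => f x * phi x) =
    (fun x => (calG x)%:C * phi x + (c x)%:C * phi x).
  by apply/funext => x; rewrite fE mulrDl.
have ifphi (phi : E -> C) : schwartz phi -> cintegrable vol (fun x => f x * phi x).
  by move=> sphi; rewrite fphiE; apply: cintegrableD; [exact: iGphi|exact: icS].
have distrE (phi : E -> C) : schwartz phi -> distr_of f phi =
    distr_of (fun x => (calG x)%:C) phi + cintegral vol (fun x => (c x)%:C * phi x).
  move=> sphi; rewrite /distr_of fphiE.
  by rewrite (cintegralD (iGphi _ sphi) (icS _ sphi)).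
(* The spectrum first: [f] is calG + c on R^n, [cphi] replaces c by U against [fourier phi], and the
   hypothesis [star] gives 0. Temperedness follows, as that of calG perturbed by an integrable
   function. *)
exists M; split => //; split; last first.
  move=> phi off; rewrite -[RHS](star _ off) /fourier_distr /distr_of.
  have sphi := off.1; have ip := schwartz_cintegrable sphi.
  have [B B0 hB] := crapid_bounded (crapid_fourier sphi).
  have mfp : cmeasurable (fourier phi) by exact: cmeasurable_fourier (schwartz_measurable sphi).
  rewrite -/f fphiE (cintegralD (cintegrable_tempered_fourier tiG sphi) (icphi _ _ mfp hB)).
  congr (_ + _); have [cR cI] := continuous_fourier ip.
  congr Complex.
    under eq_Rintegral do rewrite Re_realM; under [RHS]eq_Rintegral do rewrite Re_realM.
    by apply: (cphi _ B) => // x; exact: le_trans (normr_Re_le _) (hB x).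
  under eq_Rintegral do rewrite Im_realM; under [RHS]eq_Rintegral do rewrite Im_realM.
  by apply: (cphi _ B) => // x; exact: le_trans (normr_Im_le _) (hB x).
split.
  move=> phi sphi; have [iR iI] := ifphi _ sphi.
  have L1i (g : E -> R) : vol.-integrable setT (EFin \o g) -> L1 g.
    move=> /integrableP[/measurable_EFinP mg ig]; split=> //.
    by exists g => //; exact: aeW.
  by split; exact: L1i.
split=> [z phi psi sphi spsi|phi sphi eps eps0].
  rewrite /distr_of -/f -(cintegralZ z (ifphi _ sphi)).
  rewrite -(cintegralD (cintegrableZ z (ifphi _ sphi)) (ifphi _ spsi)).
  by apply: eq_cintegral => x; rewrite mulrDr [X in X + _]mulrCA.
have e2 : 0 < eps / 2 by rewrite divr_gt0.
have [N [d d0 hd]] := tG.2.2 _ sphi _ e2.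
pose I := \int[volume n]_x `|c x|.
have I0 : 0 <= I by apply: Rintegral_ge0.
have I1 : 0 < 4 * (I + 1) by rewrite mulr_gt0// ltr_wpDl.
(* The 4 combines the factor 2 of [normc_cintegral_le] with the half of [eps] reserved for the
   contribution of c; I + 1 allows I = 0. *)
exists N, (Num.min d (eps / (4 * (I + 1)))); first by rewrite lt_min d0 divr_gt0.
move=> psi spsi hpsi; rewrite !distrE//.
have -> (u1 u2 v1 v2 : C) : u1 + u2 - (v1 + v2) = (u1 - v1) + (u2 - v2) by ring.
apply: (le_lt_trans (normcD_le _ _)); rewrite [ltRHS](splitr eps) ltrD//.
  apply: hd => // k s x kN sN; apply: lt_le_trans (hpsi k s x kN sN) _.
  by rewrite ge_min lexx.
rewrite -(cintegralB (icS _ spsi) (icS _ sphi)).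
set e := eps / (4 * (I + 1)).
have e0 : 0 < e by rewrite divr_gt0.
have bd x : normc ((c x)%:C * psi x - (c x)%:C * phi x) <= e * `|c x|.
  rewrite -mulrBr Normc.normcM normc_real mulrC ler_wpM2r// ltW//.
  have := hpsi 0%N [::] x (leq0n _) (leq0n _); rewrite lt_min => /andP[_].
  by rewrite /schwartz_weight expr0 mul1r /cpderiv /=; case: (psi x - phi x).
have ib : vol.-integrable setT (fun x => (e * `|c x|)%:E).
  by apply: integrable_mulr; exact: integrable_norm.
apply: (le_lt_trans (normc_cintegral_le (cintegrableB (icS _ spsi) (icS _ sphi)) ib bd)).
rewrite RintegralZl//; last exact: integrable_norm.
have I1' : 0 < I + 1 by rewrite ltr_wpDl.
rewrite -/I [ltLHS](_ : _ = (I / (I + 1)) * (eps / 2)); last first.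
  by rewrite /e; field; rewrite gt_eqF.
by rewrite gtr_pMl// ltr_pdivrMr// mul1r ltrDl.
Qed.

End majorant.

(** * Integration over the parameters *)

Section ae_integral.
Context {R : realType} d (T : measurableType d) (mu : {measure set T -> \bar R}).
Local Open Scope ereal_scope.
Import HBNNSimple.

(** [f] may fail to be measurable, so its integral is handled as a supremum over simple functions
    below it. Setting such a function to 0 on the exceptional null set leaves its integral unchanged
    and puts it below the other function. *)
Lemma ge0_integral_ae_eq (f g : T -> \bar R) : measurable_fun setT g ->
  (forall x, 0 <= f x) -> (forall x, 0 <= g x) ->
  {ae mu, forall x, f x = g x} -> \int[mu]_x f x = \int[mu]_x g x.
Proof.
move=> mg f0 g0 [N [mN N0 fgN]].
have fg x : ~ N x -> f x = g x by move=> Nx; apply: contrapT => fx; exact/Nx/fgN.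
have mNC : measurable (~` N) by exact: measurableC.
have aeN : {ae mu, forall x, ~ N x} by exists N; split => // x /contrapT.
have lef (f1 f2 : T -> \bar R) : (forall x, 0 <= f1 x) -> (forall x, 0 <= f2 x) ->
    (forall h : {nnsfun T >-> R}, (forall x, (h x)%:E <= f1 x) ->
      \int[mu]_x (h x)%:E <= \int[mu]_x f2 x) ->
    \int[mu]_x f1 x <= \int[mu]_x f2 x.
  move=> f10 f20 hf; rewrite [leLHS]ge0_integralTE//; apply: ge_ereal_sup => _ [h /= hf1 <-].
  by rewrite -integralT_nnsfun; exact: hf.
have cut (h : {nnsfun T >-> R}) :
    \int[mu]_x (h x)%:E = \int[mu]_x (proj_nnsfun h mNC x)%:E.
  apply: ae_eq_integral => //.
  - by apply/measurable_EFinP.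
  - by apply/measurable_EFinP.
  apply: filterS aeN => x Nx _; rewrite -mrestrict /patch ifT//.
  by rewrite inE.
apply/eqP; rewrite eq_le; apply/andP; split; apply: lef => // h hle.
  rewrite cut; apply: ge0_le_integral => // [x _||x _].
  - by rewrite lee_fin.
  - by apply/measurable_EFinP.
  rewrite -mrestrict /patch; case: ifPn => [|_]; last exact: g0.
  by rewrite inE => Nx; rewrite -fg.
rewrite cut [leRHS]ge0_integralTE// integralT_nnsfun.
apply: ereal_sup_ubound => /=; exists (proj_nnsfun h mNC) => // x.
rewrite -mrestrict /patch; case: ifPn => [|_]; last exact: f0.
by rewrite inE => Nx; rewrite fg.
Qed.

Lemma integral_ae_eq (f g : T -> \bar R) : measurable_fun setT g ->
  {ae mu, forall x, f x = g x} -> \int[mu]_x f x = \int[mu]_x g x.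
Proof.
move=> mg fg; rewrite integralE [RHS]integralE; congr (_ - _).
  apply: ge0_integral_ae_eq => //; first exact: measurable_funepos.
  by apply: filterS fg => x fgx; rewrite !funeposE fgx.
apply: ge0_integral_ae_eq => //; first exact: measurable_funeneg.
by apply: filterS fg => x fgx; rewrite !funenegE fgx.
Qed.

Lemma cintegral_ae_eq (f g : T -> R[i]) : cmeasurable g ->
  {ae mu, forall x, f x = g x} -> cintegral mu f = cintegral mu g.
Proof.
move=> [mr mi] fg; congr Complex; congr fine; apply: integral_ae_eq.
- exact/measurable_EFinP.
- by apply: filterS fg => x ->.
- exact/measurable_EFinP.
- by apply: filterS fg => x ->.
Qed.

Variables (D : set T) (mD : measurable D).

(** No measurability of [f]: a simple function below [f] has its positive level sets inside [D],
    where the two measures agree. *)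
Lemma ge0_integral_mrestr (f : T -> \bar R) : (forall x, 0 <= f x) ->
  (forall x, ~ D x -> f x = 0) ->
  \int[mrestr mu mD]_x f x = \int[mu]_x f x.
Proof.
move=> f0 fD; rewrite !ge0_integralTE//; congr ereal_sup.
apply: eq_imagel => h /= hf; rewrite !sintegralEnnsfun.
apply: eq_fsbigr => r; rewrite inE /= => r0; congr (_ * _).
rewrite /mrestr; congr (mu _); apply/seteqP; split => [x []//|x /= hx].
split=> //; apply: contrapT => Dx; have := hf x.
by rewrite fD// hx lee_fin leNgt r0.
Qed.

Lemma integral_mrestr (f : T -> \bar R) : (forall x, ~ D x -> f x = 0) ->
  \int[mrestr mu mD]_x f x = \int[mu]_x f x.
Proof.
move=> fD; rewrite [LHS]integralE [RHS]integralE; congr (_ - _); apply: ge0_integral_mrestr => //.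
  by move=> x Dx; rewrite funeposE fD// maxxx.
by move=> x Dx; rewrite funenegE fD// oppe0 maxxx.
Qed.

End ae_integral.

(** * Restriction of the parameter measure to a sigma-finite part *)

Section sigma_finite_restriction.
Context {R : realType} d (T : measurableType d) (mu : {measure set T -> \bar R}).
Variable I : T -> \bar R.
Hypothesis mI : measurable_fun setT I.
Hypothesis I0 : forall x, (0 <= I x)%E.
Hypothesis Ioo : (\int[mu]_x I x < +oo)%E.

Definition supp_fin := [set x | (0 < I x < +oo)%E].

Lemma measurable_supp_fin : measurable supp_fin.
Proof.
rewrite (_ : supp_fin = setT `&` [set x | (0 < I x)%E] `&` (setT `&` [set x | (I x < +oo)%E])).
  apply: measurableI; first exact: emeasurable_fun_o_infty.
  exact: emeasurable_fun_infty_o.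
by rewrite !setTI; apply/seteqP; split => x /=; [move=> /andP[]|by move=> [? ?]; apply/andP].
Qed.

Definition restr_supp := mrestr mu measurable_supp_fin.

HB.instance Definition _ := Measure.on restr_supp.

Lemma sigma_finite_restr_supp : sigma_finite setT restr_supp.
Proof.
(* Outside [supp_fin] the restricted measure is 0, and by Markov's inequality the set where I
   exceeds 1/(k+1) has finite measure. *)
pose F (k : nat) := ~` supp_fin `|` [set x | (k.+1%:R^-1%:E < I x)%E].
have mA (k : nat) : measurable [set x | (k.+1%:R^-1%:E < I x)%E].
  by rewrite -[X in measurable X]setTI; exact: emeasurable_fun_o_infty.
exists F.
  apply/seteqP; split=> // x _.
  have [Dx|Dx] := pselect (supp_fin x); last by exists 0%N => //; left.
  have /andP[Ix0 Ixoo] := Dx.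
  have fIx : (I x \is a fin_num)%E by rewrite ge0_fin_numE.
  have [k hk] := ltr_add_invr (fine_gt0 Dx : 0 < fine (I x)).
  by exists k => //; right; rewrite /= -(fineK fIx) lte_fin -[X in X < _]add0r.
move=> k; split.
  by apply: measurableU => //; apply: measurableC; exact: measurable_supp_fin.
set c : R := k.+1%:R^-1; set A := [set x | (c%:E < I x)%E].
have c0 : 0 < c by rewrite invr_gt0 ltr0n.
apply: (@le_lt_trans _ _ (mu A)).
  rewrite /= /restr_supp /mrestr; apply: le_measure; rewrite ?inE//.
    apply: measurableI measurable_supp_fin; apply: measurableU (mA k).
    by apply: measurableC; exact: measurable_supp_fin.
    exact: mA.
  by move=> x [[//|]].
have mA' : measurable A := mA k.
have : (c%:E * mu A < +oo)%E.
  apply: le_lt_trans Ioo; rewrite -[X in (_ * mu X)%E]setIT -integral_indic//.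
  rewrite -ge0_integralZl_EFin//; last 2 first.
  - by apply/measurable_EFinP; exact: measurable_indic.
  - exact: ltW.
  apply: ge0_le_integral => //.
  - by move=> x _; rewrite -EFinM lee_fin mulr_ge0 ?(ltW c0)// indicE.
  - apply/measurable_EFinP; apply: measurable_funM => //; exact: measurable_indic.
  move=> x _; rewrite indicE; case: (boolP (x \in A)) => [|_]; last by rewrite mule0 I0.
  by rewrite inE /A /= mule1 => /ltW.
case: (mu A) (measure_ge0 mu A) => [r||]// _; rewrite ?ltry//.
by rewrite gt0_muley.
Qed.

HB.instance Definition _ := @Measure_isSigmaFinite.Build _ _ _
  restr_supp sigma_finite_restr_supp.

Lemma sigma_finite_restriction : exists m : {sigma_finite_measure set T -> \bar R},
  forall f : T -> \bar R, (forall x, ~ supp_fin x -> f x = 0%E) ->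
    (\int[m]_x f x = \int[mu]_x f x)%E.
Proof. by exists restr_supp => f fD; exact: integral_mrestr. Qed.

End sigma_finite_restriction.

Section parameter_reduction.
Context {R : realType} {n : nat} {dL : measure_display} {L : measurableType dL}.
Local Notation E := 'rV[R]_n.
Local Notation C := R[i].
Local Notation vol := (volume n : {measure set E -> \bar R}).

(** [W] is the density obtained by integrating out the parameter, and [g] a jointly measurable
    version of [rho]. The last clause is Fubini for transforms, phrased for an [H] known only off
    the null set [N], because the transforms of the G(.;l) are controlled only where rho(.;l) is
    integrable. *)
Lemma jointly_measurable_reduction (nu : {measure set L -> \bar R}) (rho : E -> L -> R) :
  (forall x l, 0 <= rho x l) -> jointly_measurable rho ->
  (\int[nu]_l \int[volume n]_x (rho x l)%:E < +oo)%E ->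
  exists W : E -> R, exists g : L -> E -> R, exists N : set L,
  [/\ nu.-negligible N,
      forall l, ~ N l -> vol.-integrable setT (EFin \o g l) /\
        {ae volume n, forall x, rho x l = g l x},
      [/\ vol.-integrable setT (EFin \o W), forall x, 0 <= W x &
        (\int[volume n]_x (W x)%:E = \int[nu]_l \int[volume n]_x (rho x l)%:E)%E] &
      forall (s : C) xi (H : L -> C),
        (forall l, ~ N l -> H l = s * fourier (fun x => (g l x)%:C) xi) ->
        cintegral nu H = s * fourier (fun x => (W x)%:C) xi].
Proof.
move=> rho0 [g0 mg0 rg0] rhooo.
pose I l := (\int[volume n]_x `|g0 (x, l)|%:E)%E.
have mg0n : measurable_fun setT (fun z : E * L => `|g0 z|%:E).
  by apply/measurable_EFinP; exact: measurableT_comp.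
have IE l : (\int[volume n]_x (rho x l)%:E = I l)%E.
  apply: integral_ae_eq; first exact: (measurableT_comp mg0n (pair2_measurable l)).
  by apply: filterS (rg0 l) => x <-; rewrite ger0_norm.
have I0 l : (0 <= I l)%E by apply: integral_ge0 => x _; rewrite lee_fin.
have mI : measurable_fun setT I.
  apply: (@measurable_fun_fubini_tonelli_G _ _ _ _ _ (volume n) _ mg0n) => z.
  by rewrite lee_fin.
have Ioo : (\int[nu]_l I l < +oo)%E.
  by rewrite (eq_integral _ _ (fun l _ => esym (IE l))).
pose D := supp_fin I; have mD : measurable D := measurable_supp_fin mI.
have [m mE] := sigma_finite_restriction mI I0 Ioo.
have cmE (f : L -> C) : (forall l, ~ D l -> f l = 0) -> cintegral m f = cintegral nu f.
  by move=> f0; congr Complex; congr fine; apply: mE => l Dl; rewrite f0.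
(* The cut to [D] makes integrals over [m] and [nu] coincide. It loses only parameters with I l = 0,
   where rho(.;l) is 0 almost everywhere, and those with I l = +oo, which form the null set [N]. *)
pose gD (z : E * L) := `|g0 z| * \1_D z.2.
have gD0 z : 0 <= gD z by rewrite mulr_ge0// indicE.
have mgD : measurable_fun setT gD.
  apply: measurable_funM; first exact: measurableT_comp.
  exact: (measurableT_comp (measurable_indic mD : measurable_fun setT (\1_D : L -> R)) measurable_snd).
have mgDE : measurable_fun setT (fun z => (gD z)%:E) by exact/measurable_EFinP.
pose J l := (\int[volume n]_x (gD (x, l))%:E)%E.
have mJ : measurable_fun setT J.
  apply: (@measurable_fun_fubini_tonelli_G _ _ _ _ _ (volume n) _ mgDE) => z.
  by rewrite lee_fin.
have gDD l x : D l -> gD (x, l) = `|g0 (x, l)| by move=> Dl; rewrite /gD indicE mem_set ?mulr1.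
have gDND l x : ~ D l -> gD (x, l) = 0.
  by move=> Dl; rewrite /gD indicE memNset ?mulr0.
have JD l : D l -> J l = I l by move=> Dl; apply: eq_integral => x _; rewrite gDD.
have JND l : ~ D l -> J l = 0%E.
  by move=> Dl; apply: integral0_eq => x _; rewrite gDND.
pose N := [set l | I l = +oo%E].
have Nneg : nu.-negligible N.
  have /integrable_ae : nu.-integrable setT I.
    by apply/integrableP; split=> //; under eq_integral do rewrite gee0_abs//.
  move=> /(_ measurableT); apply: negligibleS => l /= Il; rewrite Il.
  by move=> /(_ Logic.I).
have JI l : ~ N l -> J l = I l.
  move=> Nl; have [Dl|Dl] := pselect (D l); first exact: JD.
  rewrite JND//; apply/esym/eqP; rewrite -[_ == _]negbK; apply/negP => Il0; apply: Dl.
  by rewrite /D /supp_fin /= lt0e Il0 I0 ltey; apply/eqP.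
have aeJI : {ae nu, forall l, I l = J l}.
  by apply: negligibleS Nneg => l /=; apply: contra_notP => /JI.
have JQ : (\int[m]_l J l = \int[nu]_l \int[volume n]_x (rho x l)%:E)%E.
  rewrite (eq_integral _ _ (fun l _ => IE l)) (integral_ae_eq mJ aeJI).
  exact: mE.
have Joo : (\int[m]_l J l < +oo)%E by rewrite JQ.
have fi : (volume n \x m)%E.-integrable setT (fun z => (gD z)%:E).
  apply/integrable21ltyP; first by [].
  suff -> : (\int[m]_y \int[volume n]_x `|(gD (x, y))%:E| = \int[m]_l J l)%E by exact: Joo.
  by apply: eq_integral => l _; apply: eq_integral => x _; rewrite /= ger0_norm.
pose W x := \int[m]_l gD (x, l).
have mW : measurable_fun setT W by exact: measurable_Rintegral_param.
have W0 x : 0 <= W x by apply: Rintegral_ge0.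
have WQ : (\int[volume n]_x (W x)%:E = \int[nu]_l \int[volume n]_x (rho x l)%:E)%E.
  rewrite -JQ -(@fubini_tonelli _ _ _ _ _ (volume n) m (fun z => (gD z)%:E))//.
  apply: ae_eq_integral => //.
  - exact/measurable_EFinP.
  - exact: (measurable_fubini_F fi).
  have := ae_integrable1 fi; apply: filterS => x xi _.
  by rewrite /W /Rintegral fineK//; exact: integrable_fin_num.
have iW : vol.-integrable setT (EFin \o W).
  by apply: integrable_lty => //; under eq_integral do rewrite ger0_norm//; rewrite WQ.
have Jlty l : (J l < +oo)%E.
  have [Dl|Dl] := pselect (D l); last by rewrite JND.
  by rewrite JD//; case/andP: Dl.
have ig l : vol.-integrable setT (fun x => (gD (x, l))%:E).
  apply: integrable_lty; first exact: (measurableT_comp mgD (pair2_measurable l)).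
  by under eq_integral do rewrite ger0_norm//; exact: Jlty.
exists W, (fun l x => gD (x, l)), N; split=> //.
  move=> l Nl; split; first exact: ig.
  have [Dl|Dl] := pselect (D l).
    by apply: filterS (rg0 l) => x e; rewrite gDD// -e ger0_norm.
  have mg0l : measurable_fun setT (fun x => (g0 (x, l))%:E).
    by apply/measurable_EFinP; exact: (measurableT_comp mg0 (pair2_measurable l)).
  have /(ae_eq_integral_abs _ measurableT mg0l) : (\int[volume n]_x `|(g0 (x, l))%:E| = 0)%E.
    by rewrite -(JND _ Dl) JI.
  by apply: filterS2 (rg0 l) => x -> /(_ Logic.I) [->]; rewrite gDND.
move=> s xi H HE.
pose k (z : E * L) : C := expi (- (2 * pi * dotrV z.1 xi)) * (gD z)%:C.
have mk : cmeasurable k.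
  apply: cmeasurableM; last exact: cmeasurable_real.
  exact: (cmeasurable_fourier_kernel measurable_fst (measurable_cst xi)).
have kn z : normc (k z) = gD z by rewrite Normc.normcM normc_expi mul1r normc_real ger0_norm.
have fgE l : fourier (fun x => (gD (x, l))%:C) xi = cintegral vol (fun x => k (x, l)) by [].
have mfg : cmeasurable (fun l => cintegral vol (fun x => k (x, l))).
  have mk' : cmeasurable (fun z : L * E => k (z.2, z.1)).
    exact: (cmeasurable_comp (@measurable_swap _ _ L E) mk).
  exact: (cmeasurable_cintegral_param (volume n) mk').
have fg0 l : ~ D l -> cintegral vol (fun x => k (x, l)) = 0.
  move=> Dl; rewrite (_ : (fun x => _) = fun x => 0%:C); last first.
    by apply/funext => x; rewrite /k gDND// mulr0.
  by rewrite cintegral_real Rintegral_cst// mul0r.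
have ifg : cintegrable m (fun l => cintegral vol (fun x => k (x, l))).
  have iJ : m.-integrable setT (fun l => (fine (J l))%:E).
    apply: integrable_lty; first exact: measurableT_comp (@fine_measurable R setT measurableT) mJ.
    rewrite (eq_integral J) ?Joo// => l _; rewrite ger0_norm ?fine_ge0//; last first.
      by apply: integral_ge0 => x _; rewrite lee_fin.
    by rewrite fineK// ge0_fin_numE// integral_ge0// => x _; rewrite lee_fin.
  apply: (cintegrable_dom mfg (integrable_mulr 2 iJ)) => l.
  apply: (normc_cintegral_le (h := fun x => gD (x, l))) => // [|x]; last by rewrite kn.
  apply: (cintegrable_dom _ (ig l)) => [|x]; last by rewrite kn.
  exact: (cmeasurable_comp (pair2_measurable l) mk).
transitivity (cintegral nu (fun l => s * cintegral vol (fun x => k (x, l)))).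
  apply: cintegral_ae_eq; first by apply: cmeasurableM => //; exact: cmeasurable_cst.
  by apply: negligibleS Nneg => l /=; apply: contra_notP => /HE ->.
rewrite -cmE; last by move=> l Dl; rewrite fg0// mulr0.
rewrite (cintegralZ s ifg); congr (_ * _).
rewrite -(@cintegral_fubini _ _ _ _ _ (volume n) m k mk); last first.
  rewrite (eq_integral (fun x => \int[m]_y (gD (x, y))%:E)%E); last first.
    by move=> x _; apply: eq_integral => l _; rewrite kn.
  by rewrite (@fubini_tonelli _ _ _ _ _ (volume n) m (fun z => (gD z)%:E)).
apply/esym; apply: cintegral_ae_eq.
  exact: (cmeasurable_cintegral_param m mk).
have := ae_integrable1 fi; apply: filterS => x xi'.
transitivity (cintegral m (fun l => expi (- (2 * pi * dotrV x xi)) * (gD (x, l))%:C)); last by [].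
by rewrite (cintegralZ _ (cintegrable_real xi')) cintegral_real.
Qed.

End parameter_reduction.

(** * Pointwise vanishing of transforms off the spectrum *)

Section fourier_vanishing.
Context {R : realType} {n : nat}.
Local Notation E := 'rV[R]_n.
Local Notation C := R[i].
Local Notation vol := (volume n : {measure set E -> \bar R}).
Implicit Types (h p : E -> R) (x a xi : E) (K : set E).

(* Integrating against Gaussians: the integral of [h * gaussk k] vanishes with that of [h],
   and converges to [h a]. *)
Lemma integral0_continuous_eq0 h a : continuous h -> (forall x, 0 <= h x) ->
  vol.-integrable setT (EFin \o h) -> \int[volume n]_x h x = 0 -> h a = 0.
Proof.
move=> ch h0 ih int0; have mh := continuous_measurable_rV ch.
have igh (k : R) : 0 < k -> vol.-integrable setT (fun x => (h x * gaussk k (x - a))%:E) /\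
    \int[volume n]_x (h x * gaussk k (x - a)) = 0.
  move=> k0; have ik : vol.-integrable setT (fun x => (h x * gaussk k (x - a))%:E).
    apply: (integrable_mul_bounded ih (measurable_gaussk_shift k a)) => x.
    by rewrite ger0_norm ?gaussk_ge0 ?(ltW k0)//; exact: gaussk_leX.
  split=> //; apply/eqP; rewrite eq_le; apply/andP; split; last first.
    by apply: Rintegral_ge0 => x _; rewrite mulr_ge0 ?gaussk_ge0 ?(ltW k0).
  rewrite -(mulr0 (k ^+ n)) -int0 -RintegralZl//; apply: le_Rintegral => //.
    exact: integrable_mulr.
  by move=> x _; rewrite [leRHS]mulrC ler_wpM2l ?gaussk_leX.
have := gauss_approx mh (ch a) (igh 1 ltr01).1.
rewrite (_ : (fun k : nat => _) = cst 0).
  by move=> /(cvg_lim (@norm_hausdorff _ _)) <-; rewrite (cvg_lim _ (cvg_cst _)).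
by apply/funext => k; exact: (igh _ (ltr0Sn _ k)).2.
Qed.

(** If p(xi) were nonzero, p(xi) p(x) would be positive near xi, and a bump there would make a
    nonnegative continuous function of integral 0 that is nonzero at xi. *)
Lemma bump_integral0_eq0 K p xi B : closed K -> ~ K xi -> continuous p ->
  (forall x, `|p x| <= B) ->
  (forall phi : E -> R, pderivs_in (rapid 0) phi -> schwartz_off K (fun x => (phi x)%:C) ->
    \int[volume n]_x (p x * phi x) = 0) -> p xi = 0.
Proof.
move=> cK Kxi cp pB int0; apply/eqP; apply: contraT => pxi.
have [r r0 hr] : exists2 r : R, 0 < r & forall x, `|x - xi| < r -> ~ K x /\ 0 <= p xi * p x.
  have nK : nbhs xi (~` K) by apply: open_nbhs_nbhs; split => //; exact: closed_openC.
  have np : \forall x \near xi, 0 < p xi * p x.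
    have : (fun x => p xi * p x) @ xi --> p xi * p xi.
      exact: (cvgMr (cp xi)).
    move=> /cvgr_gt; apply.
    by rewrite lt0r mulf_neq0//= -expr2 sqr_ge0.
  have : nbhs (xi : E) (~` K `&` [set x | 0 < p xi * p x]) by exact: filterI.
  move=> /nbhs_normP[r /= r0 hr].
  exists r => // x xr; have [Kx px] : (~` K `&` [set x | 0 < p xi * p x]) x.
    by apply: hr; rewrite /= distrC.
  by split=> //; exact: ltW.
(* Half of the radius keeps the closure of the bump's support inside the ball that avoids K. *)
have r2 : 0 < r / 2 by rewrite divr_gt0.
have [phi [sphi phi0 phioff phion]] := bump_exists xi r2.
have off : schwartz_off K (fun x => (phi x)%:C).
  split; first exact: schwartz_real.
  move=> x clx; apply: (hr x _).1; rewrite ltNge; apply/negP => rx.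
  have /clx[y [/= phiy yx]] : nbhs x (fun y : E => `|x - y| < r / 2).
    by apply/(@nbhs_normP R E); exists (r / 2).
  move: phiy; rewrite phioff ?eqxx// leNgt; apply/negP => yxi.
  move: rx; rewrite leNgt => /negP; apply.
  have -> : x - xi = (x - y) + (y - xi) by rewrite addrA subrK.
  by rewrite (le_lt_trans (ler_normD _ _))// [ltRHS]splitr ltrD.
pose h x := p xi * p x * phi x.
have mphi := smooth_measurable sphi.1.
have cphi : continuous phi by exact: smooth_continuous sphi.1.
have iphi := rapid_integrable (lexx 0) mphi (sphi.2 [::]).
have ipphi : vol.-integrable setT (fun x => (p x * phi x)%:E).
  under eq_fun do rewrite mulrC.
  exact: integrable_mul_bounded iphi (continuous_measurable_rV cp) pB.
have hE : h = fun x => p xi * (p x * phi x) by apply/funext => x; rewrite /h mulrA.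
have : h xi = 0.
  apply: integral0_continuous_eq0.
  - by move=> x; exact: (cvgM (cvgMr (cp x)) (cphi x)).
  - move=> x; have [xr|xr] := ltP `|x - xi| (r / 2); last by rewrite /h phioff// mulr0.
    rewrite mulr_ge0// (hr x _).2// (lt_le_trans xr)// ler_pdivrMr// ler_peMr ?(ltW r0)//.
    by rewrite ler1n.
  - by rewrite hE; exact: integrable_mulr.
  - by rewrite hE RintegralZl// int0// mulr0.
move/eqP; rewrite /h !mulf_eq0 (negPf pxi)/= => /eqP phixi.
by have := phion xi; rewrite subrr normr0 phixi ltxx => /(_ r2).
Qed.

(** For integrable f the distributional transform is the continuous function [fourier f], by the
    multiplication formula; real and imaginary parts are then tested with bumps. *)
Lemma fourier_eq0_off K (f : E -> C) xi : closed K -> cintegrable vol f ->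
  (forall phi, schwartz_off K phi -> cintegral vol (fun x => f x * fourier phi x) = 0) ->
  ~ K xi -> fourier f xi = 0.
Proof.
move=> cK ifc f0 Kxi; have [cR cI] := continuous_fourier ifc.
have fB x : normc (fourier f x) <= 2 * \int[volume n]_x normc (f x) := normc_fourier_le x ifc.
have int0 (phi : E -> R) : pderivs_in (rapid 0) phi -> schwartz_off K (fun x => (phi x)%:C) ->
    cintegral vol (fun x => fourier f x * (phi x)%:C) = 0.
  move=> sphi off; rewrite -fourier_mult ?f0//.
  exact: schwartz_cintegrable (schwartz_real sphi).
apply: complex_ext.
  apply: (bump_integral0_eq0 cK Kxi cR (fun x => le_trans (normr_Re_le _) (fB x))) => phi sphi off.
  transitivity (Rea (cintegral vol (fun x => fourier f x * (phi x)%:C))); last by rewrite int0.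
  by apply: eq_Rintegral => x _; rewrite [in RHS]mulrC Re_realM mulrC.
apply: (bump_integral0_eq0 cK Kxi cI (fun x => le_trans (normr_Im_le _) (fB x))) => phi sphi off.
transitivity (Ima (cintegral vol (fun x => fourier f x * (phi x)%:C))); last by rewrite int0.
by apply: eq_Rintegral => x _; rewrite [in RHS]mulrC Im_realM mulrC.
Qed.

End fourier_vanishing.

(** * From a family of extremal functions to a single one *)

Section extremal_pair.
Context {R : realType} {n : nat} {dL : measure_display} {L : measurableType dL}.
Local Notation E := 'rV[R]_n.
Local Notation C := R[i].
Local Notation vol := (volume n : {measure set E -> \bar R}).

Lemma compact_bounded_rV (K : set E) : compact K -> exists A : R, forall x, K x -> `|x| < A.
Proof.
move=> /compact_bounded[M [_ hM]]; exists (M + 2) => x Kx.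
have := hM (M + 1); rewrite ltrDl ltr01 => /(_ isT) /(_ x Kx) /le_lt_trans; apply.
by rewrite ltrD2l ltr1n.
Qed.

Variables (K : set E) (Kcompact : compact K) (G : E -> L -> R) (F : 'rV[C]_n -> L -> C).
Variables (nu : {measure set L -> \bar R}) (calG : E -> R) (sg : R) (rho : E -> L -> R).
Hypothesis GL1 : forall l, L1 (fun x => G x l).
Hypothesis Fentire : forall l, entire (fun z => F z l).
Hypothesis Ftype : forall l, exp_type K (fun z => F z l).
Hypothesis rho0 : forall x l, 0 <= rho x l.
Hypothesis Freal : forall x l, F (rV_toC x) l = (G x l + sg * rho x l)%:C.

Lemma closedK : closed K.
Proof. by apply: compact_closed => //; exact: norm_hausdorff. Qed.

(** [fl], the restriction of F(.;l), is integrable because it is G(.;l) + sg rho(.;l); its transform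
    therefore vanishes pointwise off K, and additivity of the transform leaves the stated
    relation. *)
Lemma fourier_G_off (l : L) (g : E -> R) xi : vol.-integrable setT (EFin \o g) ->
  {ae volume n, forall x, rho x l = g x} -> ~ K xi ->
  fourier (fun x => (G x l)%:C) xi = (- sg)%:C * fourier (fun x => (g x)%:C) xi.
Proof.
move=> ig aeg Kxi; pose fl x := Rea (F (rV_toC x) l).
have flE x : F (rV_toC x) l = (fl x)%:C by rewrite /fl Freal.
have cfl : continuous fl := entire_continuous_real (Fentire l) Re_lipschitz.
have mfl := continuous_measurable_rV cfl.
have mg : measurable_fun setT g by apply/measurable_EFinP; exact: measurable_int ig.
have GE x : G x l = fl x - sg * rho x l by rewrite {1}/fl Freal /= addrK.
have [[G' mG' aeG] Goo] := GL1 l.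
have iG' : vol.-integrable setT (EFin \o G').
  apply: integrable_lty => //; apply: le_lt_trans Goo.
  rewrite le_eqVlt; apply/orP; left; apply/eqP/esym/integral_ae_eq.
    by apply/measurable_EFinP; exact: measurableT_comp.
  by apply: filterS aeG => x ->.
have ifl : vol.-integrable setT (EFin \o fl).
  have iH : vol.-integrable setT (fun x => (G' x + sg * g x)%:E).
    by apply: integrable_addr => //; exact: integrable_mulr.
  apply: integrable_lty => //; have /integrableP[mH] := iH; apply: le_lt_trans.
  rewrite le_eqVlt; apply/orP; left; apply/eqP/integral_ae_eq; first exact: measurableT_comp.
  apply: filterS2 aeG aeg => x eG eg; rewrite -eG -eg /= GE.
  by rewrite subrK.
have ifl' := cintegrable_real ifl; have ig' := cintegrable_real ig.
transitivity (fourier (fun x => (fl x)%:C + (- sg)%:C * (g x)%:C) xi).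
  apply: cintegral_ae_eq.
    apply: (cintegrable_measurable (mu := vol)); apply: cintegrable_fourier_integrand.
    by apply: cintegrableD => //; exact: cintegrableZ.
  by apply: filterS aeg => x eg; rewrite GE eg -rmorphM -rmorphD/= mulNr.
rewrite fourierD//; last exact: cintegrableZ.
rewrite fourierZ// (fourier_eq0_off closedK ifl' _ Kxi) ?add0r// => phi off.
have := (Ftype l).2 phi off; rewrite /fourier_distr /distr_of.
by under eq_cintegral do rewrite flE.
Qed.

Lemma extremal_function_of_family : sg ^+ 2 = 1 ->
  jointly_measurable rho ->
  (\int[nu]_l \int[volume n]_x (rho x l)%:E < +oo)%E ->
  continuous calG -> tempered_fun (fun x => (calG x)%:C) ->
  (forall phi, schwartz_off K phi ->
     fourier_distr (distr_of (fun x => (calG x)%:C)) phi =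
     cintegral (volume n) (fun x =>
       cintegral nu (fun l => fourier (fun y => (G y l)%:C) x) * phi x)) ->
  exists M : 'rV[C]_n -> C, [/\ real_entire M, exp_type K M,
    forall x, 0 <= sg * (Rea (M (rV_toC x)) - calG x) &
    (\int[volume n]_x (sg * (Rea (M (rV_toC x)) - calG x))%:E =
     \int[nu]_l \int[volume n]_x (rho x l)%:E)%E].
Proof.
move=> sg2 mrho rhooo cG tG hatG.
have [W [g [N [_ gN [iW W0 WQ] hatW]]]] :=
  jointly_measurable_reduction rho0 mrho rhooo.
have [A KA] := compact_bounded_rV Kcompact.
pose U x := sg * W x.
have iU : vol.-integrable setT (EFin \o U) by exact: integrable_mulr.
have sU x : sg * U x = W x by rewrite /U mulrA -expr2 sg2 mul1r.
have iW' := cintegrable_real iW.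
have star phi : schwartz_off K phi ->
    cintegral vol (fun x => (calG x)%:C * fourier phi x) +
    cintegral vol (fun x => (U x)%:C * fourier phi x) = 0.
  move=> off; have := hatG _ off; rewrite {1}/fourier_distr {1}/distr_of => ->.
  have ip := schwartz_cintegrable off.1.
  rewrite (fourier_mult (cintegrable_real iU) ip) .
  have iUc := cintegrable_real iU.
  have UE x : fourier (fun y => (U y)%:C) x = sg%:C * fourier (fun y => (W y)%:C) x.
    rewrite -fourierZ//; congr (fourier _ x); apply/funext => y.
    by rewrite -rmorphM.
  have hatE x : cintegral nu (fun l => fourier (fun y => (G y l)%:C) x) * phi x =
      - (fourier (fun y => (U y)%:C) x * phi x).
    (* The transforms of the G(.;l) are known off K only; where phi is nonzero, the support
       condition puts x there. *)
    have [->|phix] := eqVneq (phi x) 0; first by rewrite !mulr0 oppr0.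
    have Kx : ~ K x by apply: off.2; exact: subset_closure.
    rewrite (hatW (- sg)%:C x) ?UE ?rmorphN ?mulNr// => l Nl.
    have [ig aeg] := gN l Nl.
    by rewrite (fourier_G_off ig aeg Kx) rmorphN.
  have iUphi : cintegrable vol (fun x => fourier (fun y => (U y)%:C) x * phi x).
    apply: (cintegrable_dom _ (integrable_mulr (2 * \int[volume n]_x normc (U x)%:C)
      (cintegrable_norm ip))) => [|x].
      apply: cmeasurableM; last exact: schwartz_measurable off.1.
      exact: cmeasurable_fourier (cintegrable_measurable iUc).
    by rewrite Normc.normcM ler_wpM2r ?normc_ge0// normc_fourier_le.
  by rewrite (eq_cintegral vol hatE) (cintegralN iUphi) addNr.
have [M [reM eM M0 MQ]] := extremal_function cG tG iU KA star sg2
  (fun x => eq_ind_r (fun r => 0 <= r) (W0 x) (sU x)).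
exists M; split=> //; rewrite MQ -WQ.
by apply: eq_integral => x _; rewrite sU.
Qed.

End extremal_pair.

Theorem theorem9 (R : realType) (n : nat) (K : set 'rV[R]_n)
    (Kcompact : compact K)
    (Kconvex : convex_set (K : set (convex_lmodType 'rV[R]_n)))
    (dL : measure_display) (L : measurableType dL)
    (G : 'rV[R]_n -> L -> R) (GL1 : forall l, L1 (fun x => G x l))
    (F : 'rV[R[i]]_n -> L -> R[i])
    (Fentire : forall l, entire (fun z => F z l))
    (Ftype : forall l, exp_type K (fun z => F z l))
    (nu : {measure set L -> \bar R})
    (FGmeas : jointly_measurable
       (fun x l => Normc.normc (F (rV_toC x) l - (G x l)%:C)))
    (FGint : (\int[nu]_l \int[volume n]_x
       (Normc.normc (F (rV_toC x) l - (G x l)%:C))%:E < +oo)%E)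
    (hatGint : forall phi, schwartz_off K phi ->
       (\int[nu]_l \int[volume n]_x
          (Normc.normc (fourier (fun y => (G y l)%:C) x * phi x))%:E < +oo)%E)
    (calG : 'rV[R]_n -> R) (calGcont : continuous calG)
    (calGtemp : tempered_fun (fun x => (calG x)%:C))
    (hatcalG : forall phi, schwartz_off K phi ->
       fourier_distr (distr_of (fun x => (calG x)%:C)) phi =
       cintegral (volume n) (fun x =>
         cintegral nu (fun l => fourier (fun y => (G y l)%:C) x) * phi x)) :
  ((forall x l, (G x l)%:C <= F (rV_toC x) l) ->
   exists M : 'rV[R[i]]_n -> R[i],
     [/\ real_entire M, exp_type K M,
         forall x, calG x <= complex.Re (M (rV_toC x)) &
         (\int[volume n]_x (complex.Re (M (rV_toC x)) - calG x)%:E =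
          \int[nu]_l \int[volume n]_x
            (Normc.normc (F (rV_toC x) l - (G x l)%:C))%:E)%E])
  /\
  ((forall x l, F (rV_toC x) l <= (G x l)%:C) ->
   exists M : 'rV[R[i]]_n -> R[i],
     [/\ real_entire M, exp_type K M,
         forall x, complex.Re (M (rV_toC x)) <= calG x &
         (\int[volume n]_x (calG x - complex.Re (M (rV_toC x)))%:E =
          \int[nu]_l \int[volume n]_x
            (Normc.normc (F (rV_toC x) l - (G x l)%:C))%:E)%E]).

Proof.
pose rho (x : 'rV[R]_n) (l : L) := normc (F (rV_toC x) l - (G x l)%:C).
have rho0 x l : 0 <= rho x l by exact: normc_ge0.
(* The order of R[i] compares only numbers with equal imaginary parts, so either inequality between
   F and the real G forces F(.;l) to be real on R^n. *)
have rhoE x l : Ima (F (rV_toC x) l) = 0 ->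
    F (rV_toC x) l = (Rea (F (rV_toC x) l))%:C /\
    rho x l = `|Rea (F (rV_toC x) l) - G x l|.
  move=> im0; have FE : F (rV_toC x) l = (Rea (F (rV_toC x) l))%:C by exact: complex_ext.
  by split=> //; rewrite /rho {1}FE -rmorphB normc_real.
split=> FG.
  have Freal x l : F (rV_toC x) l = (G x l + 1 * rho x l)%:C.
    have := FG x l; rewrite lecE /= => /andP[/eqP/rhoE[FE ->] le].
    by rewrite mul1r ger0_norm ?subr_ge0// addrC subrK -FE.
  have [M [reM eM M0 MQ]] := extremal_function_of_family Kcompact GL1 Fentire Ftype rho0 Freal
    (expr1n _ _) FGmeas FGint calGcont calGtemp hatcalG.
  exists M; split=> // [x|]; first by have := M0 x; rewrite mul1r subr_ge0.
  by rewrite -MQ; apply: eq_integral => x _; rewrite mul1r.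
have Freal x l : F (rV_toC x) l = (G x l + -1 * rho x l)%:C.
  have := FG x l; rewrite lecE /= => /andP[/eqP/esym/rhoE[FE ->] le].
  by rewrite mulN1r ler0_norm ?subr_le0// opprK addrC subrK -FE.
have sg2 : (-1) ^+ 2 = 1 :> R by rewrite sqrrN expr1n.
have [M [reM eM M0 MQ]] := extremal_function_of_family Kcompact GL1 Fentire Ftype rho0 Freal
  sg2 FGmeas FGint calGcont calGtemp hatcalG.
exists M; split=> // [x|]; first by have := M0 x; rewrite mulN1r opprB subr_ge0.
by rewrite -MQ; apply: eq_integral => x _; rewrite mulN1r opprB.
Qed.
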